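(* Let $t>0$ and $\kappa\in(-1,1)$. Let $$\Sigma_{\kappa,t}:=\{z\in\mathbb{D}:\psi_{\kappa,t}(z)\in\mathbb{D}\}=\left\{z\in\mathbb{D}:\ \frac{a^2(y)}{a^2(y)-\kappa^2}\,\alpha^{-1}[\xi_{2t}(a(y))]\in\mathbb{C}\setminus[1,\infty),\ y=H_0(z)\right\}$$ be the analyticity region of $\psi_{\kappa,t}$, and let $\Lambda_{\kappa,t}$ be the connected component of $\Sigma_{\kappa,t}$ containing $z=0$. Then $\psi_{\kappa,t}$ is a one-to-one map from $\Lambda_{\kappa,t}$ onto $\mathbb{D}$.
   Context: $\mathbb{D}$ is the open unit disc. All square roots are principal branches. Define $$\alpha(z)=\frac{1-\sqrt{1-z}}{1+\sqrt{1-z}},\quad z\in\mathbb{C}\setminus[1,\infty),$$ an analytic bijection from $\mathbb{C}\setminus[1,\infty)$ onto $\mathbb{D}$ with inverse $\alpha^{-1}(z)=\frac{4z}{(1+z)^2}$ (this rational formula is used for $\alpha^{-1}(z)$ at every $z\in\mathbb{C}$, with value $\infty$ at $z=-1$). Further define $$H_0(z)=\frac{1+z}{1-z},\qquad a(y)=\sqrt{\kappa^2+(1-\kappa^2)y^2},\qquad \xi_{2t}(u)=\frac{u-1}{u+1}e^{tu}.$$ The flow $\psi_{\kappa,t}$ is given by $$\psi_{\kappa,t}(z)=\alpha\left(\frac{a^2(y)}{a^2(y)-\kappa^2}\,\alpha^{-1}[\xi_{2t}(a(y))]\right),\qquad y=H_0(z),$$ at those $z\in\mathbb{D}$ for which the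 argument of $\alpha$ lies in $\mathbb{C}\setminus[1,\infty)$. *)

(* Defs.v *)
From HB Require Import structures.
From mathcomp Require Import all_boot all_order all_algebra.
From mathcomp Require Import complex.
From mathcomp Require Import all_classical all_reals all_analysis.

Set Implicit Arguments.
Unset Strict Implicit.
Unset Printing Implicit Defensive.

Import Order.TTheory GRing.Theory Num.Theory numFieldNormedType.Exports.
Local Open Scope classical_set_scope.
Local Open Scope ring_scope.
Local Open Scope complex_scope.

(* The order on R[i] compares real parts of numbers with equal imaginary part,
   so [1 <= w] says that w is real and at least 1.  The library's [sqrtc] is
   the principal branch: its real part is nonnegative, and its imaginary part
   has the sign of that of the argument. *)

Definition unit_disc (R : realType) : set R[i] := [set z | `|z| < 1].

(* C \ [1, oo) *)
Definition slit_plane (R : realType) : set R[i] := [set w | ~ 1 <= w].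

Definition cexp (R : realType) (z : R[i]) : R[i] :=
  (expR (complex.Re z))%:C * (cos (complex.Im z) +i* sin (complex.Im z)).

Definition alpha (R : realType) (z : R[i]) : R[i] :=
  (1 - sqrtc (1 - z)) / (1 + sqrtc (1 - z)).

(* [None] is the point at infinity. *)
Definition alpha_inv (R : realType) (z : R[i]) : option R[i] :=
  if z == -1 then None else Some (4 * z / (1 + z) ^+ 2).

Definition H0 (R : realType) (z : R[i]) : R[i] := (1 + z) / (1 - z).

Definition a (R : realType) (kappa : R) (y : R[i]) : R[i] :=
  sqrtc ((kappa ^+ 2)%:C + (1 - kappa ^+ 2)%:C * y ^+ 2).

(* xi t is the function written xi_{2t}. *)
Definition xi (R : realType) (t : R) (u : R[i]) : R[i] :=
  (u - 1) / (u + 1) * cexp (t%:C * u).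

(* The argument of alpha in psi.  For z in the disc, y = H0 z has positive real
   part, so the factor a^2 / (a^2 - kappa^2) is finite and nonzero and its
   product with infinity is infinity; a + 1 is nonzero as well. *)
Definition psi_arg (R : realType) (kappa t : R) (z : R[i]) : option R[i] :=
  let u := a kappa (H0 z) in
  omap (fun w => u ^+ 2 / (u ^+ 2 - kappa%:C ^+ 2) * w) (alpha_inv (xi t u)).

Definition psi_dom (R : realType) (kappa t : R) : set R[i] :=
  [set z | unit_disc z /\
           exists2 w, psi_arg kappa t z = Some w & slit_plane w].

(* The value of psi is meaningful on [psi_dom] only. *)
Definition psi (R : realType) (kappa t : R) (z : R[i]) : R[i] :=
  alpha (odflt 0 (psi_arg kappa t z)).

(* The z in the disc at which psi is defined, with value in the disc. *)
Definition Sigma (R : realType) (kappa t : R) : set R[i] :=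
  [set z | psi_dom kappa t z /\ unit_disc (psi kappa t z)].

(* The topology on complex numbers is carried by [R[i]^o]. *)
Definition Lambda (R : realType) (kappa t : R) : set R[i] :=
  @connected_component R[i]^o (Sigma kappa t) 0.

(* Main.v *)
Require Import Defs.
From mathcomp Require Import all_boot all_order all_algebra.
From mathcomp Require Import complex.
From mathcomp Require Import all_classical all_reals all_analysis.
From mathcomp Require Import ring lra.
Set Implicit Arguments.
Unset Strict Implicit.
Unset Printing Implicit Defensive.
Import Order.TTheory GRing.Theory Num.Theory numFieldNormedType.Exports.
Local Open Scope classical_set_scope.
Local Open Scope ring_scope.
Local Open Scope complex_scope.

(** Write u = a(y).  The argument of alpha in the flow is
<<
  omega(u,t) = (u^2 - 1) / ((u^2 - kappa^2) delta(u,t)^2),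
  delta(u,s) = cosh(s u / 2) - sinh(s u / 2) / u,
>>
and z |-> u maps the upper half of the disc onto the open first quadrant, where
u^2 lies in the upper half-plane.  Since alpha is a bijection from the slit
plane onto the disc, it has to be shown that omega is a bijection from Lambda
onto the slit plane.  Everything is symmetric under complex conjugation.

Dynamics in time.  For fixed u, delta solves delta'' = (u^2 / 4) delta.  Put
gamma = - 2 delta' / delta; then omega' = gamma omega, Im gamma < 0 for u in the
quadrant and s > 0, and conservation of energy reads
(1 - omega) (u^2 - kappa^2) = gamma^2 - kappa^2 ([omega_gam]).  Call (u,s)
admissible if Im omega > 0 and Im ((1 - omega) conj gamma) < 0.  For u in the
quadrant, admissibility at t implies admissibility at all earlier times
([admissible_backward]), and this fixes the sector of delta(u,s) / delta(u,t).

Injectivity.  If omega(u1,t) = omega(u2,t), subtracting the two energy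
identities expresses 1 - omega by the Wronskian of delta(u1,.) and
delta(u2,.), which is a multiple of the integral of their product.  For
admissible u1, u2 the sectors found above put that integral in a half-plane
where the identity is impossible ([omega_inj]).  The case u1 = u2 of the same
argument shows that the derivative of omega in u does not vanish at admissible
points ([omega_crit]).

The part of Lambda in the upper half of the disc consists of admissible points.
On Sigma, the function [branch] is
continuous, its square is 1 / ((1 - kappa^2) (1 - omega)), and its real part
does not vanish.  At z = 0 the real part is positive, so by connectedness it is
positive on Lambda ([Lambda_branch]), and this implies admissibility
([admissible_of_branch]).  For real u, it implies gamma > 0, which replaces
admissibility there.  Together this gives injectivity on Lambda
([Lambda_omega_inj]).

Surjectivity.  Let Im W > 0.  The modulus of (omega - W) / (omega - conj W)
attains a minimum on the closure of the set of all u in the quadrant that come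
from Lambda; this set is bounded by [admissible_bounded].  The modulus is
smaller than 1 on the set and equal to 1 on the coordinate axes, so the minimum
is attained inside, and there it must be 0 because the derivative of omega is
not 0 ([upper_surj]).  Real values W < 1 are reached by moving u along the real
axis from u = 1, where omega = 0 ([real_surj]). *)

(** * Complex numbers by coordinates, continuity, the exponential *)

Section ComplexBasics.
Variable R : realType.
Local Notation C := (R[i]).
Local Notation Co := (R[i]^o).
Local Notation Re := complex.Re.
Local Notation Im := complex.Im.
Local Notation cj := (@conjc R).
Implicit Types (z w : C).

Lemma ReD z w : Re (z + w) = Re z + Re w. Proof. by case: z; case: w. Qed.
Lemma ImD z w : Im (z + w) = Im z + Im w. Proof. by case: z; case: w. Qed.
Lemma ReN z : Re (- z) = - Re z. Proof. by case: z. Qed.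
Lemma ImN z : Im (- z) = - Im z. Proof. by case: z. Qed.
Lemma ReM z w : Re (z * w) = Re z * Re w - Im z * Im w. Proof. by case: z; case: w. Qed.
Lemma ImM z w : Im (z * w) = Re z * Im w + Im z * Re w. Proof. by case: z; case: w. Qed.
Lemma ReJ z : Re (cj z) = Re z. Proof. by case: z. Qed.
Lemma ImJ z : Im (cj z) = - Im z. Proof. by case: z. Qed.
Lemma Re1 : Re (1 : C) = 1. Proof. by []. Qed.
Lemma Im1 : Im (1 : C) = 0. Proof. by []. Qed.
Lemma ReV z : Re (z^-1) = Re z / (Re z ^+ 2 + Im z ^+ 2). Proof. by case: z. Qed.
Lemma ImV z : Im (z^-1) = - Im z / (Re z ^+ 2 + Im z ^+ 2). Proof. by case: z => a b /=; rewrite mulNr. Qed.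
Lemma ReC (x : R) : Re x%:C = x. Proof. by []. Qed.
Lemma ImC (x : R) : Im x%:C = 0. Proof. by []. Qed.
Lemma natC n : (n%:R : C) = (n%:R : R)%:C. Proof. by rewrite rmorph_nat. Qed.
Lemma Re_nat n : Re (n%:R : C) = n%:R. Proof. by rewrite natC. Qed.
Lemma Im_nat n : Im (n%:R : C) = 0. Proof. by rewrite natC. Qed.
Lemma complexP z w : Re z = Re w -> Im z = Im w -> z = w. Proof. case: z; case: w => a b c d /= -> ->. by []. Qed.

Lemma normc_le_ReIm z : `|z| <= (`|Re z| + `|Im z|)%:C.
Proof.
rewrite {1}(complexE z). apply: (le_trans (ler_normD _ _)).
rewrite normrM.
have -> : `|'i%C : C| = 1. by rewrite normc_def /= expr0n expr1n add0r sqrtr1.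
rewrite mul1r rmorphD /=.
have H (x : R) : `|x%:C| = (`|x|)%:C by rewrite normc_def /= expr0n addr0 sqrtr_sqr.
by rewrite !H.
Qed.

Lemma Re_le_normc z : (`|Re z|)%:C <= `|z|.
Proof. exact: normc_ge_Re. Qed.

Lemma Im_le_normc z : (`|Im z|)%:C <= `|z|.
Proof. rewrite normc_def lecR -sqrtr_sqr. apply: ler_wsqrtr. by rewrite lerDr sqr_ge0. Qed.

(** Neighbourhoods in [R[i]^o] through boxes in the coordinates, so that
    estimates on real and imaginary parts apply directly. *)
Definition cnear (z : C) (P : C -> Prop) :=
  exists2 e : R, 0 < e & forall x, `|Re x - Re z| < e -> `|Im x - Im z| < e -> P x.

Lemma cnear_self z P : cnear z P -> P z.
Proof. by move=> [e e0 H]; apply: H; rewrite subrr normr0. Qed.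

Lemma cnearS z (P P' : C -> Prop) : (forall x, P x -> P' x) -> cnear z P -> cnear z P'.
Proof. by move=> PQ [e e0 H]; exists e => // x h1 h2; exact/PQ/H. Qed.

Lemma cnearI z (P P' : C -> Prop) : cnear z P -> cnear z P' -> cnear z (fun x => P x /\ P' x).
Proof.
move=> [d1 d10 hd1] [d2 d20 hd2].
exists (Num.min d1 d2); first by rewrite lt_min d10.
move=> x; rewrite !lt_min => /andP[a1 a2] /andP[b1 b2]; split; [exact: hd1|exact: hd2].
Qed.

Lemma nbhs_boxP (z : C) (P : set C) : @nbhs Co Co z P <-> cnear z P.
Proof. split.
 rewrite -(@nbhs_ballE C Co). move=> [e /= e0 H].
 move: e0; rewrite ltcE /= => /andP[/eqP ie re].
 exists (Re e / 2); first by rewrite divr_gt0.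
 move=> x h1 h2. apply: H => /=. rewrite /ball/=.
 apply: (le_lt_trans (normc_le_ReIm _)).
 have -> : e = (Re e)%:C by apply: complexP.
 rewrite ltcR !(ReD,ImD,ReN,ImN). rewrite distrC (distrC (Im z)). lra.
move=> [e e0 H]. rewrite -(@nbhs_ballE C Co). exists e%:C => /=. by rewrite ltcR.
move=> x /= hx; rewrite /ball/= in hx. apply: H; rewrite -ltcR.
 apply: le_lt_trans (hx). apply: le_trans (Re_le_normc _) => /=. by rewrite ReD ReN distrC.
 apply: le_lt_trans (hx). apply: le_trans (Im_le_normc _) => /=. by rewrite ImD ImN distrC.
Qed.

(** Continuity for the topology of [R[i]^o], with values in the complex and in
    the real numbers ([rcont]). *)
Definition ccont (f : C -> C) (z : C) : Prop := @continuous_at Co Co z f.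

Definition rcont (f : C -> R) (z : C) : Prop := @continuous_at Co R z f.

Lemma ccontM f g z : ccont f z -> ccont g z -> ccont (fun x => f x * g x) z.
Proof. rewrite /ccont/continuous_at => hf hg. apply: (@cvgM C Co _ _ f g _ _ hf hg). Qed.

Lemma ccontD f g z : ccont f z -> ccont g z -> ccont (fun x => f x + g x) z.
Proof. rewrite /ccont/continuous_at => hf hg. apply: (@cvgD C Co Co _ _ f g _ _ hf hg). Qed.

Lemma ccontN f z : ccont f z -> ccont (fun x => - f x) z.
Proof. rewrite /ccont/continuous_at => hf. exact: (@cvgN C Co Co _ _ f _ hf). Qed.

Lemma ccontV (f:C->C) z : f z != 0 -> ccont f z -> ccont (fun x => (f x)^-1) z.
Proof. rewrite /ccont/continuous_at => h hf. exact: (@cvgV C Co _ _ f _ h hf). Qed.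

Lemma ccont_id z : ccont (fun x => x) z.
Proof. exact: (@cvg_id Co (nbhs (z:Co))). Qed.

Lemma ccont_cst k z : ccont (fun x => k) z.
Proof. exact: (@cst_continuous Co Co k z). Qed.

Lemma ccont_comp f g z : ccont f z -> ccont g (f z) -> ccont (fun x => g (f x)) z.
Proof. move=> hf hg. exact: (@continuous_comp Co Co Co f g z hf hg). Qed.

Lemma rcontP f z : rcont f z <-> forall e : R, 0 < e -> exists2 d : R, 0 < d &
  forall x, `|Re x - Re z| < d -> `|Im x - Im z| < d -> `|f x - f z| < e.
Proof.
have H := @cvgrPdist_lt R R Co (nbhs (z : Co)) _ f (f z).
split=> [/H hf e e0|hf].
  have /nbhs_boxP[d d0 hd] := hf e e0.
  exists d => // x h1 h2. rewrite distrC. exact: hd.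
apply/H => e e0. have [d d0 hd] := hf e e0.
apply/nbhs_boxP; exists d => // x h1 h2. rewrite distrC. exact: hd.
Qed.

Lemma ccontP f z : ccont f z <-> rcont (fun x => Re (f x)) z /\ rcont (fun x => Im (f x)) z.
Proof.
split=> [hf|[/rcontP h1 /rcontP h2]].
  split; apply/rcontP => e e0.
    have /hf/nbhs_boxP[d d0 hd] : @nbhs Co Co (f z) [set y | `|Re y - Re (f z)| < e].
      by apply/nbhs_boxP; exists e.
    by exists d.
  have /hf/nbhs_boxP[d d0 hd] : @nbhs Co Co (f z) [set y | `|Im y - Im (f z)| < e].
    by apply/nbhs_boxP; exists e.
  by exists d.
move=> P /nbhs_boxP[e e0 HP].
have [d1 d10 hd1] := h1 e e0; have [d2 d20 hd2] := h2 e e0.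
apply/nbhs_boxP; exists (Num.min d1 d2); first by rewrite lt_min d10.
move=> x; rewrite !lt_min => /andP[a1 a2] /andP[b1 b2].
by apply: HP; [exact: hd1|exact: hd2].
Qed.

Lemma rcont_comp (f : C -> R) (g : R -> R) z : rcont f z -> {for f z, continuous g} -> rcont (fun x => g (f x)) z.
Proof. move=> hf hg. exact: (@continuous_comp Co R R f g z hf hg). Qed.

Lemma rcontM f g z : rcont f z -> rcont g z -> rcont (fun x => f x * g x) z.
Proof. rewrite /rcont/continuous_at => hf hg. exact: (@cvgM R Co _ _ f g _ _ hf hg). Qed.

Lemma rcontD f g z : rcont f z -> rcont g z -> rcont (fun x => f x + g x) z.
Proof. rewrite /rcont/continuous_at => hf hg. exact: (@cvgD R R Co _ _ f g _ _ hf hg). Qed.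

Lemma rcontN f z : rcont f z -> rcont (fun x => - f x) z.
Proof. rewrite /rcont/continuous_at => hf. exact: (@cvgN R R Co _ _ f _ hf). Qed.

Lemma rcontV (f : C -> R) z : f z != 0 -> rcont f z -> rcont (fun x => (f x)^-1) z.
Proof. rewrite /rcont/continuous_at => h hf. exact: (@cvgV R Co _ _ f _ h hf). Qed.

Lemma rcont_cst k z : rcont (fun x => k) z.
Proof. exact: (@cst_continuous Co R k z). Qed.

Lemma rcont_Re f z : ccont f z -> rcont (fun x => Re (f x)) z.
Proof. by move/ccontP => []. Qed.

Lemma rcont_Im f z : ccont f z -> rcont (fun x => Im (f x)) z.
Proof. by move/ccontP => []. Qed.

Lemma ccontE f z : ccont f z <-> forall P, cnear (f z) P -> cnear z (fun x => P (f x)).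
Proof.
split=> [hf P hP|hf P /nbhs_boxP hP].
  by apply/nbhs_boxP; apply: hf; exact/nbhs_boxP.
by apply/nbhs_boxP; exact: hf.
Qed.

Lemma ccont_near (f g : C -> C) z : cnear z (fun x => f x = g x) -> ccont f z -> ccont g z.
Proof.
move=> h /ccontE hf; apply/ccontE => P hP.
have e := cnear_self h; rewrite -e in hP.
by apply: cnearS (cnearI h (hf _ hP)) => x [<-].
Qed.

Lemma cexpD z w : cexp (z + w) = cexp z * cexp w.
Proof.
apply: complexP; rewrite /cexp !(ReM,ImM,ReC,ImC,ReD,ImD) expRD /= cosD sinD; ring.
Qed.

Lemma cexp0 : cexp (0 : C) = 1.
Proof. by apply: complexP; rewrite /cexp /= expR0 cos0 sin0; ring. Qed.

Lemma cexp_ReE z : Re (cexp z) = expR (Re z) * cos (Im z).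
Proof. by rewrite /cexp ReM ReC ImC /=; ring. Qed.

Lemma cexp_ImE z : Im (cexp z) = expR (Re z) * sin (Im z).
Proof. by rewrite /cexp ImM ReC ImC /=; ring. Qed.

Lemma cexpJ z : cexp (cj z) = cj (cexp z).
Proof.
by apply: complexP; rewrite ?(ReJ,ImJ,cexp_ReE,cexp_ImE) ?cosN ?sinN ?mulrN.
Qed.

Lemma ccont_cexp z : ccont (@cexp R) z.
Proof.
have hr : rcont (fun x => Re x) z := rcont_Re (@ccont_id z).
have hi : rcont (fun x => Im x) z := rcont_Im (@ccont_id z).
have he := rcont_comp hr (@continuous_expR R _).
apply/ccontP; split.
  rewrite (_ : (fun x : C => Re (cexp x)) = (fun x : C => expR (Re x) * cos (Im x))).
    exact: rcontM he (rcont_comp hi (@continuous_cos R _)).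
  by apply/funext => x; rewrite cexp_ReE.
rewrite (_ : (fun x : C => Im (cexp x)) = (fun x : C => expR (Re x) * sin (Im x))).
  exact: rcontM he (rcont_comp hi (@continuous_sin R _)).
by apply/funext => x; rewrite cexp_ImE.
Qed.
End ComplexBasics.
Arguments ccont_id {R} z.
Arguments ccont_cst {R} k z.
Arguments rcont_cst {R} k z.
Arguments ccont_cexp {R} z.

(** * Real calculus along the time variable *)

Section TimeCalculus.
Variable R : realType.
Local Notation C := (R[i]).
Local Notation Re := complex.Re.
Local Notation Im := complex.Im.
Local Notation cj := (@conjc R).
Implicit Types (z w : C).

Lemma derive_ge0_le (f df : R -> R) (a b : R) : a <= b ->
  (forall x : R, a <= x <= b -> is_derive x (1 : R) f (df x)) ->
  (forall x, a < x < b -> 0 <= df x) -> f a <= f b.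
Proof.
rewrite le_eqVlt => /predU1P[->//|ab] hf hd.
have hf' x : x \in `]a, b[ -> is_derive x (1 : R) f (df x).
  by rewrite in_itv /= => /andP[ax xb]; apply: hf; rewrite !ltW.
have [|c cab e] := MVT ab hf'.
  apply: derivable_within_continuous => x; rewrite in_itv /= => /hf; by case.
have := hd c; rewrite in_itv /= in cab; rewrite cab => /(_ isT) h.
by rewrite -subr_ge0 e mulr_ge0 // subr_ge0 ltW.
Qed.

(** Used to stop a path as soon as a prescribed value is met, while smaller
    values are known before. *)
Lemma first_hit (f : R -> R) (a b v : R) : a <= b -> continuous f -> f a <= v <= f b ->
  exists x, [/\ a <= x <= b, f x = v & forall y, a <= y <= x -> f y <= v].
Proof.
move=> ab cf /andP[fa fb].
pose E := `[a, b]%classic `&` (f @^-1` [set y | v <= y]).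
have cE : compact E.
  apply: (subclosed_compact _ (@segment_compact R a b)); last by move=> x [].
  apply: closedI; first exact: interval_closed.
  apply: closed_comp; [by move=> *; exact: cf|exact: closed_ge].
have nE : E !=set0 by exists b; split => //=; rewrite in_itv /= ab lexx.
have [x] := @compact_EVT_min R R id E nE cE (continuous_subspaceT (fun x => @cvg_id _ _)).
rewrite inE => -[/= xab vx] xmin; rewrite in_itv /= in xab.
have fxv : f x = v.
  apply/eqP; rewrite eq_le vx andbT leNgt; apply/negP => vx'.
  have ax : a <= x by case/andP: xab.
  have [|y yax fy] := @IVT R f a x v ax (continuous_subspaceT cf).
    by rewrite (min_idPl _) ?(max_idPr _) ?fa ?vx //; apply: (le_trans fa).
  move: yax; rewrite in_itv /= => /andP[ay yx].
  have yE : y \in E.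
    rewrite inE; split => /=; last by rewrite fy.
    by rewrite in_itv /= ay (le_trans yx) //; case/andP: xab.
  have /= xy := xmin y yE.
  have e : x = y by apply/eqP; rewrite eq_le xy yx.
  by move: vx'; rewrite e fy ltxx.
exists x; split => // y /andP[ay yx].
rewrite leNgt; apply/negP => vy.
have yE : y \in E.
  rewrite inE; split => /=; last exact: ltW.
  by rewrite in_itv /= ay (le_trans yx) //; case/andP: xab.
have /= xy := xmin y yE.
have e : x = y by apply/eqP; rewrite eq_le xy yx.
by move: vy; rewrite -e fxv ltxx.
Qed.

(** Used for the last time at which an inequality fails, so that it holds at all
    later times. *)
Lemma last_zero (f : R -> R) (a b : R) : a <= b -> continuous f -> f a <= 0 -> 0 < f b ->
  exists x, [/\ a <= x < b, f x = 0 & forall y, x < y <= b -> 0 < f y].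
Proof.
move=> ab cf fa fb.
pose E := `[a, b]%classic `&` (f @^-1` [set y | y <= 0]).
have cE : compact E.
  apply: (subclosed_compact _ (@segment_compact R a b)); last by move=> x [].
  apply: closedI; first exact: interval_closed.
  apply: closed_comp; [by move=> *; exact: cf|exact: closed_le].
have nE : E !=set0 by exists a; split => //=; rewrite in_itv /= ab lexx.
have cN : continuous (fun x : R => - x) by move=> x; apply: (@cvgN R R); exact: cvg_id.
have [x] := @compact_EVT_min R R (fun x => - x) E nE cE (continuous_subspaceT cN).
rewrite inE => -[/= xab vx] xmax; rewrite in_itv /= in xab; case/andP: xab => ax xb.
have xltb : x < b.
  by rewrite lt_neqAle xb andbT; apply/eqP => e; move: fb; rewrite -e ltNge vx.
have pos y : x < y <= b -> 0 < f y.
  move=> /andP[xy yb]; rewrite ltNge; apply/negP => fy.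
  have yE : y \in E by rewrite inE; split => //=; rewrite in_itv /= yb (le_trans ax (ltW xy)).
  by have := xmax y yE; rewrite lerN2 leNgt xy.
exists x; split => //; first by rewrite ax.
have [|y yxb fy] := @IVT R f x b 0 xb (continuous_subspaceT cf).
  by rewrite (min_idPl _) ?(max_idPr _) ?vx ?(ltW fb) //; apply: (le_trans vx); exact: ltW.
move: yxb; rewrite in_itv /= => /andP[xy yb].
have [<-//|ne] := eqVneq y x.
by have := pos y; rewrite lt_neqAle eq_sym ne xy yb fy ltxx => /(_ isT).
Qed.

Lemma derive_pos_right (f : R -> R) (x l : R) : is_derive x (1 : R) f l -> 0 < l -> f x = 0 ->
  forall b, x < b -> exists2 y, x < y <= b & 0 < f y.
Proof.
move=> [df fl] l0 fx b xb.
have /cvg_ex[/= m hm] := df.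
have ml : m = l by rewrite -fl /derive; apply/esym/cvg_lim.
rewrite ml in hm.
move/cvgrPdist_lt: hm => /(_ _ l0); rewrite near_withinE => /nbhs_ballP[e /= e0 he].
pose h := Num.min (e / 2) (b - x).
have h0 : 0 < h by rewrite lt_min divr_gt0 // subr_gt0.
have := he h; rewrite /ball /= sub0r normrN gtr0_norm // => H.
exists (x + h).
  rewrite ltrDl h0 /= -lerBrDl; by rewrite /h ge_min lexx orbT.
have he2 : h < e by rewrite gt_min ltr_pdivrMr // ltr_pMr // ltr1n.
move: (H he2 (lt0r_neq0 h0)).
rewrite fx subr0 /GRing.scale /= mulr1 (addrC h) ltr_norml => /andP[_].
rewrite ltrBlDr ltrDl pmulr_rgt0 ?invr_gt0 //.
Qed.

Local Notation rder f s l := (is_derive (s : R) (1 : R) (f : R -> R) (l : R)).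

Lemma rderM (f g : R -> R) s a b : rder f s a -> rder g s b -> rder (fun x => f x * g x) s (a * g s + f s * b).
Proof.
move=> hf hg; apply: is_derive_eq (is_deriveM hf hg) _.
by rewrite /GRing.scale /= addrC mulrC.
Qed.

Lemma rderD (f g : R -> R) s a b : rder f s a -> rder g s b -> rder (fun x => f x + g x) s (a + b).
Proof. by move=> hf hg; exact: is_deriveD. Qed.

Lemma rderN (f : R -> R) s a : rder f s a -> rder (fun x => - f x) s (- a).
Proof. by move=> hf; exact: is_deriveN. Qed.

Lemma rder_ext (f g : R -> R) s a b : (forall x, f x = g x) -> a = b -> rder f s a -> rder g s b.
Proof. by move=> /funext -> ->. Qed.

Lemma rder_comp (f g : R -> R) s a b : rder f s a -> rder g (f s) b -> rder (fun x => g (f x)) s (b * a).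
Proof.
by move=> hf hg; apply: is_derive_eq (@is_derive1_comp R g f s b a hg hf) _.
Qed.

(** Derivatives along the time variable are taken by coordinates, since the mean
    value theorem is applied to real and imaginary parts separately. *)
Definition cder (f f' : R -> C) := forall s : R,
  is_derive s (1 : R) (fun x => Re (f x)) (Re (f' s)) /\
  is_derive s (1 : R) (fun x => Im (f x)) (Im (f' s)).

Lemma cder_eq (f f' g' : R -> C) : (forall s, f' s = g' s) -> cder f f' -> cder f g'.
Proof. by move=> e h s; rewrite -e. Qed.

Lemma cderD f f' g g' : cder f f' -> cder g g' -> cder (fun s => f s + g s) (fun s => f' s + g' s).
Proof.
move=> hf hg s; have [a b] := hf s; have [c d] := hg s; split.
  by apply: rder_ext (rderD a c) => [x|]; rewrite ReD.
by apply: rder_ext (rderD b d) => [x|]; rewrite ImD.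
Qed.

Lemma cderM f f' g g' : cder f f' -> cder g g' -> cder (fun s => f s * g s) (fun s => f' s * g s + f s * g' s).
Proof.
move=> hf hg s; have [a b] := hf s; have [c d] := hg s; split.
  apply: rder_ext (rderD (rderM a c) (rderN (rderM b d))) => [x|]; rewrite !(ReD,ReM) //; ring.
apply: rder_ext (rderD (rderM a d) (rderM b c)) => [x|]; rewrite !(ImD,ImM) //; ring.
Qed.

Lemma cder_cst k : cder (fun=> k) (fun=> 0).
Proof. by move=> s; split; exact: is_derive_cst. Qed.

Lemma cderZ k f f' : cder f f' -> cder (fun s => k * f s) (fun s => k * f' s).
Proof. by move=> hf; apply: cder_eq (cderM (cder_cst k) hf) => s; rewrite mul0r add0r. Qed.

Lemma cderJ f f' : cder f f' -> cder (fun s => cj (f s)) (fun s => cj (f' s)).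
Proof.
move=> hf s; have [a b] := hf s; split.
  by apply: rder_ext a => [x|]; rewrite ReJ.
by apply: rder_ext (rderN b) => [x|]; rewrite ImJ.
Qed.

Lemma cder_linear k : cder (fun s => s%:C * k) (fun=> k).
Proof.
move=> s; have hid : rder (fun x => x) s 1 by exact: is_derive_id.
split.
  by apply: rder_ext (rderM hid (is_derive_cst (Re k) s 1)) => [x|]; rewrite ?ReM ?ReC ?ImC; ring.
by apply: rder_ext (rderM hid (is_derive_cst (Im k) s 1)) => [x|]; rewrite ?ImM ?ReC ?ImC; ring.
Qed.

Lemma cder_cexp f f' : cder f f' -> cder (fun s => cexp (f s)) (fun s => f' s * cexp (f s)).
Proof.
move=> hf s; have [a b] := hf s.
have he := rder_comp a (is_derive_expR (Re (f s))).
have hc := rder_comp b (is_derive_cos (Im (f s))).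
have hs := rder_comp b (is_derive_sin (Im (f s))).
split.
  by apply: rder_ext (rderM he hc) => [x|]; rewrite ?(cexp_ReE,ReM) ?(cexp_ImE,cexp_ReE) //; ring.
by apply: rder_ext (rderM he hs) => [x|]; rewrite ?(cexp_ImE,ImM) ?(cexp_ImE,cexp_ReE) //; ring.
Qed.

(** Strict positivity of the derivative at the single point 0 suffices: it makes
    f nonzero at once, and monotonicity keeps it away from 0. *)
Lemma derive_sign (f df : R -> R) : (forall x, rder f x (df x)) -> (forall x, 0 <= df x) ->
  0 < df 0 -> f 0 = 0 -> forall x, x != 0 -> 0 < x * f x.
Proof.
move=> hf df0 d0 f0 x; rewrite neq_lt => /orP[x0|x0].
  pose g (x : R) := - f (- x).
  have hg y : rder g y (df (- y)).
    have h1 : rder (fun x => - x) y (-1) := rderN (is_derive_id y (1 : R)).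
    by apply: rder_ext (rderN (rder_comp h1 (hf (- y)))) => //; rewrite mulrN1 opprK.
  have hg0 : rder g 0 (df 0) by rewrite -{2}oppr0; exact: hg.
  have g0 : g 0 = 0 by rewrite /g oppr0 f0 oppr0.
  have nx0 : 0 < - x by rewrite oppr_gt0.
  have [y /andP[y0 yx] gy] := derive_pos_right hg0 d0 g0 nx0.
  have := @derive_ge0_le g (fun y => df (- y)) y (- x) yx (fun y _ => hg y) (fun y _ => df0 (- y)).
  move=> /(lt_le_trans gy); rewrite /g opprK oppr_gt0 => h.
  by rewrite -mulrNN mulr_gt0 // oppr_gt0.
have [y /andP[y0 yx] gy] := derive_pos_right (hf 0) d0 f0 x0.
have := @derive_ge0_le f df y x yx (fun y _ => hf y) (fun y _ => df0 y).
by move=> /(lt_le_trans gy) h; rewrite mulr_gt0.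
Qed.

Lemma rderV (f : R -> R) (s a : R) : f s != 0 -> rder f s a -> rder (fun x => (f x)^-1) s (- a / f s ^+ 2).
Proof.
move=> f0 hf; apply: is_derive_eq (is_deriveV f0 hf) _.
by rewrite /GRing.scale /= mulrC mulrN mulNr.
Qed.

Lemma sqr_ReIm_gt0 z : z != 0 -> 0 < Re z ^+ 2 + Im z ^+ 2.
Proof.
move=> z0; rewrite lt_neqAle addr_ge0 ?sqr_ge0 // andbT eq_sym paddr_eq0 ?sqr_ge0 // !sqrf_eq0.
by apply: contra z0 => /andP[/eqP a /eqP b]; apply/eqP; apply: complexP.
Qed.

Lemma cderV f f' : (forall s, f s != 0) -> cder f f' -> cder (fun s => (f s)^-1) (fun s => - f' s / f s ^+ 2).
Proof.
move=> f0 hf s; have [a b] := hf s.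
have n0 x : Re (f x) * Re (f x) + Im (f x) * Im (f x) != 0.
  by rewrite -!expr2; exact: lt0r_neq0 (sqr_ReIm_gt0 (f0 x)).
have hn := rderD (rderM a a) (rderM b b).
have hv := @rderV (fun x => Re (f x) * Re (f x) + Im (f x) * Im (f x)) s _ (n0 s) hn.
have n0s := n0 s.
have -> : - f' s / f s ^+ 2 = - f' s * ((f s)^-1 * (f s)^-1) by rewrite expr2 invfM.
split.
  apply: rder_ext (rderM a hv) => [x|]; first by rewrite ReV !expr2.
  by rewrite !(ReM,ImM,ReV,ImV,ReN,ImN) ?(ReM,ImM,ReV,ImV,ReN,ImN) !expr2; field.
apply: rder_ext (rderM (rderN b) hv) => [x|]; first by rewrite ImV !expr2.
by rewrite !(ReM,ImM,ReV,ImV,ReN,ImN) ?(ReM,ImM,ReV,ImV,ReN,ImN) !expr2; field.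
Qed.

Lemma cder_cont f f' : cder f f' -> continuous (fun s => Re (f s)) /\ continuous (fun s => Im (f s)).
Proof.
move=> hf; split => s; have [a b] := hf s; apply: differentiable_continuous; apply/derivable1_diffP.
by case: a. by case: b.
Qed.
End TimeCalculus.

(** * The flow in the variable u, and its dynamics in time *)

Section Dynamics.
Variable R : realType.
Local Notation C := (R[i]).
Local Notation Re := complex.Re.
Local Notation Im := complex.Im.
Local Notation cj := (@conjc R).
Implicit Types (z w u : C).

Definition ccosh z := (cexp z + cexp (- z)) / 2.

Definition csinh z := (cexp z - cexp (- z)) / 2.

Lemma cosh2_sinh2 z : ccosh z ^+ 2 - csinh z ^+ 2 = 1.
Proof.
have h : cexp z * cexp (- z) = 1 by rewrite -cexpD subrr cexp0.
by rewrite /ccosh /csinh -[RHS]h; field.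
Qed.

Lemma cosh0 : ccosh 0 = 1. Proof. by rewrite /ccosh oppr0 cexp0; field. Qed.
Lemma sinh0 : csinh 0 = 0. Proof. by rewrite /csinh oppr0 cexp0 subrr mul0r. Qed.
Lemma coshN z : ccosh (- z) = ccosh z. Proof. by rewrite /ccosh opprK addrC. Qed.
Lemma sinhN z : csinh (- z) = - csinh z. Proof. by rewrite /csinh opprK; ring. Qed.
Lemma conj2 : cj 2 = 2. Proof. by rewrite conjc_nat. Qed.
Lemma conjD z w : cj (z + w) = cj z + cj w. Proof. exact: rmorphD. Qed.
Lemma conjM z w : cj (z * w) = cj z * cj w. Proof. exact: rmorphM. Qed.
Lemma conjN z : cj (- z) = - cj z. Proof. exact: rmorphN. Qed.
Lemma conjV z : cj (z^-1) = (cj z)^-1. Proof. exact: conjc_inv. Qed.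
Lemma conjR (x : R) : cj x%:C = x%:C. Proof. exact: conjc_real. Qed.

Lemma coshJ z : ccosh (cj z) = cj (ccosh z).
Proof. by rewrite /ccosh conjM conjV conj2 conjD -!cexpJ conjN. Qed.

Lemma sinhJ z : csinh (cj z) = cj (csinh z).
Proof. by rewrite /csinh conjM conjV conj2 conjD conjN -!cexpJ conjN. Qed.

Lemma cder_ext (f g f' g' : R -> C) : (forall x, f x = g x) -> (forall x, f' x = g' x) -> cder f f' -> cder g g'.
Proof. by move=> /funext -> /funext ->. Qed.

Lemma cder_cosh k : cder (fun s => ccosh (s%:C * k)) (fun s => k * csinh (s%:C * k)).
Proof.
have h := cder_cexp (cder_linear k).
have h' := cder_cexp (cderZ (-1) (cder_linear k)).
by apply: cder_ext (cderZ (2^-1) (cderD h h')) => s; rewrite ?/ccosh ?/csinh !mulN1r; ring.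
Qed.

Lemma cder_sinh k : cder (fun s => csinh (s%:C * k)) (fun s => k * ccosh (s%:C * k)).
Proof.
have h := cder_cexp (cder_linear k).
have h' := cder_cexp (cderZ (-1) (cder_linear k)).
by apply: cder_ext (cderZ (2^-1) (cderD h (cderZ (-1) h'))) => s; rewrite ?/ccosh ?/csinh !mulN1r; ring.
Qed.

(** The solution of delta'' = (u^2 / 4) delta with value 1 and derivative -1/2
    at time 0; [ddelta] is its derivative in time. *)
Definition delta u (s : R) := ccosh (s%:C * (u / 2)) - csinh (s%:C * (u / 2)) / u.

Definition ddelta u (s : R) := u / 2 * csinh (s%:C * (u / 2)) - ccosh (s%:C * (u / 2)) / 2.

Lemma delta_0 u : delta u 0 = 1.
Proof. by rewrite /delta mul0r cosh0 sinh0 mul0r subr0. Qed.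

Lemma ddelta_0 u : ddelta u 0 = - 2^-1.
Proof. by rewrite /ddelta mul0r cosh0 sinh0 mulr0 add0r mul1r. Qed.

Lemma cder_delta u : u != 0 -> cder (delta u) (ddelta u).
Proof.
move=> u0; apply: cder_ext (cderD (cder_cosh (u / 2)) (cderZ (- u^-1) (cder_sinh (u / 2)))) => s.
  by rewrite /delta; ring.
by rewrite /ddelta; field.
Qed.

Lemma cder_ddelta u : u != 0 -> cder (ddelta u) (fun s => u ^+ 2 / 4 * delta u s).
Proof.
move=> u0; apply: cder_ext (cderD (cderZ (u / 2) (cder_sinh (u / 2))) (cderZ (- 2^-1) (cder_cosh (u / 2)))) => s.
  by rewrite /ddelta; ring.
by rewrite /delta; field.
Qed.

(** Conservation of energy for delta'' = (u^2 / 4) delta. *)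
Lemma delta_conserved u s : u != 0 -> u ^+ 2 * delta u s ^+ 2 - 4 * ddelta u s ^+ 2 = u ^+ 2 - 1.
Proof.
move=> u0; have := cosh2_sinh2 (s%:C * (u / 2)); rewrite /delta /ddelta.
move: (ccosh _) (csinh _) => c d h.
have -> : u ^+ 2 - 1 = (u ^+ 2 - 1) * (c ^+ 2 - d ^+ 2) by rewrite h mulr1.
by field.
Qed.

(** The values of u = a(y) when z ranges over the upper half of the disc. *)
Definition quadrant : set C := [set u | 0 < Re u /\ 0 < Im u].

Lemma quadrant_neq0 u : quadrant u -> u != 0.
Proof. by move=> [h _]; apply: contraTneq h => ->; rewrite ltxx. Qed.

Lemma Im_sqr u : Im (u ^+ 2) = 2 * Re u * Im u.
Proof. by rewrite expr2 ImM; ring. Qed.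

Lemma Re_sqr u : Re (u ^+ 2) = Re u ^+ 2 - Im u ^+ 2.
Proof. by rewrite expr2 ReM -!expr2. Qed.

Lemma quadrant_sqr u : quadrant u -> 0 < Im (u ^+ 2).
Proof. by move=> [h1 h2]; rewrite Im_sqr !mulr_gt0. Qed.

Lemma Im_quarter z : Im (z / 4) = Im z / 4.
Proof. by rewrite ImM ReV ImV Re_nat Im_nat; field. Qed.

Lemma Im_div z w : Im (z / w) = Im (z * cj w) / (Re w ^+ 2 + Im w ^+ 2).
Proof. by rewrite !ImM ReV ImV ReJ ImJ; ring. Qed.

Lemma Re_div z w : Re (z / w) = Re (z * cj w) / (Re w ^+ 2 + Im w ^+ 2).
Proof. by rewrite !ReM ReV ImV ReJ ImJ; ring. Qed.

(** The derivative of Im (delta' conj delta) in time is Im (u^2) |delta|^2 / 4,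
    which is nonnegative everywhere and positive at time 0. *)
Lemma Im_ddelta_delta_sign u s : quadrant u -> s != 0 -> 0 < s * Im (ddelta u s * cj (delta u s)).
Proof.
move=> Qu; have u0 := quadrant_neq0 Qu; have z0 := quadrant_sqr Qu; move: s.
pose df s := Im (u ^+ 2) / 4 * (Re (delta u s) ^+ 2 + Im (delta u s) ^+ 2).
apply: (@derive_sign R (fun s => Im (ddelta u s * cj (delta u s))) df) => [s|s||].
- have [_] := cderM (cder_ddelta u0) (cderJ (cder_delta u0)) s.
  apply: rder_ext => //.
  rewrite /df -(Im_quarter (u ^+ 2)); move: (_ / _) (delta _ _) (ddelta _ _) => k z w.
  by rewrite ImD !ImM !ReM !ReJ !ImJ; ring.
- by rewrite mulr_ge0 ?divr_ge0 ?(ltW z0) // addr_ge0 ?sqr_ge0.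
- by rewrite /df delta_0 /= expr0n addr0 expr1n mulr1 divr_gt0.
- by rewrite delta_0 ddelta_0 ImM ImN ReJ ImJ ImV Im_nat /=; ring.
Qed.

Lemma delta_neq0 u s : quadrant u -> delta u s != 0.
Proof.
move=> Qu; have [->|s0] := eqVneq s 0; first by rewrite delta_0 oner_eq0.
have := Im_ddelta_delta_sign Qu s0; apply: contraTneq => ->.
by rewrite ImM ReJ ImJ /= oppr0 !mulr0 addr0 mulr0 ltxx.
Qed.

(** The logarithmic derivative of [omega] in time. *)
Definition gam u s := - (2 * ddelta u s / delta u s).

Lemma gam_0 u : gam u 0 = 1.
Proof. by rewrite /gam delta_0 ddelta_0; field. Qed.

Lemma Im_gam_lt0 u s : quadrant u -> 0 < s -> Im (gam u s) < 0.
Proof.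
move=> Qu s0; have := Im_ddelta_delta_sign Qu (lt0r_neq0 s0); rewrite pmulr_rgt0 // => h.
have d0 := delta_neq0 s Qu; have n0 := sqr_ReIm_gt0 d0.
rewrite /gam ImN -mulrA ImM Re_nat Im_nat mul0r addr0 oppr_lt0 Im_div.
by rewrite mulr_gt0 // divr_gt0.
Qed.
Variable kappa : R.
Hypothesis kappa2 : kappa ^+ 2 < 1.

Definition sqk u := u ^+ 2 - (kappa ^+ 2)%:C.

(** The argument of alpha in the flow at time s, as a function of u; see
    [psi_arg_omega]. *)
Definition omega u s := (u ^+ 2 - 1) / (sqk u * delta u s ^+ 2).

Lemma Im_sqk u : Im (sqk u) = Im (u ^+ 2).
Proof. by rewrite /sqk ImD ImN ImC subr0. Qed.

Lemma Im_gt0_neq0 z : 0 < Im z -> z != 0.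
Proof. by apply: contraTneq => ->; rewrite ltxx. Qed.

Lemma quadrant_sqk u : quadrant u -> sqk u != 0.
Proof. by move=> Qu; apply: Im_gt0_neq0; rewrite Im_sqk quadrant_sqr. Qed.

(** Conservation of energy, divided by delta^2. *)
Lemma omega_gam u s : u != 0 -> sqk u != 0 -> delta u s != 0 -> (1 - omega u s) * sqk u = gam u s ^+ 2 - (kappa ^+ 2)%:C.
Proof.
move=> u0 z0 d0; have := delta_conserved s u0 => h.
have -> : gam u s ^+ 2 = u ^+ 2 - (u ^+ 2 - 1) / delta u s ^+ 2.
  by rewrite -h /gam; field.
rewrite /omega; move: z0; rewrite /sqk; move: (kappa ^+ 2)%:C => k z0.
by field; rewrite d0 z0.
Qed.

Lemma cder_omega u : quadrant u -> cder (omega u) (fun s => gam u s * omega u s).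
Proof.
move=> Qu; have u0 := quadrant_neq0 Qu; have d0 s := delta_neq0 s Qu; have z0 := quadrant_sqk Qu.
have hd := cderV d0 (cder_delta u0).
apply: cder_ext (cderZ ((u ^+ 2 - 1) / sqk u) (cderM hd hd)) => s; have {}d0 := d0 s; rewrite /gam /omega.
  by field; rewrite d0.
by field; rewrite d0.
Qed.

(** A Riccati equation, as for every logarithmic derivative of a solution of a
    linear equation of second order. *)
Lemma cder_gam u : quadrant u -> cder (gam u) (fun s => (gam u s ^+ 2 - u ^+ 2) / 2).
Proof.
move=> Qu; have u0 := quadrant_neq0 Qu; have d0 s := delta_neq0 s Qu.
apply: cder_ext (cderZ (- 2) (cderM (cder_ddelta u0) (cderV d0 (cder_delta u0)))) => s; have {}d0 := d0 s; rewrite /gam.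
  by field.
by field.
Qed.

(** The first condition says that the value is in the upper half-plane. The
    second one makes the pair of conditions propagate backward in time, and
    is also the sign that injectivity in u rests on. *)
Definition admissible u s := 0 < Im (omega u s) /\ Im ((1 - omega u s) * cj (gam u s)) < 0.

Lemma admissible_0 u : quadrant u -> admissible u 0.
Proof.
move=> Qu; have z0 := quadrant_sqk Qu; have zi : 0 < Im (sqk u) by rewrite Im_sqk quadrant_sqr.
have e : 1 - omega u 0 = (1 - kappa ^+ 2)%:C / sqk u.
  rewrite /omega delta_0 /sqk; rewrite /sqk in z0. rewrite rmorphB rmorph1 /=. move: (_%:C) z0 => k z0. by field.
have h : Im (1 - omega u 0) < 0.
  rewrite e ImM ReC ImC mul0r addr0 ImV pmulr_rlt0 ?subr_gt0 // mulNr oppr_lt0 divr_gt0 //.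
  exact: sqr_ReIm_gt0.
split.
  by move: h; rewrite ImD ImN Im1 sub0r oppr_lt0.
by rewrite gam_0 ImM ReJ ImJ Re1 Im1 oppr0 mulr0 add0r mulr1.
Qed.

(** Put r = (1 - w) conj g. If r is real, then 1 - w = r g / |g|^2, so r > 0 as
    w is above the real axis; but r Z = g |g|^2 - kappa^2 conj g is below
    the real axis. *)
Lemma real_quotient_absurd (Z w g : C) : (1 - w) * Z = g ^+ 2 - (kappa ^+ 2)%:C ->
  0 < Im Z -> 0 < Im w -> Im ((1 - w) * cj g) = 0 -> Im g < 0 -> False.
Proof.
move=> e Z0 w0 r0 g0.
set r := Re ((1 - w) * cj g).
have er : (1 - w) * cj g = r%:C by apply: complexP => //; rewrite r0.
have e1 : r%:C * Z = (g ^+ 2 - (kappa ^+ 2)%:C) * cj g by rewrite -er -e; ring.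
have e2 : r%:C * g = (1 - w) * (g * cj g) by rewrite -er; ring.
have k0 := sqr_ge0 kappa.
have i1 : r * Im Z = - (Im g * (Re g ^+ 2 + Im g ^+ 2 + kappa ^+ 2)) * (-1).
  have -> : r * Im Z = Im (r%:C * Z) by rewrite ImM ReC ImC; ring.
  by rewrite e1 expr2 !(ImM,ReM,ImD,ReD,ReN,ImN,ReJ,ImJ,ReC,ImC); ring.
have i2 : r * Im g = - (Im w * (Re g ^+ 2 + Im g ^+ 2)).
  have -> : r * Im g = Im (r%:C * g) by rewrite ImM ReC ImC; ring.
  by rewrite e2 !(ImM,ReM,ImD,ReD,ReN,ImN,ReJ,ImJ,Re1,Im1); ring.
have n0 : 0 < Re g ^+ 2 + Im g ^+ 2 by rewrite ltr_wpDl ?sqr_ge0 // exprn_even_gt0 //= lt_eqF.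
have rpos : 0 < r.
  rewrite -(nmulr_llt0 _ g0) i2 oppr_lt0. exact: mulr_gt0.
have : 0 < r * Im Z by exact: mulr_gt0.
rewrite i1 mulrN1 opprK nmulr_rgt0 // ltNge addr_ge0 ?sqr_ge0 //; exact: ltW.
Qed.

Lemma Im_1BM_conj (w g : C) : Im w = 0 -> Im ((1 - w) * cj g) = - ((1 - Re w) * Im g).
Proof. by rewrite !(ImM,ReJ,ImJ,ReD,ImD,ReN,ImN,Im1,Re1) => ->; ring. Qed.

(** At the last time x where admissibility fails, one of the two quantities
    vanishes while both conditions hold afterwards; each way of vanishing
    contradicts Im gamma < 0 or Im (u^2) > 0. *)
Lemma admissible_backward u t s : quadrant u -> admissible u t -> 0 <= s <= t -> admissible u s.
Proof.
move=> Qu gt /andP[s0 st].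
have [_ cA] := cder_cont (cder_omega Qu).
have [_ cB] := cder_cont (cderZ (-1) (cderM (cderD (cder_cst 1) (cderZ (-1) (cder_omega Qu))) (cderJ (cder_gam Qu)))).
pose phi := (fun x => Im (omega u x)) \min (fun x => Im (-1 * ((1 + -1 * omega u x) * cj (gam u x)))).
have cphi : continuous phi by move=> x; apply: continuous_min; [exact: cA|exact: cB].
have admissibleE x : admissible u x <-> 0 < phi x.
  rewrite /phi /= lt_min !mulN1r ImN oppr_gt0; split=> [[-> ->]|/andP[]] //.
apply/admissibleE; rewrite ltNge; apply/negP => ps.
(* x is the last time up to t where one of the two conditions fails. *)
have [x [/andP[sx xt] phix pos]] := last_zero st cphi ps ((admissibleE t).1 gt).
have x0 : 0 < x.
  rewrite lt_neqAle (le_trans s0 sx) andbT; apply/eqP => x0.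
  by move: phix; rewrite -x0 => p0; have /admissibleE := admissible_0 Qu; rewrite p0 ltxx.
have gx := Im_gam_lt0 Qu x0.
have iw : 0 <= Im (omega u x) by rewrite -phix /phi /= ge_min lexx.
have ib : Im ((1 - omega u x) * cj (gam u x)) <= 0.
  by rewrite -oppr_ge0 -phix /phi /= !mulN1r ImN ge_min lexx orbT.
have [iw0|iw0] := eqVneq (Im (omega u x)) 0; last first.
  have {iw iw0}iw : 0 < Im (omega u x) by rewrite lt_neqAle eq_sym iw0.
  have ib0 : Im ((1 - omega u x) * cj (gam u x)) = 0.
    move: phix; rewrite /phi /= !mulN1r ImN /Num.min; case: ifP => _ h.
      by rewrite h ltxx in iw.
    by apply/eqP; rewrite -oppr_eq0 h.
  have h1 := omega_gam (quadrant_neq0 Qu) (quadrant_sqk Qu) (delta_neq0 x Qu).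
  have h2 : 0 < Im (sqk u) by rewrite Im_sqk quadrant_sqr.
  exact: real_quotient_absurd h1 h2 iw ib0 gx.
(* omega is real at x. A negative value is excluded by the second condition,
   and the value 0 would mean u^2 = 1. *)
have [wneg|wpos] := ltP (Re (omega u x)) 0.
  move: ib; rewrite Im_1BM_conj // oppr_le0 leNgt nmulr_llt0 // subr_gt0.
  by rewrite (lt_trans wneg).
have [r0|rn0] := eqVneq (Re (omega u x)) 0.
  have := complexP (w := 0) r0 iw0; move/eqP; rewrite /omega mulf_eq0 invr_eq0 mulf_eq0 sqrf_eq0.
  rewrite (negbTE (delta_neq0 x Qu)) (negbTE (quadrant_sqk Qu)) !orbF => /eqP e.
  by have := quadrant_sqr Qu; rewrite (_ : u ^+ 2 = 1) ?Im1 ?ltxx //; apply/eqP; rewrite -subr_eq0 e.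
have {rn0}wpos' : 0 < Re (omega u x) by rewrite lt_neqAle eq_sym rn0.
(* For a positive value, Im omega has derivative omega Im gamma < 0 and would
   be negative just after x. *)
have [_ hd'] := cder_omega Qu x; have {hd'}hd := rderN hd'.
have hp : 0 < - Im (gam u x * omega u x) by rewrite ImM iw0 mulr0 add0r oppr_gt0 nmulr_rlt0.
have hz : - Im (omega u x) = 0 by rewrite iw0 oppr0.
have [y xyt] := @derive_pos_right R (fun x => - Im (omega u x)) x _ hd hp hz t xt.
have /admissibleE[h _] := pos y xyt.
by rewrite oppr_gt0 ltNge ltW.
Qed.

(** The normalisation makes the ratio equal to 1 at s = t, from where its sector
    is followed backward in time. *)
Definition delta_ratio u t s := delta u s / delta u t.

Lemma cder_delta_ratio u t : quadrant u -> cder (delta_ratio u t) (fun s => - (gam u s / 2) * delta_ratio u t s).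
Proof.
move=> Qu; apply: cder_ext (cderZ (delta u t)^-1 (cder_delta (quadrant_neq0 Qu))) => s; rewrite /delta_ratio; first by rewrite mulrC.
rewrite /gam; have := delta_neq0 t Qu; have := delta_neq0 s Qu; move: (delta _ _) (delta _ _) (ddelta _ _) => x y z x0 y0.
by field; rewrite x0 y0.
Qed.

Lemma delta_ratio_tt u t : quadrant u -> delta_ratio u t t = 1.
Proof. by move=> Qu; rewrite /delta_ratio divff // delta_neq0. Qed.

Lemma delta_ratio_sqr u t s : quadrant u -> omega u t = delta_ratio u t s ^+ 2 * omega u s.
Proof.
move=> Qu; rewrite /delta_ratio /omega; have := delta_neq0 t Qu; have := delta_neq0 s Qu; have := quadrant_sqk Qu.
by move: (delta _ _) (delta _ _) (sqk u) => x y z z0 x0 y0; field; rewrite x0 y0 z0.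
Qed.

Lemma Im_sqrM (h w : C) : Re h = 0 -> Im (h ^+ 2 * w) = - Im h ^+ 2 * Im w.
Proof. by rewrite expr2 !(ImM,ReM) => ->; ring. Qed.

(** Where the real part vanishes, the square of the ratio is a real number at
    most 0; but this square is omega(u,t) / omega(u,s), and both are in the
    upper half-plane. *)
Lemma Re_delta_ratio_gt0 u t s : quadrant u -> admissible u t -> 0 <= s <= t -> 0 < Re (delta_ratio u t s).
Proof.
move=> Qu gt /andP[s0 st]; rewrite ltNge; apply/negP => hs.
have [cR _] := cder_cont (cder_delta_ratio t Qu).
have ht : 0 < Re (delta_ratio u t t) by rewrite delta_ratio_tt // Re1 ltr01.
have [x [/andP[sx xt] rx _]] := last_zero st cR hs ht.
have [wt _] := gt.
have [|wx _] := admissible_backward (s := x) Qu gt; first by rewrite (le_trans s0 sx) ltW.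
move: wt; rewrite (delta_ratio_sqr t x Qu); rewrite Im_sqrM // mulNr oppr_gt0 pmulr_llt0 // ltNge.
by rewrite sqr_ge0.
Qed.

(** The logarithmic derivative of the ratio is - gamma / 2, whose imaginary part
    is positive; hence the argument increases to its value 0 at s = t. *)
Lemma Im_delta_ratio_le0 u t s : quadrant u -> admissible u t -> 0 <= s <= t -> Im (delta_ratio u t s) <= 0.
Proof.
move=> Qu gt /andP[s0 st].
have hd := cder_delta_ratio t Qu.
pose df x := (- Im (gam u x) / 2) * (Re (delta_ratio u t x) ^+ 2 + Im (delta_ratio u t x) ^+ 2) / Re (delta_ratio u t x) ^+ 2.
have re x : s <= x <= t -> 0 < Re (delta_ratio u t x).
  by move=> /andP[sx xt]; apply: Re_delta_ratio_gt0 => //; rewrite (le_trans s0 sx).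
have : Im (delta_ratio u t s) / Re (delta_ratio u t s) <= Im (delta_ratio u t t) / Re (delta_ratio u t t).
  apply: (@derive_ge0_le R (fun x => Im (delta_ratio u t x) / Re (delta_ratio u t x)) df _ _ st) => x xst.
    have [a b] := hd x; have r0 := lt0r_neq0 (re _ xst).
    apply: rder_ext (rderM b (rderV r0 a)) => //.
    rewrite /df. move: r0; move: (delta_ratio _ _ _) (gam _ _) => h g r0.
    by rewrite !(ReM,ImM,ReN,ImN,ReV,ImV,Re_nat,Im_nat); field; rewrite r0.
  case/andP: xst => sx xt.
  rewrite /df mulr_ge0 ?invr_ge0 ?sqr_ge0 // mulr_ge0 ?addr_ge0 ?sqr_ge0 // divr_ge0 // oppr_ge0 ltW //.
  by apply: Im_gam_lt0 => //; exact: le_lt_trans sx.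
rewrite delta_ratio_tt // Im1 mul0r pmulr_lle0 // invr_gt0; apply: re; by rewrite lexx.
Qed.

Lemma ImM_le0 (h1 h2 : C) : 0 < Re h1 -> 0 < Re h2 -> Im h1 <= 0 -> Im h2 <= 0 -> Im (h1 * h2) <= 0.
Proof. by rewrite ImM => a b c d; rewrite -oppr_ge0; nra. Qed.

(** Both ratios are in the fourth quadrant up to time t, so the integral of
    their product is in the lower half-plane. The case u1 = u2 is used for
    the derivative of omega in u. *)
Lemma Im_wronskian_le0 u1 u2 t (I : R -> C) : quadrant u1 -> quadrant u2 -> admissible u1 t -> admissible u2 t -> 0 <= t ->
  I 0 = 0 -> cder I (fun s => delta u1 s * delta u2 s) -> Im (I t / (delta u1 t * delta u2 t)) <= 0.
Proof.
move=> Q1 Q2 g1 g2 t0 I0 hI.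
have hd := cderZ (- (delta u1 t * delta u2 t)^-1) hI.
have := @derive_ge0_le R (fun s => Im (- (delta u1 t * delta u2 t)^-1 * I s)) _ 0 t t0 (fun x _ => (hd x).2).
rewrite I0 mulr0 => H.
rewrite -oppr_ge0 -ImN mulrC -mulNr; apply: H => x /andP[x0 xt].
have -> : - (delta u1 t * delta u2 t)^-1 * (delta u1 x * delta u2 x) = - (delta_ratio u1 t x * delta_ratio u2 t x).
  by rewrite /delta_ratio invfM; ring.
have xx : 0 <= x <= t by rewrite !ltW.
by rewrite ImN oppr_ge0; apply: ImM_le0; rewrite ?Re_delta_ratio_gt0 ?Im_delta_ratio_le0.
Qed.

(** Both injectivity in u and the non-vanishing of the derivative in u are
    reduced to this: if 1 - w = - g X, then (1 - w) conj g = - |g|^2 X. *)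
Lemma halfplane_contradiction (w X g : C) : Im X <= 0 -> Im ((1 - w) * cj g) < 0 -> 1 - w = - g * X -> False.
Proof.
move=> X0 h e; move: h; rewrite e.
have -> : Im (- g * X * cj g) = - (Re g ^+ 2 + Im g ^+ 2) * Im X.
  by rewrite !(ImM,ReM,ReN,ImN,ReJ,ImJ); ring.
by rewrite ltNge mulNr oppr_ge0 mulr_ge0_le0 // addr_ge0 ?sqr_ge0.
Qed.
End Dynamics.

(** * Injectivity and non-degeneracy in u *)

Section InjectivityInU.
Variable R : realType.
Local Notation C := (R[i]).
Local Notation Re := complex.Re.
Local Notation Im := complex.Im.
Local Notation cj := (@conjc R).
Implicit Types (z w u : C).
Variable kappa : R.
Hypothesis kappa2 : kappa ^+ 2 < 1.
Local Notation omega := (@omega R kappa).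
Local Notation sqk := (@sqk R kappa).
Local Notation admissible := (@admissible R kappa).

Lemma quadrant_sqr_inj u1 u2 : quadrant u1 -> quadrant u2 -> u1 ^+ 2 = u2 ^+ 2 -> u1 = u2.
Proof.
move=> [r1 _] [r2 _] /eqP; rewrite eqf_sqr => /orP[/eqP//|/eqP e].
by move: r1; rewrite e ReN oppr_gt0 ltNge ltW.
Qed.

(** The Wronskian of the solutions for u1 and u2, scaled so that by their
    differential equations it is the integral of their product. *)
Definition wronskian u1 u2 s := 4 / (u1 ^+ 2 - u2 ^+ 2) * (ddelta u1 s * delta u2 s - delta u1 s * ddelta u2 s).

Lemma wronskian_0 u1 u2 : wronskian u1 u2 0 = 0.
Proof. by rewrite /wronskian !delta_0 !ddelta_0 mulr1 mul1r subrr mulr0. Qed.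

Lemma cder_wronskian u1 u2 : u1 != 0 -> u2 != 0 -> u1 ^+ 2 - u2 ^+ 2 != 0 ->
  cder (wronskian u1 u2) (fun s => delta u1 s * delta u2 s).
Proof.
move=> n1 n2 dz.
have h1 := cderM (cder_ddelta n1) (cder_delta n2).
have h2 := cderM (cder_delta n1) (cder_ddelta n2).
apply: cder_ext (cderZ (4 / (u1 ^+ 2 - u2 ^+ 2)) (cderD h1 (cderZ (-1) h2))) => s.
  by rewrite /wronskian mulN1r.
move: (delta _ _) (delta _ _) (ddelta _ _) (ddelta _ _) => a b c d; by field.
Qed.

(** At equal values of omega, the difference of the two instances of [omega_gam]
    is (1 - omega) (u1^2 - u2^2) = gamma1^2 - gamma2^2, and gamma1 - gamma2
    is a multiple of the Wronskian. *)
Lemma omega_eq_wronskian u1 u2 t : u1 != 0 -> u2 != 0 -> u1 ^+ 2 - u2 ^+ 2 != 0 ->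
  sqk u1 != 0 -> sqk u2 != 0 -> delta u1 t != 0 -> delta u2 t != 0 -> omega u1 t = omega u2 t ->
  1 - omega u1 t = - ((gam u1 t + gam u2 t) / 2) * (wronskian u1 u2 t / (delta u1 t * delta u2 t)).
Proof.
move=> n1 n2 dz z1 z2 d1 d2 ew.
have e1 := omega_gam n1 z1 d1.
have e2 := omega_gam n2 z2 d2.
have eg : gam u1 t - gam u2 t = - ((u1 ^+ 2 - u2 ^+ 2) / 2) * (wronskian u1 u2 t / (delta u1 t * delta u2 t)).
  rewrite /gam /wronskian; move: d1 d2.
  move: (delta _ _) (delta _ _) (ddelta _ _) (ddelta _ _) => a b c d a0 b0; by field; rewrite a0 b0 dz.
apply: (mulIf dz).
have -> : (1 - omega u1 t) * (u1 ^+ 2 - u2 ^+ 2) = (1 - omega u1 t) * sqk u1 - (1 - omega u2 t) * sqk u2.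
  by rewrite -ew /sqk; ring.
rewrite e1 e2.
have -> : gam u1 t ^+ 2 - (kappa ^+ 2)%:C - (gam u2 t ^+ 2 - (kappa ^+ 2)%:C) = (gam u1 t + gam u2 t) * (gam u1 t - gam u2 t) by ring.
rewrite eg; move: (gam _ _) (gam _ _) (wronskian _ _ _ / _) => a b x; by field.
Qed.

(** The mean of the two gammas inherits the second condition of admissibility,
    so [halfplane_contradiction] applies to it. *)
Lemma omega_inj u1 u2 t : quadrant u1 -> quadrant u2 -> admissible u1 t -> admissible u2 t -> 0 <= t ->
  omega u1 t = omega u2 t -> u1 = u2.
Proof.
move=> Q1 Q2 g1 g2 t0 ew; apply: quadrant_sqr_inj => //.
apply/eqP; rewrite -subr_eq0; apply/negPn/negP => dz.
have n1 := quadrant_neq0 Q1; have n2 := quadrant_neq0 Q2.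
have X0 := Im_wronskian_le0 kappa2 Q1 Q2 g1 g2 t0 (wronskian_0 u1 u2) (cder_wronskian n1 n2 dz).
apply: (halfplane_contradiction X0 _ (omega_eq_wronskian n1 n2 dz (quadrant_sqk kappa Q1) (quadrant_sqk kappa Q2) (delta_neq0 t Q1) (delta_neq0 t Q2) ew)).
have [_ h1] := g1; have [_ h2] := g2; rewrite -ew in h2.
have -> : Im ((1 - omega u1 t) * cj ((gam u1 t + gam u2 t) / 2)) =
   (Im ((1 - omega u1 t) * cj (gam u1 t)) + Im ((1 - omega u1 t) * cj (gam u2 t))) / 2.
  move: (omega _ _) (gam _ _) (gam _ _) => w g h.
  rewrite !(ImM,ReM,ReN,ImN,ReJ,ImJ,ReD,ImD,Re1,Im1,ReV,ImV,Re_nat,Im_nat). by field.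
by rewrite ltr_pdivrMr // mul0r -oppr_gt0 opprD addr_gt0 // oppr_gt0.
Qed.

Lemma deltaJ u s : delta (cj u) s = cj (delta u s).
Proof.
have e : cj (s%:C * (u / 2)) = s%:C * (cj u / 2) by rewrite !conjM conjR conjV conj2.
by rewrite /delta -e coshJ sinhJ conjD conjN (conjM (csinh _)) conjV.
Qed.

Lemma ddeltaJ u s : ddelta (cj u) s = cj (ddelta u s).
Proof.
have e : cj (s%:C * (u / 2)) = s%:C * (cj u / 2) by rewrite !conjM conjR conjV conj2.
by rewrite /ddelta -e coshJ sinhJ conjD conjN (conjM (u / 2)) (conjM (ccosh _)) (conjM u) conjV conj2.
Qed.

Lemma cj_real z : cj z = z -> Im z = 0.
Proof. by move/(congr1 (@complex.Im R)); rewrite ImJ; lra. Qed.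

Lemma delta_real (x s : R) : Im (delta x%:C s) = 0.
Proof. by apply: cj_real; rewrite -deltaJ conjR. Qed.

Lemma ddelta_real (x s : R) : Im (ddelta x%:C s) = 0.
Proof. by apply: cj_real; rewrite -ddeltaJ conjR. Qed.

Lemma delta_RE (x s : R) : delta x%:C s = (Re (delta x%:C s))%:C.
Proof. by apply: complexP; rewrite ?ReC ?ImC ?delta_real. Qed.

Lemma ddelta_RE (x s : R) : ddelta x%:C s = (Re (ddelta x%:C s))%:C.
Proof. by apply: complexP; rewrite ?ReC ?ImC ?ddelta_real. Qed.

Lemma gamC (x s : R) : gam x%:C s = (- (2 * Re (ddelta x%:C s) / Re (delta x%:C s)))%:C.
Proof.
by rewrite /gam {1}delta_RE {1}ddelta_RE rmorphN !rmorphM fmorphV /= natC.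
Qed.

Lemma realC_neq0 (x : R) : 0 < x -> x%:C != 0 :> C.
Proof. by move=> x0; rewrite eq_complex /= eqxx andbT lt0r_neq0. Qed.

(** For real u the product of delta and its derivative is nondecreasing in time.
    It is negative at time t since gamma > 0, so delta has no zero before t. *)
Lemma delta_pos (x t s : R) : 0 < x -> 0 < Re (gam x%:C t) -> 0 <= s <= t -> 0 < Re (delta x%:C s).
Proof.
move=> x0 g0 /andP[s0 st]; have xn := realC_neq0 x0.
have hd y := (cder_delta xn y).1.
have hd1 y : is_derive y (1 : R) (fun s => Re (ddelta x%:C s)) (x ^+ 2 / 4 * Re (delta x%:C y)).
  apply: rder_ext (cder_ddelta xn y).1 => //.
  rewrite (ReM (_ / _)) delta_real mulr0 subr0; congr (_ * _).
  by rewrite ReM Re_sqr Im_sqr ReC ImC ReV ImV Re_nat Im_nat; field.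
have dd1 : Re (delta x%:C t) * Re (ddelta x%:C t) < 0.
  move: g0; rewrite gamC ReC oppr_gt0 => h.
  have d0 : Re (delta x%:C t) != 0.
    by apply: contraTneq h => ->; rewrite invr0 mulr0 ltxx.
  have -> : Re (delta x%:C t) * Re (ddelta x%:C t) = 2 * Re (ddelta x%:C t) / Re (delta x%:C t) * (Re (delta x%:C t) ^+ 2 / 2).
    by field.
  by rewrite pmulr_llt0 // divr_gt0 // exprn_even_gt0.
have neg y : y <= t -> Re (delta x%:C y) != 0.
  move=> yt; apply: contraTneq dd1 => e; rewrite -leNgt.
  have := @derive_ge0_le R _ _ y t yt (fun (r : R) _ => rderM (hd r) (hd1 r)).
  rewrite e mul0r; apply => r _.
  by rewrite -expr2 addr_ge0 ?sqr_ge0 // mulrCA -expr2 mulr_ge0 ?sqr_ge0 // divr_ge0 ?sqr_ge0.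
rewrite ltNge; apply/negP => ds.
have [cR _] := cder_cont (cder_delta xn).
have cR' : continuous (fun s => - Re (delta x%:C s)) by move=> r; apply: (@cvgN R R); exact: cR.
have [|y [/andP[sy yt] y0 _]] := @first_hit R _ 0 s 0 s0 cR'.
  by rewrite delta_0 Re1 oppr_le0 oppr_ge0 ler01.
have := neg y; rewrite (le_trans yt st) => /(_ isT).
by move/eqP: y0; rewrite oppr_eq0 => ->.
Qed.

Lemma gam_real (x s : R) : Im (gam x%:C s) = 0.
Proof. by rewrite gamC ImC. Qed.

Lemma real_of_Im0 z : Im z = 0 -> (Re z)%:C = z.
Proof. by move=> h; apply: complexP; rewrite ?ReC ?ImC. Qed.

Lemma Re_real_frac (x y p q : R) z : p != 0 -> q != 0 ->
  Re (- ((x%:C + y%:C) / 2) * (z / (p%:C * q%:C))) = - ((x + y) / 2) * (Re z / (p * q)).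
Proof.
move=> p0 q0.
have -> : - ((x%:C + y%:C) / 2) * (z / (p%:C * q%:C)) = (- ((x + y) / 2) / (p * q))%:C * z.
  have p0' : p%:C != 0 :> C by rewrite eq_complex /= eqxx andbT.
  have q0' : q%:C != 0 :> C by rewrite eq_complex /= eqxx andbT.
  by field; rewrite ?p0 ?q0 ?p0' ?q0'.
by rewrite ReM ReC ImC; field; rewrite p0 q0.
Qed.

(** The identity behind [omega_inj], with signs of real numbers in place of
    half-planes. *)
Lemma omega_inj_real (x1 x2 t : R) : 0 < x1 -> 0 < x2 -> 0 <= t ->
  sqk x1%:C != 0 -> sqk x2%:C != 0 ->
  0 < Re (gam x1%:C t) -> 0 < Re (gam x2%:C t) -> Re (omega x1%:C t) < 1 ->
  omega x1%:C t = omega x2%:C t -> x1 = x2.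
Proof.
move=> p1 p2 t0 z1 z2 g1 g2 w1 ew.
have n1 := realC_neq0 p1; have n2 := realC_neq0 p2.
have tt : 0 <= t <= t by rewrite t0 lexx.
have q1 := delta_pos p1 g1 tt; have q2 := delta_pos p2 g2 tt.
have d1 : delta x1%:C t != 0 by apply: contraTneq q1 => ->; rewrite ltxx.
have d2 : delta x2%:C t != 0 by apply: contraTneq q2 => ->; rewrite ltxx.
have [dz|dz] := eqVneq (x1%:C ^+ 2 - x2%:C ^+ 2 : C) 0.
  move/eqP: dz; rewrite subr_eq0 -!rmorphXn /= => /eqP/complexI/eqP.
  rewrite eqrXn2 ?ltW // => /eqP //.
have e := omega_eq_wronskian n1 n2 dz z1 z2 d1 d2 ew.
have hI := cder_wronskian n1 n2 dz.
have I0 : 0 <= Re (wronskian x1%:C x2%:C t).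
  have := @derive_ge0_le R _ _ 0 t t0 (fun (r : R) _ => (hI r).1).
  rewrite wronskian_0; apply => r /andP[z0 zt].
  have zz : 0 <= r <= t by rewrite !ltW.
  by rewrite ReM !delta_real mulr0 subr0 ltW // mulr_gt0 // (delta_pos _ _ zz).
have : 0 < Re (1 - omega x1%:C t) by rewrite ReD ReN Re1 subr_gt0.
rewrite e ltNge => /negP[].
rewrite -[gam x1%:C t](real_of_Im0 (gam_real _ _)) -[gam x2%:C t](real_of_Im0 (gam_real _ _)) (delta_RE x1) (delta_RE x2).
rewrite Re_real_frac ?lt0r_neq0 // mulNr oppr_le0 mulr_ge0 //.
  by rewrite divr_ge0 // addr_ge0 ?ltW.
by rewrite divr_ge0 // mulr_ge0 ?ltW.
Qed.

(** The derivatives of [delta] and [ddelta] in u. *)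
Definition delta_u u (s : R) := let a := s%:C / 2 in let v := s%:C * (u / 2) in
  a * csinh v - a * ccosh v / u + csinh v / u ^+ 2.

Definition ddelta_u u (s : R) := let a := s%:C / 2 in let v := s%:C * (u / 2) in
  csinh v / 2 + a * u / 2 * ccosh v - a / 2 * csinh v.

Lemma delta_u_0 u : delta_u u 0 = 0. Proof. by rewrite /delta_u !mul0r sinh0 subrr add0r mul0r. Qed.
Lemma ddelta_u_0 u : ddelta_u u 0 = 0. Proof. by rewrite /ddelta_u !mul0r sinh0 !mul0r; ring. Qed.

Lemma cder_delta_u u : u != 0 -> cder (delta_u u) (ddelta_u u).
Proof.
move=> u0; have hs := cder_sinh (u / 2); have hc := cder_cosh (u / 2).
have ha := cder_linear (2^-1 : C).
apply: cder_ext (cderD (cderD (cderM ha hs) (cderZ (- u^-1) (cderM ha hc))) (cderZ ((u ^+ 2)^-1) hs)) => s.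
  by rewrite /delta_u; move: (csinh _) (ccosh _) => a b; field.
by rewrite /ddelta_u; move: (csinh _) (ccosh _) => a b; field.
Qed.

Lemma cder_ddelta_u u : u != 0 -> cder (ddelta_u u) (fun s => u ^+ 2 / 4 * delta_u u s + u / 2 * delta u s).
Proof.
move=> u0; have hs := cder_sinh (u / 2); have hc := cder_cosh (u / 2).
have ha := cder_linear (2^-1 : C).
apply: cder_ext (cderD (cderZ (2^-1) hs) (cderD (cderZ (u / 2) (cderM ha hc)) (cderZ (- (2^-1)) (cderM ha hs)))) => s.
  by rewrite /ddelta_u; move: (csinh _) (ccosh _) => a b; field.
by rewrite /delta_u /delta; move: (csinh _) (ccosh _) => a b; field.
Qed.

(** Half the derivative in u of [delta_conserved]. *)
Lemma delta_u_conserved u s : u != 0 -> u * delta u s ^+ 2 + u ^+ 2 * delta u s * delta_u u s - 4 * ddelta u s * ddelta_u u s = u.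
Proof.
move=> u0; have := cosh2_sinh2 (s%:C * (u / 2)); rewrite /delta /ddelta /delta_u /ddelta_u.
move: (ccosh _) (csinh _) => c d h.
transitivity (u * (c ^+ 2 - d ^+ 2)); last by rewrite h mulr1.
by field.
Qed.

(** The expression is a nonzero multiple of the derivative of omega in u. Its
    vanishing is the limit of [omega_eq_wronskian] as u1 and u2 come
    together, with the integral of delta^2 in place of the scaled Wronskian. *)
Lemma omega_crit u t : quadrant u -> admissible u t -> 0 <= t ->
  u * delta u t * (1 - (kappa ^+ 2)%:C) - (u ^+ 2 - 1) * sqk u * delta_u u t != 0.
Proof.
move=> Qu g t0; apply/negP => /eqP e.
have u0 := quadrant_neq0 Qu.
(* The integral of delta^2 from 0 to s. *)
pose I s := 2 / u * (ddelta_u u s * delta u s - ddelta u s * delta_u u s).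
have I0 : I 0 = 0 by rewrite /I ddelta_u_0 delta_u_0 mul0r mulr0 subrr mulr0.
have hI : cder I (fun s => delta u s * delta u s).
  have h1 := cderM (cder_ddelta_u u0) (cder_delta u0).
  have h2 := cderM (cder_ddelta u0) (cder_delta_u u0).
  apply: cder_ext (cderZ (2 / u) (cderD h1 (cderZ (-1) h2))) => s.
    by rewrite /I mulN1r.
  by move: (delta _ _) (delta_u _ _) (ddelta _ _) (ddelta_u _ _) => a b c d; field.
have X0 := Im_wronskian_le0 kappa2 Qu Qu g g t0 I0 hI.
have [_ h] := g.
apply: (halfplane_contradiction X0 h).
have h1 := delta_u_conserved t u0; have h2 := delta_conserved t u0.
have d0 := delta_neq0 t Qu; have z0 := quadrant_sqk kappa Qu.
have eX : gam u t * (I t / (delta u t * delta u t)) =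
    - 1 + delta u t ^- 2 - (u ^+ 2 - 1) * delta_u u t / (u * delta u t ^+ 3).
  have -> : - 1 + delta u t ^- 2 - (u ^+ 2 - 1) * delta_u u t / (u * delta u t ^+ 3) =
     (u * delta u t - u * delta u t ^+ 3 - (u ^+ 2 - 1) * delta_u u t) / (u * delta u t ^+ 3).
    by move: d0; move: (delta _ _) (delta_u _ _) => a b a0; field; rewrite a0 u0.
  rewrite -h2 -[X in X * delta u t - _]h1 /gam /I; move: d0; move: (delta _ _) (delta_u _ _) (ddelta _ _) (ddelta_u _ _) => a b c d a0.
  by field; rewrite a0 u0.
rewrite mulNr eX; move/eqP: e; rewrite subr_eq0 => /eqP e.
have -> : (u ^+ 2 - 1) * delta_u u t / (u * delta u t ^+ 3) = (1 - (kappa ^+ 2)%:C) / (sqk u * delta u t ^+ 2).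
  apply: (@mulIf _ (sqk u * u * delta u t ^+ 3)); first by rewrite !mulf_neq0 // expf_neq0.
  have -> : (u ^+ 2 - 1) * delta_u u t / (u * delta u t ^+ 3) * (sqk u * u * delta u t ^+ 3) = (u ^+ 2 - 1) * sqk u * delta_u u t.
    by move: d0; move: (delta _ _) (delta_u _ _) (sqk _) => a b c a0; field; rewrite a0 u0.
  rewrite -e; move: d0 z0; move: (_%:C) (delta _ _) (sqk _) => k a c a0 c0; by field; rewrite a0 c0.
have ek : (kappa ^+ 2)%:C = u ^+ 2 - sqk u by rewrite /sqk; ring.
rewrite /omega ek; move: d0 z0; move: (delta _ _) (sqk _) => a c a0 c0; by field; rewrite a0 c0.
Qed.
End InjectivityInU.

(** * Elementary bounds for delta at small times *)

Section SmallTime.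
Variable R : realType.
Local Notation C := (R[i]).
Local Notation Re := complex.Re.
Local Notation Im := complex.Im.
Implicit Types (z w u : C).

Lemma expR_upper (x : R) : `|x| <= 1 / 2 -> expR x <= 1 + x + 2 * x ^+ 2.
Proof.
rewrite ler_norml => /andP[x1 x2].
have h := @expR_ge1Dx R (- x).
have e0 := @expR_gt0 R x.
have h2 : expR x * expR (- x) = 1 by rewrite -expRD subrr expR0.
have h3 : expR x * (1 - x) <= 1 by rewrite -[leRHS]h2 ler_pM2l.
have h4 : 1 <= (1 + x + 2 * x ^+ 2) * (1 - x) by nra.
rewrite -(ler_pM2r (_ : 0 < 1 - x)); last by lra.
by apply: le_trans h3 h4.
Qed.

Lemma sin_le_id (y : R) : 0 <= y -> sin y <= y.
Proof.
move=> y0; rewrite -subr_ge0.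
have hd (x : R) : is_derive x (1 : R) (fun x => x - sin x) (1 - cos x).
  exact: rderD (is_derive_id _ _) (rderN (is_derive_sin x)).
have := @derive_ge0_le R _ _ 0 y y0 (fun x _ => hd x).
by rewrite sin0 subr0; apply => x _; rewrite subr_ge0 cos_le1.
Qed.

Lemma cos_ge_quad (y : R) : 0 <= y -> 1 - y ^+ 2 / 2 <= cos y.
Proof.
move=> y0; rewrite -subr_ge0.
have hd (x : R) : is_derive x (1 : R) (fun x => cos x - (1 - x * x / 2)) (- sin x + x).
  have hi := is_derive_id x (1 : R).
  apply: rder_ext (rderD (is_derive_cos x) (rderN (rderD (is_derive_cst (1 : R) x (1 : R)) (rderN (rderM (rderM hi hi) (is_derive_cst (2^-1 : R) x (1 : R))))))) => [//|].
  by rewrite /=; field.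
have := @derive_ge0_le R _ _ 0 y y0 (fun x _ => hd x).
rewrite cos0 mul0r mul0r subr0 subrr expr2; apply => x /andP[x0 _].
by rewrite addrC subr_ge0 sin_le_id // ltW.
Qed.

Lemma sin_ge_cubic (y : R) : 0 <= y -> y - y ^+ 3 / 6 <= sin y.
Proof.
move=> y0; rewrite -subr_ge0.
have hd (x : R) : is_derive x (1 : R) (fun x => sin x - (x - x * (x * x) / 6)) (cos x - (1 - x ^+ 2 / 2)).
  have hi := is_derive_id x (1 : R).
  apply: rder_ext (rderD (is_derive_sin x) (rderN (rderD hi (rderN (rderM (rderM hi (rderM hi hi)) (is_derive_cst (6^-1 : R) x (1 : R))))))) => [//|].
  by rewrite /=; field.
have := @derive_ge0_le R _ _ 0 y y0 (fun x _ => hd x).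
rewrite sin0 !mul0r !subr0 !exprS expr0 mulr1; apply => x /andP[x0 _].
by rewrite subr_ge0 cos_ge_quad // ltW.
Qed.

Definition coshR (x : R) := (expR x + expR (- x)) / 2.

Definition sinhR (x : R) := (expR x - expR (- x)) / 2.

Lemma Re_ccosh z : Re (ccosh z) = coshR (Re z) * cos (Im z).
Proof.
rewrite /ccosh /coshR ReM ReV ImV Re_nat Im_nat ReD ImD !cexp_ReE !cexp_ImE ReN ImN cosN sinN.
by field.
Qed.

Lemma Im_ccosh z : Im (ccosh z) = sinhR (Re z) * sin (Im z).
Proof.
rewrite /ccosh /sinhR ImM ReV ImV Re_nat Im_nat ReD ImD !cexp_ReE !cexp_ImE ReN ImN cosN sinN.
by field.
Qed.

Lemma Re_csinh z : Re (csinh z) = sinhR (Re z) * cos (Im z).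
Proof.
rewrite /csinh /sinhR ReM ReV ImV Re_nat Im_nat ReD ImD ReN ImN !cexp_ReE !cexp_ImE ReN ImN cosN sinN.
by field.
Qed.

Lemma Im_csinh z : Im (csinh z) = coshR (Re z) * sin (Im z).
Proof.
rewrite /csinh /coshR ImM ReV ImV Re_nat Im_nat ReD ImD ReN ImN !cexp_ReE !cexp_ImE ReN ImN cosN sinN.
by field.
Qed.

Lemma coshR_ge1 (x : R) : 1 <= coshR x.
Proof.
have h2 : expR x * expR (- x) = 1 by rewrite -expRD subrr expR0.
have p0 := @expR_gt0 R x; have q0 := @expR_gt0 R (- x).
have h := mulr_ge0 (sqr_ge0 (expR x - 1)) (ltW q0).
rewrite (_ : _ * _ = expR x * (expR x * expR (- x)) - 2 * (expR x * expR (- x)) + expR (- x)) in h; last by ring.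
rewrite h2 in h; rewrite /coshR; lra.
Qed.

Lemma sinhR_ge (x : R) : 0 <= x -> x <= sinhR x.
Proof.
move=> x0; rewrite -subr_ge0.
have hd (y : R) : is_derive y (1 : R) (fun x => sinhR x - x) (coshR y - 1).
  have hi := is_derive_id y (1 : R).
  have h1 := is_derive_expR y; have h2 := rder_comp (rderN hi) (is_derive_expR (- y)).
  apply: rder_ext (rderD (rderM (rderD h1 (rderN h2)) (is_derive_cst (2^-1 : R) y (1 : R))) (rderN hi)) => //.
  by rewrite /coshR /=; field.
have := @derive_ge0_le R _ _ 0 x x0 (fun y _ => hd y).
have r0 : sinhR 0 = 0 by rewrite /sinhR oppr0 subrr mul0r.
rewrite r0 subr0; apply => y _; by rewrite subr_ge0 coshR_ge1.
Qed.

Lemma coshR_sinhR_bounds (x : R) : 0 <= x <= 1 / 2 ->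
  [/\ 1 <= coshR x, coshR x <= 1 + 3 / 2 * x ^+ 2, x <= sinhR x & sinhR x <= 2 * x].
Proof.
move=> /andP[x0 x1].
have h2 : expR x * expR (- x) = 1 by rewrite -expRD subrr expR0.
have ax : `|x| <= 1 / 2 by rewrite ger0_norm.
have h3 := expR_upper ax.
have := @expR_upper (- x); rewrite normrN => /(_ ax) h4.
have h5 := @expR_ge1Dx R x; have h6 := @expR_ge1Dx R (- x).
have p0 := @expR_gt0 R x; have q0 := @expR_gt0 R (- x).
rewrite sqrrN in h4.
have q1 : expR (- x) <= 1 - x + x ^+ 2.
  by have : expR x * expR (- x) <= expR x * (1 - x + x ^+ 2); [nra|rewrite ler_pM2l].
split; [exact: coshR_ge1| | exact: sinhR_ge| ]; rewrite /coshR /sinhR; nra.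
Qed.

(** The terms of first order in u cancel: delta = 1 - s / 2 + s^2 u^2 / 8 + ...,
    with imaginary part about s^2 Re u Im u / 4. The lower bound keeps half
    of it. *)
Lemma delta_bounds u (s x y : R) : quadrant u -> 0 < s -> x = s * Re u / 2 -> y = s * Im u / 2 ->
  x ^+ 2 + y ^+ 2 <= 1 / 10 -> s <= 1 / 40 ->
  [/\ 1 / 2 <= Re (delta u s), Re (delta u s) <= 2 & s ^+ 2 * Re u * Im u / 8 <= Im (delta u s)].
Proof.
move=> [a0 b0] s0 ex ey xy s1.
have ru : Re (s%:C * (u / 2)) = x.
  by rewrite ex !(ReM,ImM) ReV ImV Re_nat Im_nat ReC ImC; field.
have iu : Im (s%:C * (u / 2)) = y.
  by rewrite ey !(ReM,ImM) ReV ImV Re_nat Im_nat ReC ImC; field.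
have eR : Re (delta u s) = coshR x * cos y - (sinhR x * cos y * Re u + coshR x * sin y * Im u) / (Re u ^+ 2 + Im u ^+ 2).
  by rewrite /delta ReD ReN (Re_div (csinh _)) (ReM (csinh _)) ReJ ImJ Re_ccosh Re_csinh Im_csinh ru iu; ring.
have eI : Im (delta u s) = sinhR x * sin y - (coshR x * sin y * Re u - sinhR x * cos y * Im u) / (Re u ^+ 2 + Im u ^+ 2).
  by rewrite /delta ImD ImN (Im_div (csinh _)) (ImM (csinh _)) ReJ ImJ Im_ccosh Re_csinh Im_csinh ru iu; ring.
clear ru iu.
move: (Re (delta u s)) (Im (delta u s)) eR eI => dr di.
move: (Re u) (Im u) a0 b0 ex ey => a b a0 b0 ex ey.
have x0 : 0 < x by rewrite ex divr_gt0 // mulr_gt0.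
have y0 : 0 < y by rewrite ey divr_gt0 // mulr_gt0.
have x1 : x <= 1 / 2 by nra.
have y1 : y <= 1 / 2 by nra.
have [c1 c2 s2 s3] : [/\ 1 <= coshR x, coshR x <= 1 + 3 / 2 * x ^+ 2, x <= sinhR x & sinhR x <= 2 * x].
  by apply: coshR_sinhR_bounds; rewrite ltW.
have k1 := cos_ge_quad (ltW y0); have k2 := cos_le1 y.
have k3 := sin_le_id (ltW y0); have k4 := sin_ge_cubic (ltW y0).
have n0 : 0 < a ^+ 2 + b ^+ 2 by rewrite addr_gt0 // exprn_gt0.

have s4 : 98 / 100 * y <= sin y by nra.
have c3 : 95 / 100 <= cos y by nra.
have c4 : coshR x <= 115 / 100 by nra.
have r1 : 0 <= sinhR x by apply: le_trans s2; exact: ltW.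
have r2 : 0 <= coshR x by apply: le_trans c1.
have r3 : 0 <= cos y by lra.
have r4 : 0 <= sin y by lra.
have q0 : 0 < a * b by exact: mulr_gt0.
(* In the real part, the subtracted quotient is nonnegative and small. *)
have B0 : 0 <= sinhR x * cos y * a + coshR x * sin y * b.
  have a0' := ltW a0; have b0' := ltW b0.
  by apply: addr_ge0; apply: mulr_ge0 => //; apply: mulr_ge0.
have B1 : sinhR x * cos y * a + coshR x * sin y * b <= s * (a ^+ 2 + b ^+ 2).
  have h1 : sinhR x * cos y <= s * a by nra.
  have h2 : coshR x * sin y <= s * b by nra.
  nra.
have B2 : 0 <= (sinhR x * cos y * a + coshR x * sin y * b) / (a ^+ 2 + b ^+ 2) <= 1 / 40.
  rewrite divr_ge0 ?(ltW n0) //= ler_pdivrMr //; nra.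
(* In the imaginary part, the terms of order s cancel in the subtracted
   quotient. *)
have E1 : (coshR x * sin y * a - sinhR x * cos y * b) / (a ^+ 2 + b ^+ 2) <= s ^+ 2 * a * b / 100.
  rewrite ler_pdivrMr //.
  have h1 : coshR x * sin y * a <= coshR x * y * a by rewrite ler_pM2r // ler_wpM2l.
  have h2 : x * cos y * b <= sinhR x * cos y * b by rewrite ler_pM2r // ler_wpM2r.
  have h3 : coshR x * y * a - x * cos y * b = s * (a * b) / 2 * (coshR x - cos y) by rewrite ex ey; ring.
  have h4 : coshR x - cos y <= 3 / 2 * (x ^+ 2 + y ^+ 2) by nra.
  have h5 : x ^+ 2 + y ^+ 2 = s ^+ 2 * (a ^+ 2 + b ^+ 2) / 4 by rewrite ex ey; field.
  have h6 : s * (a * b) / 2 * (coshR x - cos y) <= s * (a * b) / 2 * (3 / 2 * (s ^+ 2 * (a ^+ 2 + b ^+ 2) / 4)).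
    rewrite -h5 ler_pM2l //. by rewrite divr_gt0 // mulr_gt0.
  have h7 : s * (a * b) / 2 * (3 / 2 * (s ^+ 2 * (a ^+ 2 + b ^+ 2) / 4)) <= s ^+ 2 * a * b / 100 * (a ^+ 2 + b ^+ 2).
    have -> : s * (a * b) / 2 * (3 / 2 * (s ^+ 2 * (a ^+ 2 + b ^+ 2) / 4)) = s * (s ^+ 2 * (a * b) * (a ^+ 2 + b ^+ 2) * (3 / 16)) by field.
    have -> : s ^+ 2 * a * b / 100 * (a ^+ 2 + b ^+ 2) = (1 / 100) * (s ^+ 2 * (a * b) * (a ^+ 2 + b ^+ 2)) by field.
    have : 0 < s ^+ 2 * (a * b) * (a ^+ 2 + b ^+ 2) by rewrite !mulr_gt0 // exprn_gt0.
    move: (_ * _ * _) => T; nra.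
  lra.
(* The main term of the imaginary part. *)
have E2 : s ^+ 2 * a * b * (24 / 100) <= sinhR x * sin y.
  have h1 : x * (98 / 100 * y) <= sinhR x * sin y by apply: ler_pM; lra.
  have h2 : x * y = s ^+ 2 * a * b / 4 by rewrite ex ey; field.
  have h3 : 0 < s ^+ 2 * a * b by rewrite -mulrA mulr_gt0 // exprn_gt0.
  nra.
have h3 : 0 < s ^+ 2 * a * b by rewrite -mulrA mulr_gt0 // exprn_gt0.
move/andP: B2 => [B2 B3].
move: ((sinhR x * cos y * a + coshR x * sin y * b) / (a ^+ 2 + b ^+ 2)) B2 B3 => B B2 B3 eR; move: ((coshR x * sin y * a - sinhR x * cos y * b) / (a ^+ 2 + b ^+ 2)) E1 => E E1 eI.
clear B0 B1 n0 k4 s4 ex ey a0 b0 q0 x0 y0 x1 y1 xy.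
have p1 : 95 / 100 <= coshR x * cos y by nra.
have p2 : coshR x * cos y <= 115 / 100 by nra.
split.
- rewrite eR; lra.
- rewrite eR; lra.
- rewrite eI; lra.
Qed.
End SmallTime.

(** * Admissible points are bounded *)

Section Bounded.
Variable R : realType.
Local Notation C := (R[i]).
Local Notation Re := complex.Re.
Local Notation Im := complex.Im.
Local Notation cj := (@conjc R).
Implicit Types (z w u : C).

Variable kappa : R.
Hypothesis kappa2 : kappa ^+ 2 < 1.

(** For large u the argument of (u^2 - 1) / (u^2 - kappa^2) is about (1 -
    kappa^2) Im (u^2) / |u|^4. At the small time s = 16 / |u|^2 that of
    delta^2, about s^2 Im (u^2) / 4, is already larger, so that omega(u,s)
    is below the real axis. *)
Lemma admissible_bounded u (t : R) : quadrant u -> 0 < t -> (forall s, 0 <= s <= t -> 0 < Im (omega kappa u s)) ->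
  Re u ^+ 2 + Im u ^+ 2 <= 640 + 16 / t.
Proof.
move=> Qu t0 hw; have [a0 b0] := Qu.
rewrite leNgt; apply/negP => hn.
set n := Re u ^+ 2 + Im u ^+ 2 in hn.
have t16 : 0 < 16 / t by rewrite divr_gt0.
have n640 : 640 < n by lra.
have n0 : 0 < n by lra.
(* The constants: s n = 16 makes Im (delta^2) large enough, and |s u / 2|^2 = s
   (s n) / 4 = 64 / n is at most 1 / 10 as n > 640, so that the bounds on
   delta apply. *)
pose s := 16 / n.
have s0 : 0 < s by rewrite divr_gt0.
have st : s <= t.
  rewrite /s ler_pdivrMr // mulrC -ler_pdivrMr //; lra.
have s1 : s <= 1 / 40 by rewrite /s ler_pdivrMr //; lra.
have sn : s * n = 16 by rewrite /s divfK // lt0r_neq0.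
have e2 : (s * Re u / 2) ^+ 2 + (s * Im u / 2) ^+ 2 <= 1 / 10.
  have -> : (s * Re u / 2) ^+ 2 + (s * Im u / 2) ^+ 2 = s * (s * n) / 4 by rewrite /n; field.
  rewrite sn; lra.
have [p1 p2 q1] := delta_bounds Qu s0 erefl erefl e2 s1.
have := hw s; rewrite (ltW s0) st => /(_ isT).
rewrite /omega Im_div.
have z0 := quadrant_sqk kappa Qu; have d0 := delta_neq0 s Qu.
rewrite pmulr_lgt0 ?invr_gt0; last first.
  by apply: sqr_ReIm_gt0; rewrite mulf_neq0 // expf_neq0.
rewrite ltNge => /negP; apply.
have -> : Im ((u ^+ 2 - 1) * cj (sqk kappa u * delta u s ^+ 2)) =
  Im (u ^+ 2) * (1 - kappa ^+ 2) * (Re (delta u s) ^+ 2 - Im (delta u s) ^+ 2)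
  - 2 * Re (delta u s) * Im (delta u s) * (n ^+ 2 - (1 + kappa ^+ 2) * Re (u ^+ 2) + kappa ^+ 2).
  have -> : n ^+ 2 = Re (u ^+ 2) ^+ 2 + Im (u ^+ 2) ^+ 2 by rewrite Re_sqr Im_sqr /n; ring.
  rewrite /sqk; move: (u ^+ 2) (delta u s) (kappa ^+ 2) => z d k.
  by rewrite expr2 !(ImM,ReM,ImD,ReD,ImN,ReN,ImJ,ReJ,Im1,Re1,ReC,ImC); ring.
have An : Re (u ^+ 2) <= n by rewrite Re_sqr /n; have := sqr_ge0 (Im u); lra.
have P : n ^+ 2 / 2 <= n ^+ 2 - (1 + kappa ^+ 2) * Re (u ^+ 2) + kappa ^+ 2.
  have k0 := sqr_ge0 kappa.
  have : (1 + kappa ^+ 2) * Re (u ^+ 2) <= (1 + kappa ^+ 2) * n by rewrite ler_wpM2l //; lra.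
  have : (1 + kappa ^+ 2) * n <= 2 * n by rewrite ler_pM2r // -[leRHS]/(1 + 1) lerD2l ltW.
  have : 4 * n <= n ^+ 2 by rewrite expr2 ler_pM2r //; lra.
  lra.
have eB : Im (u ^+ 2) = 2 * Re u * Im u := Im_sqr u.
have B0 := quadrant_sqr Qu.
have q2 : s ^+ 2 * Im (u ^+ 2) / 16 <= Im (delta u s) by rewrite eB; lra.
have k0 := sqr_ge0 kappa.
move: (Re (delta u s)) (Im (delta u s)) (Im (u ^+ 2)) (_ + kappa ^+ 2) p1 p2 q2 B0 P => p q B P p1 p2 q2 B0 hP.
have h1 : B * (1 - kappa ^+ 2) * (p ^+ 2 - q ^+ 2) <= B * 4.
  rewrite -mulrA ler_pM2l //.
  have k1 : 0 <= 1 - kappa ^+ 2 by rewrite subr_ge0 ltW.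
  have k2 : 1 - kappa ^+ 2 <= 1 by rewrite lerBlDr lerDl.
  have : p ^+ 2 - q ^+ 2 <= 4 by nra.
  move: (1 - kappa ^+ 2) (p ^+ 2 - q ^+ 2) k1 k2; clear => c v k1 k2 hv.
  by apply: le_trans (ler_wpM2l k1 hv) _; rewrite ler_piMl.
have h2 : B * 8 <= 2 * p * q * P.
  have hq : 0 < s ^+ 2 * B / 16 by rewrite divr_gt0 // mulr_gt0 // exprn_gt0.
  have h3 : (s ^+ 2 * B / 16) * (n ^+ 2 / 2) <= q * P.
    by apply: ler_pM => //; [exact: ltW|rewrite divr_ge0 // sqr_ge0].
  have e : (s ^+ 2 * B / 16) * (n ^+ 2 / 2) = B * 8.
    have -> : (s ^+ 2 * B / 16) * (n ^+ 2 / 2) = B * (s * n) ^+ 2 / 32 by field.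
    by rewrite sn; field.
  have : 0 < q * P by apply: lt_le_trans h3; rewrite e mulr_gt0.
  rewrite e in h3; rewrite -2!mulrA; move: (q * P) h3 => T; nra.
lra.
Qed.
End Bounded.

(** * Complex differentiability *)

Section ComplexDifferentiability.
Variable R : realType.
Local Notation C := (R[i]).
Local Notation Re := complex.Re.
Local Notation Im := complex.Im.
Implicit Types (z w u : C).

(** Differentiability in the form of Caratheodory: the difference quotient
    extends continuously. The rules of differentiation are then identities
    between such extensions. *)
Definition cdiff (f : C -> C) z l := exists phi : C -> C,
  [/\ ccont phi z, phi z = l & cnear z (fun x => f x = f z + phi x * (x - z))].

Lemma cnearT z (P : C -> Prop) : (forall x, P x) -> cnear z P.
Proof. by move=> h; exists 1 => // x _ _. Qed.

Lemma cdiff_cont f z l : cdiff f z l -> ccont f z.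
Proof.
move=> [phi [cp _ hf]].
apply: (@ccont_near R (fun x => f z + phi x * (x - z))); first by apply: cnearS hf => x ->.
apply: ccontD; first exact: ccont_cst.
exact: ccontM cp (ccontD (ccont_id z) (ccont_cst (- z) z)).
Qed.

Lemma cdiff_cst k z : cdiff (fun=> k) z 0.
Proof.
exists (fun=> 0); split => //; first by exact: (ccont_cst _ z).
by apply: cnearT => x; rewrite mul0r addr0.
Qed.

Lemma cdiff_id z : cdiff (fun x => x) z 1.
Proof.
exists (fun=> 1); split => //; first by exact: (ccont_cst _ z).
by apply: cnearT => x; rewrite mul1r; ring.
Qed.

Lemma cdiff_eq f z l l' : l = l' -> cdiff f z l -> cdiff f z l'.
Proof. by move=> ->. Qed.

Lemma cdiffD f g z l m : cdiff f z l -> cdiff g z m -> cdiff (fun x => f x + g x) z (l + m).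
Proof.
move=> [p [cp pl hp]] [q [cq ql hq]].
exists (fun x => p x + q x); split; [exact: ccontD cp cq|by rewrite pl ql|].
by apply: cnearS (cnearI hp hq) => x [-> ->]; ring.
Qed.

Lemma cdiffM f g z l m : cdiff f z l -> cdiff g z m -> cdiff (fun x => f x * g x) z (l * g z + f z * m).
Proof.
move=> hf hg; have cg := cdiff_cont hg; move: hf hg => [p [cp pl hp]] [q [cq ql hq]].
exists (fun x => p x * g x + f z * q x); split.
- exact: ccontD (ccontM cp cg) (ccontM (ccont_cst (f z) z) cq).
- by rewrite pl ql.
- by apply: cnearS (cnearI hp hq) => x [-> ->]; ring.
Qed.

Lemma cdiffZ k f z l : cdiff f z l -> cdiff (fun x => k * f x) z (k * l).
Proof. by move=> hf; apply: cdiff_eq (cdiffM (cdiff_cst k z) hf); rewrite mul0r add0r. Qed.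

Lemma ccont_neq0 (f : C -> C) z : f z != 0 -> ccont f z -> cnear z (fun x => f x != 0).
Proof.
move=> f0 /ccontE cf; apply: (cf (fun y => y != 0)).
have [r0|r0] := eqVneq (Re (f z)) 0; last first.
  exists `|Re (f z)|; first by rewrite normr_gt0.
  by move=> x h _; apply: contraTneq h => ->; rewrite sub0r normrN ltxx.
have i0 : Im (f z) != 0 by apply: contra f0 => /eqP i0; apply/eqP; apply: complexP.
exists `|Im (f z)|; first by rewrite normr_gt0.
by move=> x _ h; apply: contraTneq h => ->; rewrite sub0r normrN ltxx.
Qed.

Lemma cdiffV (f : C -> C) z l : f z != 0 -> cdiff f z l -> cdiff (fun x => (f x)^-1) z (- l / f z ^+ 2).
Proof.
move=> f0 hf; have cf := cdiff_cont hf; have nz := ccont_neq0 f0 cf; move: hf => [p [cp pl hp]].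
exists (fun x => - p x * ((f x)^-1 * (f z)^-1)); split.
- exact: ccontM (ccontN cp) (ccontM (ccontV f0 cf) (ccont_cst (f z)^-1 z)).
- by rewrite pl expr2 invfM.
- apply: cnearS (cnearI hp nz) => x [e fx0].
  have -> : - p x * ((f x)^-1 * (f z)^-1) * (x - z) = - (f x - f z) * ((f x)^-1 * (f z)^-1).
    by rewrite {2}e; ring.
  by field; rewrite f0 fx0.
Qed.

Lemma cdiff_comp f g z l m : cdiff f z l -> cdiff g (f z) m -> cdiff (fun x => g (f x)) z (m * l).
Proof.
move=> hf; have /ccontE cf := cdiff_cont hf; have cf' := cdiff_cont hf.
move: hf => [p [cp pl hp]] [q [cq ql hq]].
exists (fun x => q (f x) * p x); split.
- exact: ccontM (ccont_comp cf' cq) cp.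
- by rewrite ql pl.
- apply: cnearS (cnearI hp (cf _ hq)) => x [e ->]; rewrite e; ring.
Qed.

Lemma expR_sub1 (a : R) : `|a| <= 1 / 2 -> [/\ expR a <= 2, `|expR a - 1| <= 2 * `|a| & `|expR a - 1 - a| <= 2 * a ^+ 2].
Proof.
move=> ha; have h1 := expR_upper ha; have h2 := @expR_ge1Dx R a.
have a2 : a ^+ 2 = `|a| ^+ 2 by rewrite real_normK // num_real.
have [q1 q2] : a <= `|a| /\ - `|a| <= a by rewrite ler_norm lerNl -normrN ler_norm.
have n0 := normr_ge0 a.
have sq : `|a| ^+ 2 <= `|a| / 2 by nra.
rewrite a2 in h1 *.
split; [lra|rewrite ler_norml; lra|rewrite ler_norml; lra].
Qed.

Lemma sin_subid (b : R) : `|b| <= 1 / 2 -> `|sin b - b| <= b ^+ 2.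
Proof.
have pos (c : R) : 0 <= c -> c <= 1 / 2 -> `|sin c - c| <= c ^+ 2.
  move=> c0 c1; have h1 := sin_le_id c0; have h2 := sin_ge_cubic c0.
  rewrite ler_norml; nra.
have [b0|b0] := leP 0 b; first by rewrite ger0_norm // => ?; exact: pos.
rewrite ltr0_norm // => b1; have := @pos (- b).
rewrite oppr_ge0 (ltW b0) => /(_ isT b1); rewrite sinN sqrrN -opprD normrN; exact.
Qed.

Lemma cos_sub1 (b : R) : `|cos b - 1| <= b ^+ 2 / 2.
Proof.
have pos (c : R) : 0 <= c -> `|cos c - 1| <= c ^+ 2 / 2.
  move=> c0; have h1 := cos_ge_quad c0; have h2 := cos_le1 c.
  rewrite ler_norml; have := sqr_ge0 c; lra.
have [b0|b0] := leP 0 b; first exact: pos.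
have := @pos (- b); rewrite oppr_ge0 (ltW b0) cosN sqrrN; exact.
Qed.

Lemma normr_Re_div z w (c : R) : w != 0 -> 0 <= c ->
  `|Re z| <= c * (Re w ^+ 2 + Im w ^+ 2) -> `|Im z| <= c * (Re w ^+ 2 + Im w ^+ 2) ->
  `|Re (z / w)| <= c * (`|Re w| + `|Im w|) /\ `|Im (z / w)| <= c * (`|Re w| + `|Im w|).
Proof.
move=> w0 c0 h1 h2; have n0 := sqr_ReIm_gt0 w0.
have key (p q : R) : `|p| <= c * (Re w ^+ 2 + Im w ^+ 2) -> `|q| <= c * (Re w ^+ 2 + Im w ^+ 2) ->
    `|p * Re w + q * Im w| / (Re w ^+ 2 + Im w ^+ 2) <= c * (`|Re w| + `|Im w|).
  move=> hp hq; rewrite ler_pdivrMr //.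
  apply: le_trans (ler_normD _ _) _; rewrite !normrM.
  have -> : c * (`|Re w| + `|Im w|) * (Re w ^+ 2 + Im w ^+ 2) =
     c * (Re w ^+ 2 + Im w ^+ 2) * `|Re w| + c * (Re w ^+ 2 + Im w ^+ 2) * `|Im w| by ring.
  by apply: lerD; apply: ler_wpM2r.
rewrite Re_div Im_div ReM ImM ReJ ImJ !normrM !normfV (gtr0_norm n0); split.
  have -> : Re z * Re w - Im z * - Im w = Re z * Re w + Im z * Im w by ring.
  exact: key.
have -> : Re z * - Im w + Im z * Re w = Im z * Re w + (- Re z) * Im w by ring.
by apply: key => //; rewrite normrN.
Qed.

Lemma cexp_rem z : `|Re z| <= 1 / 2 -> `|Im z| <= 1 / 2 ->
  `|Re (cexp z - 1 - z)| <= 3 * (Re z ^+ 2 + Im z ^+ 2) /\ `|Im (cexp z - 1 - z)| <= 3 * (Re z ^+ 2 + Im z ^+ 2).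
Proof.
rewrite !(ReD, ImD, ReN, ImN, Re1, Im1) cexp_ReE cexp_ImE.
move: (Re z) (Im z) => a b ha hb.
have [e1 e2 e3] := expR_sub1 ha; have s1 := sin_subid hb; have c1 := cos_sub1 b.
have e0 := @expR_gt0 R a.
have a2 : a ^+ 2 = `|a| ^+ 2 by rewrite real_normK // num_real.
have b2 : b ^+ 2 = `|b| ^+ 2 by rewrite real_normK // num_real.
split.
  have -> : expR a * cos b - 1 - a = (expR a - 1 - a) + expR a * (cos b - 1) by ring.
  apply: le_trans (ler_normD _ _) _; rewrite normrM (gtr0_norm e0).
  have : expR a * `|cos b - 1| <= 2 * (b ^+ 2 / 2) by apply: ler_pM => //; exact: ltW.
  have := sqr_ge0 a; have := sqr_ge0 b; lra.
have -> : expR a * sin b - 0 - b = expR a * (sin b - b) + (expR a - 1) * b by ring.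
apply: le_trans (ler_normD _ _) _; rewrite !normrM (gtr0_norm e0).
have h1 : expR a * `|sin b - b| <= 2 * b ^+ 2 by apply: ler_pM => //; exact: ltW.
have h2 : `|expR a - 1| * `|b| <= 2 * `|a| * `|b| by apply: ler_wpM2r.
have h3 : 2 * `|a| * `|b| <= a ^+ 2 + b ^+ 2.
  rewrite a2 b2 -subr_ge0; have := sqr_ge0 (`|a| - `|b|); by rewrite sqrrB; lra.
have := sqr_ge0 a; lra.
Qed.

Lemma cdiff_cexp0 : cdiff (@cexp R) 0 1.
Proof.
pose phi h : C := if h == 0 then 1 else (cexp h - 1) / h.
exists phi; split; last first.
- apply: cnearT => x; rewrite cexp0 subr0 /phi; case: eqVneq => [->|x0]; first by rewrite cexp0; ring.
  by field.
- by rewrite /phi eqxx.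
have bnd (e : R) : 0 < e -> exists2 d : R, 0 < d & forall x, `|Re x - Re (0 : C)| < d -> `|Im x - Im (0 : C)| < d ->
    `|Re (phi x) - 1| < e /\ `|Im (phi x)| < e.
  move=> e0; exists (Num.min (1 / 2) (e / 6)); first by rewrite lt_min divr_gt0 //= divr_gt0.
  move=> x; rewrite !subr0 !lt_min => /andP[a1 a2] /andP[b1 b2].
  rewrite /phi; case: eqVneq => [_|x0]; first by rewrite Re1 Im1 subrr normr0.
  have [r1 r2] := cexp_rem (ltW a1) (ltW b1).
  have [k1 k2] := normr_Re_div x0 (ler0n _ 3) r1 r2.
  have ex : (cexp x - 1 - x) / x = (cexp x - 1) / x - 1 by field.
  rewrite ex ReD ImD ReN ImN Re1 Im1 subr0 in k1 k2.
  split; [apply: le_lt_trans k1 _|apply: le_lt_trans k2 _]; lra.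
apply/ccontP; split; apply/rcontP => e e0; have [d d0 hd] := bnd e e0; exists d => // x h1 h2; have [k1 k2] := hd x h1 h2.
  by rewrite /phi eqxx Re1.
by rewrite {2}/phi eqxx Im1 subr0.
Qed.

Lemma cdiff_cexp z : cdiff (@cexp R) z (cexp z).
Proof.
have h1 : cdiff (fun x => x - z) z 1.
  by apply: cdiff_eq (cdiffD (cdiff_id z) (cdiff_cst (- z) z)); rewrite addr0.
have h2 : cdiff (fun x => cexp (x - z)) z 1.
  have h0 : cdiff (@cexp R) (z - z) 1 by rewrite subrr; exact: cdiff_cexp0.
  by apply: cdiff_eq (cdiff_comp h1 h0); rewrite mulr1.
have h3 := cdiffZ (cexp z) h2.
rewrite (_ : @cexp R = fun x => cexp z * cexp (x - z)).
  by apply: cdiff_eq h3; rewrite subrr cexp0; ring.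
by apply/funext => x; rewrite -cexpD addrC subrK.
Qed.

Lemma cdiff_cosh f z l : cdiff f z l -> cdiff (fun x => ccosh (f x)) z (csinh (f z) * l).
Proof.
move=> hf; have h1 := cdiff_comp hf (cdiff_cexp (f z)).
have h2 := cdiff_comp (cdiffZ (-1) hf) (cdiff_cexp (-1 * f z)).
have h3 := cdiffZ (2^-1) (cdiffD h1 h2).
rewrite (_ : (fun x => ccosh (f x)) = fun x => 2^-1 * (cexp (f x) + cexp (-1 * f x))).
  by apply: cdiff_eq h3; rewrite /csinh !mulN1r; ring.
by apply/funext => x; rewrite /ccosh mulN1r; ring.
Qed.

Lemma cdiff_sinh f z l : cdiff f z l -> cdiff (fun x => csinh (f x)) z (ccosh (f z) * l).
Proof.
move=> hf; have h1 := cdiff_comp hf (cdiff_cexp (f z)).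
have h2 := cdiff_comp (cdiffZ (-1) hf) (cdiff_cexp (-1 * f z)).
have h3 := cdiffZ (2^-1) (cdiffD h1 (cdiffZ (-1) h2)).
rewrite (_ : (fun x => csinh (f x)) = fun x => 2^-1 * (cexp (f x) + -1 * cexp (-1 * f x))).
  by apply: cdiff_eq h3; rewrite /ccosh !mulN1r; ring.
by apply/funext => x; rewrite /csinh !mulN1r; ring.
Qed.

Lemma cdiff_delta u s : u != 0 -> cdiff (fun u => delta u s) u (delta_u u s).
Proof.
move=> u0.
have hv := cdiffZ (s%:C / 2) (cdiff_id u).
have h := cdiffD (cdiff_cosh hv) (cdiffZ (-1) (cdiffM (cdiff_sinh hv) (cdiffV u0 (cdiff_id u)))).
have e x : s%:C / 2 * x = s%:C * (x / 2) by ring.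
rewrite (_ : (fun u => delta u s) = fun x => ccosh (s%:C / 2 * x) + -1 * (csinh (s%:C / 2 * x) * x^-1)).
  apply: cdiff_eq h; rewrite /delta_u !e; move: (csinh _) (ccosh _) => p q; by field.
by apply/funext => x; rewrite /delta !e; ring.
Qed.

Definition sqnorm z := Re z ^+ 2 + Im z ^+ 2.

Lemma sqnormM z w : sqnorm (z * w) = sqnorm z * sqnorm w.
Proof. by rewrite /sqnorm ReM ImM; ring. Qed.

(** A short step from z along - f z / l multiplies the value by a factor
    slightly below 1, up to terms of higher order. *)
Lemma sqnorm_decrease f z l (P : C -> Prop) : cdiff f z l -> l != 0 -> f z != 0 -> cnear z P ->
  exists2 x, P x & sqnorm (f x) < sqnorm (f z).
Proof.
move=> [phi [cp pl hf]] l0 f0 hP.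
have cm : ccont (fun x => phi x * l^-1) z := ccontM cp (ccont_cst l^-1 z).
have m1 : phi z * l^-1 = 1 by rewrite pl divff.
have near1 : cnear (phi z * l^-1) (fun m => 1 / 2 < Re m < 2 /\ -1 < Im m < 1).
  exists (1 / 2); first by rewrite divr_gt0.
  move=> m; rewrite m1 Re1 Im1 subr0 !ltr_norml => /andP[a1 a2] /andP[b1 b2].
  by split; apply/andP; split; lra.
have [d d0 H] := cnearI (cnearI hf ((ccontE _ _).1 cm _ near1)) hP.
(* The length h of the step keeps the point in the box of size d and lets the
   term of first order dominate. *)
pose dir := - f z / l.
pose h := Num.min (1 / 10) (d / (2 * (`|Re dir| + `|Im dir| + 1))).
have n0 : 0 < `|Re dir| + `|Im dir| + 1 by rewrite ltr_wpDl ?addr_ge0.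
have h0 : 0 < h by rewrite lt_min divr_gt0 //= divr_gt0 // mulr_gt0.
have h1 : h <= 1 / 10 by rewrite ge_min lexx.
have hd : h * (`|Re dir| + `|Im dir| + 1) < d.
  have : h <= d / (2 * (`|Re dir| + `|Im dir| + 1)) by rewrite ge_min lexx orbT.
  rewrite ler_pdivlMr ?mulr_gt0 //; lra.
have hb (r : R) : `|r| <= `|Re dir| + `|Im dir| -> `|h * r| < d.
  move=> hr; rewrite normrM (gtr0_norm h0); apply: le_lt_trans hd; rewrite ler_pM2l //; lra.
have [||[ef [mr mi]] Px] := H (z + h%:C * dir).
- rewrite ReD addrAC subrr add0r ReM ReC ImC mul0r subr0; apply: hb; by rewrite lerDl.
- rewrite ImD addrAC subrr add0r ImM ReC ImC mul0r addr0; apply: hb; by rewrite lerDr.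
exists (z + h%:C * dir) => //.
set m := phi (z + h%:C * dir) * l^-1 in mr mi.
have -> : f (z + h%:C * dir) = f z * (1 - h%:C * m).
  rewrite ef /m /dir; by field.
rewrite sqnormM -[ltRHS]mulr1 ltr_pM2l; last exact: sqr_ReIm_gt0.
clearbody m; rewrite /sqnorm !(ReD,ImD,ReN,ImN,ReM,ImM,ReC,ImC,Re1,Im1).
move: (Re m) (Im m) mr mi => p q /andP[p1 p2] /andP[q1 q2].
have pq : p ^+ 2 + q ^+ 2 <= 5 by nra.
have k1 : h * (p ^+ 2 + q ^+ 2) <= 1 / 2 by nra.
have k2 : 0 < h * (2 * p - h * (p ^+ 2 + q ^+ 2)) by rewrite mulr_gt0 // subr_gt0; lra.
rewrite -subr_gt0; apply: (lt_le_trans k2); rewrite le_eqVlt; apply/orP; left; apply/eqP; ring.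
Qed.
End ComplexDifferentiability.

(** * The principal square root and the Cayley map *)

Section SquareRoot.
Variable R : realType.
Local Notation C := (R[i]).
Local Notation Re := complex.Re.
Local Notation Im := complex.Im.
Local Notation cj := (@conjc R).
Implicit Types (z w u : C).

(** The complement of the half-line of real numbers at most 0; on it the
    principal square root is continuous, with positive real part. *)
Definition off_cut z := Im z = 0 -> 0 < Re z.

Lemma off_cut_near z : off_cut z -> cnear z off_cut.
Proof.
move=> oz; have [i0|i0] := eqVneq (Im z) 0.
  exists (Re z); first exact: oz.
  by move=> x; rewrite ltr_norml => /andP[h _] _ _; lra.
exists `|Im z|; first by rewrite normr_gt0.
by move=> x _ h e; move: h; rewrite e sub0r normrN ltxx.
Qed.

Lemma Re_sqrtc_ge0 z : 0 <= Re (sqrtc z).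
Proof. by case: z => x y; rewrite /sqrtc /=; exact: sqrtr_ge0. Qed.

Lemma Re_sqrtc_gt0 z : off_cut z -> 0 < Re (sqrtc z).
Proof.
move=> oz; rewrite lt_neqAle Re_sqrtc_ge0 andbT eq_sym; apply/negP => /eqP r0.
have e := sqr_sqrtc z.
have ei : Im z = 0 by rewrite -e Im_sqr r0; ring.
by have := oz ei; rewrite -e Re_sqr r0 expr0n /= sub0r oppr_gt0 ltNge sqr_ge0.
Qed.

Lemma sqrtc_unique v z : 0 < Re v -> v ^+ 2 = z -> sqrtc z = v.
Proof.
move=> v0 e; have : sqrtc z ^+ 2 == v ^+ 2 by rewrite sqr_sqrtc e.
rewrite eqf_sqr => /orP[/eqP//|/eqP h].
by have := Re_sqrtc_ge0 z; rewrite h ReN oppr_ge0 leNgt v0.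
Qed.

Lemma off_cut_sqr z : 0 < Re z -> off_cut (z ^+ 2).
Proof.
move=> r0; rewrite /off_cut Im_sqr Re_sqr => /eqP.
rewrite mulf_eq0 mulf_eq0 pnatr_eq0 (gt_eqF r0) /= => /eqP ->.
by rewrite expr0n subr0 exprn_gt0.
Qed.

Lemma sqrtc_sqr z : 0 < Re z -> sqrtc (z ^+ 2) = z.
Proof. by move=> r0; apply: sqrtc_unique. Qed.

Lemma sqrtcJ z : off_cut z -> sqrtc (cj z) = cj (sqrtc z).
Proof.
move=> oz; apply: sqrtc_unique; first by rewrite ReJ Re_sqrtc_gt0.
by rewrite expr2 -conjM -expr2 sqr_sqrtc.
Qed.

(** Off the cut the imaginary part of the root is Im x / (2 Re (sqrtc x)), which
    removes the sign in its definition. *)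
Lemma ccont_sqrtc z : off_cut z -> ccont (@sqrtc R) z.
Proof.
move=> oz.
have hr : rcont (fun x => Re x) z := rcont_Re (ccont_id z).
have hi : rcont (fun x => Im x) z := rcont_Im (ccont_id z).
have sq (f : C -> R) : rcont f z -> rcont (fun x => Num.sqrt (f x)) z.
  by move=> hf; exact: rcont_comp hf (@sqrt_continuous R _).
have hR : rcont (fun x => Re (sqrtc x)) z.
  rewrite (_ : (fun x => Re (sqrtc x)) = fun x => Num.sqrt ((Num.sqrt (Re x * Re x + Im x * Im x) + Re x) * 2^-1)).
    have h1 := sq _ (rcontD (rcontM hr hr) (rcontM hi hi)).
    exact: sq _ (rcontM (rcontD h1 hr) (rcont_cst 2^-1 z)).
  by apply/funext => [[x y]]; rewrite /sqrtc /= !expr2.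
have r0 := Re_sqrtc_gt0 oz.
have nR : cnear z (fun x => 0 < Re (sqrtc x)).
  have [d d0 hd] := (rcontP _ _).1 hR _ r0.
  by exists d => // x h1 h2; have := hd x h1 h2; rewrite ltr_norml => /andP[h _]; lra.
pose f (x : C) : C := (Re (sqrtc x)) +i* (Im x * (Re (sqrtc x) * 2)^-1).
apply: (@ccont_near R f).
  apply: cnearS nR => x x0; apply: complexP => //=.
  have := congr1 (@complex.Im R) (sqr_sqrtc x); rewrite Im_sqr => <-.
  by field; rewrite lt0r_neq0.
apply/ccontP; split => //.
apply: (rcontM hi); apply: rcontV; first by rewrite mulf_neq0 // lt0r_neq0.
exact: rcontM hR (rcont_cst 2 z).
Qed.

Lemma unit_discE z : unit_disc z <-> sqnorm z < 1.
Proof.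
rewrite /unit_disc /= normc_def /sqnorm -[1 : C]/(1%:C) ltcR.
rewrite -[X in _ < X](sqrtr1 R) ltr_sqrt ?ltr01 //.
Qed.

Lemma slit_planeE w : slit_plane w <-> off_cut (1 - w).
Proof.
rewrite /slit_plane /off_cut /= ReD ImD ReN ImN Re1 Im1 sub0r; split.
  move=> h e; rewrite subr_gt0 ltNge; apply/negP => r1; apply: h.
  by rewrite lecE Re1 Im1 r1 andbT -oppr_eq0 e.
move=> h; rewrite lecE Re1 Im1 => /andP[/eqP e]; rewrite leNgt => /negP; apply.
by rewrite -subr_gt0; apply: h; rewrite e oppr0.
Qed.

Lemma cayley_disc z : 0 < Re z <-> sqnorm ((1 - z) / (1 + z)) < 1 /\ 1 + z != 0.
Proof.
have e : sqnorm (1 + z) - sqnorm (1 - z) = 4 * Re z by rewrite /sqnorm !(ReD,ImD,ReN,ImN,Re1,Im1); ring.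
have nd (d : C) : d != 0 -> sqnorm ((1 - z) / d) = sqnorm (1 - z) / sqnorm d.
  move=> d0; have n0 : sqnorm d != 0 by exact: lt0r_neq0 (sqr_ReIm_gt0 d0).
  by apply: (mulIf n0); rewrite -sqnormM divfK // divfK.
split.
  move=> r0.
  have d0 : 1 + z != 0.
    apply/negP => /eqP/(congr1 (@complex.Re R)); rewrite ReD Re1 /=; lra.
  split => //; rewrite nd // ltr_pdivrMr ?(sqr_ReIm_gt0 d0) // mul1r; lra.
move=> [h d0]; move: h; rewrite nd // ltr_pdivrMr ?(sqr_ReIm_gt0 d0) // mul1r; lra.
Qed.
End SquareRoot.

(** * The flow expressed through u *)

Section FlowInU.
Variable R : realType.
Local Notation C := (R[i]).
Local Notation Re := complex.Re.
Local Notation Im := complex.Im.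
Local Notation H0 := (@H0 R).
Implicit Types (z w u : C).
Variable kappa : R.
Hypothesis kappa2 : kappa ^+ 2 < 1.
Local Notation omega := (@omega R kappa).
Local Notation sqk := (@sqk R kappa).

Lemma onem_kappa2_neq0 : 1 - kappa ^+ 2 != 0. Proof. by rewrite subr_eq0 gt_eqF. Qed.
Lemma onem_kappa2_gt0 : 0 < 1 - kappa ^+ 2. Proof. by rewrite subr_gt0. Qed.

Definition u_of z := a kappa (H0 z).

Lemma Re_H0 z : unit_disc z -> 0 < Re (H0 z).
Proof.
move=> /unit_discE h; have d0 : 1 - z != 0.
  rewrite subr_eq0; apply: contraTneq h => <-.
  by rewrite /sqnorm Re1 Im1 expr1n expr0n addr0 ltxx.
apply/cayley_disc; rewrite /H0.
have e2 : 1 + (1 + z) / (1 - z) = 2 / (1 - z) by field.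
have h0 : 1 + (1 + z) / (1 - z) != 0 by rewrite e2 mulf_neq0 // ?invr_eq0 // pnatr_eq0.
split => //; have -> : (1 - (1 + z) / (1 - z)) / (1 + (1 + z) / (1 - z)) = - z.
  by rewrite e2; field; rewrite d0.
by move: h; rewrite /sqnorm ReN ImN !sqrrN.
Qed.

Lemma sqnormN z : sqnorm (- z) = sqnorm z. Proof. by rewrite /sqnorm ReN ImN !sqrrN. Qed.

Lemma H0_disc y : 0 < Re y -> unit_disc ((y - 1) / (y + 1)) /\ H0 ((y - 1) / (y + 1)) = y.
Proof.
move=> r0; have [h d0] := (cayley_disc y).1 r0; split.
  apply/unit_discE.
  have -> : (y - 1) / (y + 1) = - ((1 - y) / (1 + y)) by rewrite -mulNr opprB (addrC y 1).
  by rewrite sqnormN.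
rewrite addrC in d0; rewrite /H0.
have -> : 1 + (y - 1) / (y + 1) = 2 * y / (y + 1) by field.
have -> : 1 - (y - 1) / (y + 1) = 2 / (y + 1) by field.
by field.
Qed.

Lemma H0K z : unit_disc z -> (H0 z - 1) / (H0 z + 1) = z.
Proof.
move=> /unit_discE h; have d0 : 1 - z != 0.
  rewrite subr_eq0; apply: contraTneq h => <-.
  by rewrite /sqnorm Re1 Im1 expr1n expr0n addr0 ltxx.
have e2 : (1 + z) / (1 - z) + 1 = 2 / (1 - z) by field.
rewrite /H0 e2; by field; rewrite d0.
Qed.

Lemma Re_aff (k c : R) w : Re (k%:C + c%:C * w) = k + c * Re w.
Proof. by rewrite ReD ReM !ReC !ImC; ring. Qed.

Lemma Im_aff (k c : R) w : Im (k%:C + c%:C * w) = c * Im w.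
Proof. by rewrite ImD ImM !ReC !ImC; ring. Qed.

Lemma off_cut_aff y : 0 < Re y -> off_cut ((kappa ^+ 2)%:C + (1 - kappa ^+ 2)%:C * y ^+ 2).
Proof.
move=> r0; have h := off_cut_sqr r0; rewrite /off_cut Re_aff Im_aff => /eqP.
rewrite mulf_eq0 (negbTE onem_kappa2_neq0) /= => /eqP/h h2.
by rewrite ltr_wpDl ?sqr_ge0 // mulr_gt0 // onem_kappa2_gt0.
Qed.

Lemma Re_a y : 0 < Re y -> 0 < Re (a kappa y).
Proof. by move=> r0; apply: Re_sqrtc_gt0; exact: off_cut_aff. Qed.

Lemma sqk_a y : sqk (a kappa y) = (1 - kappa ^+ 2)%:C * y ^+ 2.
Proof. by rewrite /sqk /a sqr_sqrtc addrC addKr. Qed.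

Lemma sqk_a_neq0 y : 0 < Re y -> sqk (a kappa y) != 0.
Proof.
move=> r0; rewrite sqk_a mulf_neq0 //; first by rewrite eq_complex /= eqxx andbT onem_kappa2_neq0.
by rewrite expf_neq0 //; apply: contraTneq r0 => ->; rewrite ltxx.
Qed.

Lemma cexp_neq0 z : cexp z != 0.
Proof.
apply/negP => /eqP h; have : cexp z * cexp (- z) = 1 by rewrite -cexpD subrr cexp0.
by rewrite h mul0r => /eqP; rewrite eq_sym oner_eq0.
Qed.

(** With e = exp (t u / 2), both the argument of alpha and delta are rational in
    e and u, and the point at infinity is taken exactly at the zeros of
    delta. *)
Lemma psi_arg_omega t z : unit_disc z ->
  psi_arg kappa t z = if delta (u_of z) t == 0 then None else Some (omega (u_of z) t).
Proof.
move=> Dz; rewrite /psi_arg -/(u_of z).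
have y0 := Re_H0 Dz; have u0 : 0 < Re (u_of z) := Re_a y0.
have zz := sqk_a_neq0 y0; rewrite -/(u_of z) in zz.
move: (u_of z) u0 zz => u u0 zz.
have un : u != 0 by apply: contraTneq u0 => ->; rewrite ltxx.
have u1 : u + 1 != 0.
  by apply/negP => /eqP/(congr1 (@complex.Re R)); rewrite ReD Re1 /=; lra.
pose e := cexp (t%:C * (u / 2)).
have e0 : e != 0 := cexp_neq0 _.
have ee : cexp (t%:C * u) = e ^+ 2.
  by rewrite expr2 -cexpD; congr cexp; field.
have eD : delta u t = ((u - 1) * e + (u + 1) * e^-1) / (2 * u).
  rewrite /delta /ccosh /csinh -/e.
  have -> : cexp (- (t%:C * (u / 2))) = e^-1.
    by apply: (mulfI e0); rewrite divff // -cexpD subrr cexp0.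
  by field; rewrite un e0.
have e1 : 1 + xi t u = 2 * u * e * delta u t / (u + 1).
  by rewrite /xi ee eD; field; rewrite un e0 u1.
clearbody e; rewrite /alpha_inv -addr_eq0 (addrC (xi t u)) e1.
rewrite !mulf_eq0 invr_eq0 (negbTE u1) (negbTE un) (negbTE e0) pnatr_eq0 /= orbF.
case: eqVneq => // d0 /=; congr Some.
rewrite /omega; move: zz; rewrite /sqk rmorphXn /= => zz.
rewrite /xi ee; by field; rewrite un e0 u1 d0 zz.
Qed.

Lemma ccont_cosh (f : C -> C) z : ccont f z -> ccont (fun x => ccosh (f x)) z.
Proof.
move=> hf; have h1 := ccont_comp hf (ccont_cexp _); have h2 := ccont_comp (ccontN hf) (ccont_cexp _).
exact: ccontM (ccontD h1 h2) (ccont_cst 2^-1 z).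
Qed.

Lemma ccont_sinh (f : C -> C) z : ccont f z -> ccont (fun x => csinh (f x)) z.
Proof.
move=> hf; have h1 := ccont_comp hf (ccont_cexp _); have h2 := ccont_comp (ccontN hf) (ccont_cexp _).
exact: ccontM (ccontD h1 (ccontN h2)) (ccont_cst 2^-1 z).
Qed.

Lemma ccont_arg (t : R) (f : C -> C) z : ccont f z -> ccont (fun x => t%:C * (f x / 2)) z.
Proof. by move=> hf; exact: ccontM (ccont_cst t%:C z) (ccontM hf (ccont_cst 2^-1 z)). Qed.

Lemma ccont_delta (t : R) (f : C -> C) z : f z != 0 -> ccont f z -> ccont (fun x => delta (f x) t) z.
Proof.
move=> f0 hf; have ha := @ccont_arg t f z hf.
exact: ccontD (ccont_cosh ha) (ccontN (ccontM (ccont_sinh ha) (ccontV f0 hf))).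
Qed.

Lemma ccont_ddelta (t : R) (f : C -> C) z : ccont f z -> ccont (fun x => ddelta (f x) t) z.
Proof.
move=> hf; have ha := @ccont_arg t f z hf.
exact: ccontD (ccontM (ccontM hf (ccont_cst 2^-1 z)) (ccont_sinh ha)) (ccontN (ccontM (ccont_cosh ha) (ccont_cst 2^-1 z))).
Qed.

Lemma ccont_gam (t : R) (f : C -> C) z : f z != 0 -> delta (f z) t != 0 -> ccont f z -> ccont (fun x => gam (f x) t) z.
Proof.
move=> f0 d0 hf; have h0 := @ccont_delta t f z f0 hf; have h1 := @ccont_ddelta t f z hf.
exact: ccontN (ccontM (ccontM (ccont_cst 2 z) h1) (@ccontV R (fun x => delta (f x) t) z d0 h0)).
Qed.

Lemma ccontX2 (f : C -> C) z : ccont f z -> ccont (fun x => f x ^+ 2) z.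
Proof.
move=> hf; rewrite (_ : (fun x => f x ^+ 2) = fun x => f x * f x); first by apply: (ccontM hf hf).
by apply/funext => x; rewrite expr2.
Qed.

Lemma ccont_sqk (f : C -> C) z : ccont f z -> ccont (fun x => sqk (f x)) z.
Proof. by move=> hf; exact: ccontD (ccontX2 hf) (ccont_cst (- (kappa ^+ 2)%:C) z). Qed.

Lemma ccont_omega (t : R) (f : C -> C) z : f z != 0 -> delta (f z) t != 0 -> sqk (f z) != 0 -> ccont f z -> ccont (fun x => omega (f x) t) z.
Proof.
move=> f0 d0 z0 hf; have h0 := @ccont_delta t f z f0 hf.
have n0 : sqk (f z) * delta (f z) t ^+ 2 != 0 by rewrite mulf_neq0 // expf_neq0.
have h2 := ccontM (ccont_sqk hf) (ccontX2 h0).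
exact: ccontM (ccontD (ccontX2 hf) (ccont_cst (- 1) z)) (@ccontV R (fun x => sqk (f x) * delta (f x) t ^+ 2) z n0 h2).
Qed.

Lemma ccont_H0 z : unit_disc z -> ccont H0 z.
Proof.
move=> /unit_discE h; have d0 : 1 - z != 0.
  rewrite subr_eq0; apply: contraTneq h => <-.
  by rewrite /sqnorm Re1 Im1 expr1n expr0n addr0 ltxx.
have h1 := ccontD (ccont_cst 1 z) (ccont_id z).
have h2 := ccontD (ccont_cst 1 z) (ccontN (ccont_id z)).
exact: ccontM h1 (@ccontV R (fun x => 1 - x) z d0 h2).
Qed.

Lemma ccont_u_of z : unit_disc z -> ccont u_of z.
Proof.
move=> Dz; have h := ccont_H0 Dz; have r0 := Re_H0 Dz.
have h2 := ccontD (ccont_cst (kappa ^+ 2)%:C z) (ccontM (ccont_cst (1 - kappa ^+ 2)%:C z) (ccontX2 h)).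
exact: ccont_comp h2 (ccont_sqrtc (off_cut_aff r0)).
Qed.

Lemma unit_disc_near z : unit_disc z -> cnear z (@unit_disc R).
Proof.
move=> /unit_discE h.
have hr : rcont (fun x => Re x) z := rcont_Re (ccont_id z).
have hi : rcont (fun x => Im x) z := rcont_Im (ccont_id z).
have /rcontP hn := rcontD (rcontM hr hr) (rcontM hi hi).
have e0 : 0 < 1 - sqnorm z by rewrite subr_gt0.
have [d d0 hd] := hn _ e0; exists d => // x h1 h2; apply/unit_discE.
have := hd x h1 h2; rewrite -!expr2 ltr_norml => /andP[_]; rewrite /sqnorm; lra.
Qed.
End FlowInU.

(** * A continuous square root on Sigma *)

Section Branch.
Variable R : realType.
Local Notation C := (R[i]).
Local Notation Re := complex.Re.
Local Notation Im := complex.Im.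
Local Notation cj := (@conjc R).
Implicit Types (z w u : C).
Local Notation H0 := (@H0 R).
Variables kappa t : R.
Hypothesis kappa2 : kappa ^+ 2 < 1.
Hypothesis t0 : 0 < t.
Local Notation omega := (@omega R kappa).
Local Notation sqk := (@sqk R kappa).
Local Notation u_of := (@u_of R kappa).
Local Notation alpha := (@alpha R).

Lemma sqnorm_cayley z : 0 < Re z -> sqnorm ((1 - z) / (1 + z)) < 1.
Proof. by move=> /cayley_disc[]. Qed.

Lemma Re_gt0_1D_neq0 z : 0 < Re z -> 1 + z != 0.
Proof. by move=> /cayley_disc[]. Qed.

Lemma alpha_disc w : off_cut (1 - w) -> unit_disc (alpha w).
Proof. by move=> ow; apply/unit_discE/sqnorm_cayley/Re_sqrtc_gt0. Qed.

Lemma alphaK w : off_cut (1 - w) -> 1 - ((1 - alpha w) / (1 + alpha w)) ^+ 2 = w.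
Proof.
move=> ow; have s0 := Re_sqrtc_gt0 ow; have d0 := Re_gt0_1D_neq0 s0; rewrite /alpha.
have e := sqr_sqrtc (1 - w).
have -> : (1 - (1 - sqrtc (1 - w)) / (1 + sqrtc (1 - w))) / (1 + (1 - sqrtc (1 - w)) / (1 + sqrtc (1 - w))) = sqrtc (1 - w).
  move: (sqrtc _) d0 => s d0.
  have -> : 1 - (1 - s) / (1 + s) = 2 * s / (1 + s) by field.
  have -> : 1 + (1 - s) / (1 + s) = 2 / (1 + s) by field.
  by field.
by rewrite e; ring.
Qed.

Lemma alpha_surj p : unit_disc p -> exists2 w, off_cut (1 - w) & alpha w = p.
Proof.
move=> /unit_discE h.
pose s := (1 - p) / (1 + p).
have d0 : 1 + p != 0.
  rewrite addrC addr_eq0; apply: contraTneq h => ->.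
  by rewrite sqnormN /sqnorm Re1 Im1 expr1n expr0n addr0 ltxx.
have e : (1 - s) / (1 + s) = p.
  rewrite /s.
  have -> : 1 - (1 - p) / (1 + p) = 2 * p / (1 + p) by field.
  have -> : 1 + (1 - p) / (1 + p) = 2 / (1 + p) by field.
  by field.
have r0 : 0 < Re s.
  apply/cayley_disc; rewrite e; split => //.
  have -> : 1 + s = 2 / (1 + p) by rewrite /s; field.
  by rewrite mulf_neq0 ?invr_eq0 // pnatr_eq0.
exists (1 - s ^+ 2); rewrite ?/alpha opprB addrCA subrr addr0; first exact: off_cut_sqr.
by rewrite sqrtc_sqr.
Qed.

Lemma psi_domE z : psi_dom kappa t z <-> [/\ unit_disc z, delta (u_of z) t != 0 & off_cut (1 - omega (u_of z) t)].
Proof.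
rewrite /psi_dom /=; split.
  move=> [Dz [w]]; rewrite psi_arg_omega //; case: eqVneq => // d0 [<-] /slit_planeE.
  by split.
move=> [Dz d0 /slit_planeE sw]; split => //.
by exists (omega (u_of z) t) => //; rewrite psi_arg_omega // (negbTE d0).
Qed.

Lemma psiE z : psi_dom kappa t z -> psi kappa t z = alpha (omega (u_of z) t).
Proof. by move=> /psi_domE[Dz d0 _]; rewrite /psi psi_arg_omega // (negbTE d0). Qed.

Lemma Sigma_dom : Sigma kappa t = psi_dom kappa t.
Proof.
apply/seteqP; split => z; first by case.
move=> h; split => //; rewrite psiE //; apply: alpha_disc.
by have /psi_domE[] := h.
Qed.

Lemma SigmaP z : Sigma kappa t z <-> [/\ unit_disc z, delta (u_of z) t != 0 & off_cut (1 - omega (u_of z) t)].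
Proof. by rewrite Sigma_dom; exact: psi_domE. Qed.

Lemma Re_u_of z : unit_disc z -> 0 < Re (u_of z).
Proof. by move=> Dz; apply: Re_a => //; exact: Re_H0. Qed.

Lemma u_of_neq0 z : unit_disc z -> u_of z != 0.
Proof. by move=> /Re_u_of h; apply: contraTneq h => ->; rewrite ltxx. Qed.

Lemma sqk_u z : sqk (u_of z) = (1 - kappa ^+ 2)%:C * H0 z ^+ 2.
Proof. exact: sqk_a. Qed.

Lemma sqk_u_neq0 z : unit_disc z -> sqk (u_of z) != 0.
Proof. by move=> Dz; apply: sqk_a_neq0 => //; exact: Re_H0. Qed.

Lemma RealM (x : R) z : Re (x%:C * z) = x * Re z /\ Im (x%:C * z) = x * Im z.
Proof. by rewrite ReM ImM ReC ImC; split; ring. Qed.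

Lemma off_cut_sqk z : unit_disc z -> off_cut (sqk (u_of z)).
Proof.
move=> Dz; have h := off_cut_sqr (Re_H0 Dz); rewrite /off_cut sqk_u.
have [-> ->] := RealM (1 - kappa ^+ 2) (H0 z ^+ 2).
move=> /eqP; rewrite mulf_eq0 (negbTE (onem_kappa2_neq0 kappa2)) /= => /eqP /h h2.
by rewrite mulr_gt0 // onem_kappa2_gt0.
Qed.

Lemma gamJ u s : gam (cj u) s = cj (gam u s).
Proof. by rewrite /gam deltaJ ddeltaJ conjN !conjM conjV conj2. Qed.

Lemma omegaJ u s : omega (cj u) s = cj (omega u s).
Proof.
rewrite /omega /sqk deltaJ conjM conjV !expr2 !conjM !conjD !conjN !conjM conjR; congr (_ / _).
by congr (_ + _); rewrite (conjR 1).
Qed.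

Lemma Im_gam_neq0 u : 0 < Re u -> Im u != 0 -> Im (gam u t) != 0.
Proof.
move=> r0; rewrite neq_lt => /orP[i0|i0].
  have Qc : quadrant (cj u) by split; rewrite ?ReJ ?ImJ ?oppr_gt0.
  by have := Im_gam_lt0 Qc t0; rewrite gamJ ImJ oppr_lt0 => /lt0r_neq0.
have Qu : quadrant u by split.
by have := Im_gam_lt0 Qu t0 => /ltr0_neq0.
Qed.

(** If u is not real, neither is gamma, and a real square of it is negative. If
    u is real, the claim is 1 - omega > 0, read through [omega_gam]. *)
Lemma gam_sqr_avoid z : Sigma kappa t z -> Im (gam (u_of z) t ^+ 2) = 0 -> kappa ^+ 2 < Re (gam (u_of z) t ^+ 2) \/ Re (gam (u_of z) t ^+ 2) < 0.
Proof.
move=> /SigmaP[Dz d0 ow]; rewrite Im_sqr Re_sqr => /eqP.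
rewrite mulf_eq0 mulf_eq0 pnatr_eq0 /=.
have u0 := u_of_neq0 Dz; have z0 := sqk_u_neq0 Dz; have oz := off_cut_sqk Dz; have ru := Re_u_of Dz.
have e := omega_gam u0 z0 d0.
have [iu|iu] := eqVneq (Im (u_of z)) 0; last first.
  rewrite (negbTE (Im_gam_neq0 ru iu)) orbF => /eqP ->; right.
  by rewrite expr0n sub0r oppr_lt0 exprn_even_gt0 //= Im_gam_neq0.
move=> _; left.
have uR : u_of z = (Re (u_of z))%:C by rewrite real_of_Im0.
have gi : Im (gam (u_of z) t) = 0 by rewrite uR gam_real.
have zi : Im (sqk (u_of z)) = 0 by rewrite Im_sqk Im_sqr iu mulr0.
have zr := oz zi.
have ZR : sqk (u_of z) = (Re (sqk (u_of z)))%:C by rewrite real_of_Im0.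
have [er ei] := RealM (Re (sqk (u_of z))) (1 - omega (u_of z) t).
rewrite -ZR mulrC e in er ei.
have i1 : Im (gam (u_of z) t ^+ 2 - (kappa ^+ 2)%:C) = 0 by rewrite ImD ImN ImC Im_sqr gi mulr0 subr0.
have : 0 < Re (1 - omega (u_of z) t).
  by apply: ow; move/eqP: ei; rewrite i1 eq_sym mulf_eq0 (gt_eqF zr) /= => /eqP.
rewrite -(pmulr_rgt0 _ zr) -er ReD ReN ReC Re_sqr gi expr0n /= subr0 subr_gt0; exact.
Qed.

(** By [gam_sqr_avoid] the root is continuous on Sigma, so gamma times this
    factor is a continuous square root of gamma^2 - kappa^2, within a right
    angle of gamma. *)
Definition gam_factor z := sqrtc (1 - (kappa ^+ 2)%:C / gam (u_of z) t ^+ 2).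

(** By [omega_gam], a square root of 1 / ((1 - kappa^2) (1 - omega)) on Sigma.
    Where its real part is positive it is the principal one, which is the
    case on Lambda by [Lambda_branch]. *)
Definition branch z := H0 z / (gam (u_of z) t * gam_factor z).

Lemma gam_neq0 z : Sigma kappa t z -> gam (u_of z) t != 0.
Proof.
move=> Sz; apply/negP => /eqP h; have := gam_sqr_avoid Sz.
rewrite h expr0n /= => /(_ erefl)[]; last by rewrite ltxx.
by rewrite ltNge sqr_ge0.
Qed.

Lemma off_cut_gam_factor z : Sigma kappa t z -> off_cut (1 - (kappa ^+ 2)%:C / gam (u_of z) t ^+ 2).
Proof.
move=> Sz; have g0 := gam_neq0 Sz; have av := gam_sqr_avoid Sz.
have g2 : gam (u_of z) t ^+ 2 != 0 by rewrite expf_neq0.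
move: (gam (u_of z) t ^+ 2) g2 av => h h0 av.
have n0 := sqr_ReIm_gt0 h0.
rewrite /off_cut ImD ReD ImN ReN Im1 Re1 Im_div Re_div.
have [-> ->] := RealM (kappa ^+ 2) (cj h); rewrite ReJ ImJ => /eqP.
rewrite sub0r oppr_eq0 mulf_eq0 invr_eq0 (gt_eqF n0) orbF mulrN oppr_eq0 mulf_eq0.
have [k0|k0] := eqVneq kappa 0; first by rewrite k0 expr0n /= !mul0r subr0 ltr01.
rewrite sqrf_eq0 (negbTE k0) /= => /eqP hi.
rewrite subr_gt0 ltr_pdivrMr // mul1r hi expr0n /= addr0.
have k2 : 0 < kappa ^+ 2 by rewrite exprn_even_gt0.
have := av hi => -[a1|a1].
  rewrite (expr2 (Re h)) ltr_pM2r //; exact: lt_trans k2 a1.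
apply: (@lt_trans _ _ 0); last by rewrite exprn_even_gt0 //= lt_eqF.
by rewrite pmulr_rlt0.
Qed.

Lemma Re_gam_factor z : Sigma kappa t z -> 0 < Re (gam_factor z).
Proof. by move=> Sz; apply: Re_sqrtc_gt0; exact: off_cut_gam_factor. Qed.

Lemma gam_factor_neq0 z : Sigma kappa t z -> gam_factor z != 0.
Proof. by move=> /Re_gam_factor h; apply: contraTneq h => ->; rewrite ltxx. Qed.

Lemma gam_factor_sqr z : Sigma kappa t z -> (gam (u_of z) t * gam_factor z) ^+ 2 = gam (u_of z) t ^+ 2 - (kappa ^+ 2)%:C.
Proof.
move=> Sz; have g0 := gam_neq0 Sz.
rewrite exprMn sqr_sqrtc; move: (_%:C) (gam _ _) g0 => k g g0; by field.
Qed.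

Lemma branch_sqr z : Sigma kappa t z -> (1 - kappa ^+ 2)%:C * branch z ^+ 2 * (1 - omega (u_of z) t) = 1.
Proof.
move=> Sz; have [Dz d0 ow] := (SigmaP z).1 Sz.
have e := omega_gam (u_of_neq0 Dz) (sqk_u_neq0 Dz) d0.
have z0 := sqk_u_neq0 Dz.
have w0 : 1 - omega (u_of z) t != 0.
  by apply/negP => /eqP h; move: ow; rewrite h /off_cut /= => /(_ erefl); rewrite ltxx.
rewrite /branch expr_div_n gam_factor_sqr // -e.
have -> : (1 - kappa ^+ 2)%:C * (H0 z ^+ 2 / ((1 - omega (u_of z) t) * sqk (u_of z))) =
   ((1 - kappa ^+ 2)%:C * H0 z ^+ 2) / ((1 - omega (u_of z) t) * sqk (u_of z)) by rewrite mulrA.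
rewrite -sqk_u; move: (sqk _) z0 (1 - _) w0 => a a0 b b0; by field; rewrite a0 b0.
Qed.

(** The square is a positive multiple of 1 / (1 - omega), and 1 - omega is not a
    negative number on Sigma. *)
Lemma Re_branch_neq0 z : Sigma kappa t z -> Re (branch z) != 0.
Proof.
move=> Sz; have [Dz d0 ow] := (SigmaP z).1 Sz; apply/negP => /eqP r0.
have e := branch_sqr Sz; have c0 := onem_kappa2_gt0 kappa2.
pose r := (1 - kappa ^+ 2) * Im (branch z) ^+ 2.
have er : (1 - kappa ^+ 2)%:C * branch z ^+ 2 = (- r)%:C.
  have [h1 h2] := RealM (1 - kappa ^+ 2) (branch z ^+ 2).
  by apply: complexP; rewrite ?h1 ?h2 ?ReC ?ImC ?Re_sqr ?Im_sqr r0 /r; ring.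
rewrite er in e; have [h1 h2] := RealM (- r) (1 - omega (u_of z) t).
rewrite e Re1 in h1; rewrite e Im1 in h2.
have rn : r != 0 by apply/negP => /eqP rr; move: h1; rewrite rr oppr0 mul0r => /eqP; rewrite oner_eq0.
have := ow; rewrite /off_cut => h.
have : 0 < Re (1 - omega (u_of z) t).
  by apply: h; move/eqP: h2; rewrite eq_sym mulf_eq0 oppr_eq0 (negbTE rn) /= => /eqP.
have r1 : 0 <= r by rewrite mulr_ge0 ?sqr_ge0 // ltW.
move=> /ltW p1; have : 0 <= r * Re (1 - omega (u_of z) t) by exact: mulr_ge0.
move: h1; rewrite mulNr; lra.
Qed.

Lemma ccont_branch z : Sigma kappa t z -> ccont branch z.
Proof.
move=> Sz; have [Dz d0 ow] := (SigmaP z).1 Sz.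
have hu := ccont_u_of kappa2 Dz.
have hg := @ccont_gam R t u_of z (u_of_neq0 Dz) d0 hu.
have g2 : gam (u_of z) t ^+ 2 != 0 by rewrite expf_neq0 // gam_neq0.
have h1 := ccontM (ccont_cst (kappa ^+ 2)%:C z) (@ccontV R (fun x => gam (u_of x) t ^+ 2) z g2 (ccontX2 hg)).
have h2 := ccontD (ccont_cst 1 z) (ccontN h1).
have hm : ccont gam_factor z := ccont_comp h2 (ccont_sqrtc (off_cut_gam_factor Sz)).
have n0 : gam (u_of z) t * gam_factor z != 0 by rewrite mulf_neq0 ?gam_neq0 ?gam_factor_neq0.
exact: ccontM (ccont_H0 Dz) (@ccontV R (fun x => gam (u_of x) t * gam_factor x) z n0 (ccontM hg hm)).
Qed.
End Branch.

(** * From the branch to admissibility *)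

Section BranchAdmissible.
Variable R : realType.
Local Notation C := (R[i]).
Local Notation Re := complex.Re.
Local Notation Im := complex.Im.
Local Notation cj := (@conjc R).
Implicit Types (z w u : C).
Variables kappa t : R.
Hypothesis kappa2 : kappa ^+ 2 < 1.
Hypothesis t0 : 0 < t.
Local Notation sqk := (@sqk R kappa).
Local Notation admissible := (@admissible R kappa).
Local Notation u_of := (@u_of R kappa).

Local Notation H0 := (@H0 R).
Local Notation branch := (@branch R kappa t).
Local Notation Sigma := (@Sigma R kappa t).

Lemma ImV_lt0 z : Im z < 0 -> 0 < Im z^-1.
Proof.
move=> h; have z0 : z != 0 by apply: contraTneq h => ->; rewrite ltxx.
by rewrite ImV divr_gt0 ?oppr_gt0 // sqr_ReIm_gt0.
Qed.

Lemma ImV_gt0 z : 0 < Im z -> Im z^-1 < 0.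
Proof. by move=> h; rewrite -[z^-1]opprK -invrN ImN oppr_lt0 ImV_lt0 // ImN oppr_lt0. Qed.

Lemma ReV_gt0 z : 0 < Re z -> 0 < Re z^-1.
Proof.
move=> h; have z0 : z != 0 by apply: contraTneq h => ->; rewrite ltxx.
by rewrite ReV divr_gt0 // sqr_ReIm_gt0.
Qed.

Lemma Im_gt0_of_sqr z : 0 < Re z -> 0 < Im (z ^+ 2) -> 0 < Im z.
Proof. by move=> r0; rewrite Im_sqr pmulr_rgt0 // mulr_gt0. Qed.

(** If J were on or above the real axis, the angle less than a right angle
    between J and g would force their real parts to have the same sign, and
    the products of coordinates, which are half the imaginary parts of the
    squares, could not agree. *)
Lemma Im_lt0_same_side (J g m : C) : J = g * m -> 0 < Re m -> Im (J ^+ 2) = Im (g ^+ 2) -> Im g < 0 -> Im J < 0.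
Proof.
move=> eJ m0; rewrite !Im_sqr => e g0.
have h : 0 < Re J * Re g + Im J * Im g.
  have -> : Re J * Re g + Im J * Im g = (Re g ^+ 2 + Im g ^+ 2) * Re m by rewrite eJ ReM ImM; ring.
  by rewrite mulr_gt0 // sqr_ReIm_gt0 //; apply: contraTneq g0 => ->; rewrite ltxx.
move: (Re J) (Im J) (Re g) (Im g) e g0 h => A B p q e q0 h.
rewrite ltNge; apply/negP => B0.
have Ap : 0 < A * p by nra.
have eAB : A * B = p * q by lra.
have e2 : A * p * B = p ^+ 2 * q by rewrite mulrAC eAB; ring.
have : 0 <= A * p * B by rewrite mulr_ge0 // ltW.
rewrite e2 nmulr_lge0 // => p0.
have : p ^+ 2 = 0 by apply/eqP; rewrite eq_le p0 sqr_ge0.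
by move/eqP; rewrite sqrf_eq0 => /eqP pz; rewrite pz mulr0 ltxx in Ap.
Qed.

(** Here y = H_0(z), m is [gam_factor] and Z = u^2 - kappa^2. Put Y = y / (g m),
    S = (1 - kappa^2) Y^2 = 1 / (1 - w) and p = y / m. Since g m is below
    the real axis, Y is in the first quadrant, so S is above the real axis,
    and so is (1 - kappa^2) p^2 = Z + kappa^2 S; hence p is in the first
    quadrant, being within a right angle of y. Finally (1 - w) conj g = conj
    g / S has the sign of - Im (g S), and g S is a positive multiple of p Y. *)
Lemma admissible_algebra (y g m w Z : C) : 0 < Re y -> 0 < Im Z -> Im g < 0 -> 0 < Re m ->
  (g * m) ^+ 2 = g ^+ 2 - (kappa ^+ 2)%:C -> Z = (1 - kappa ^+ 2)%:C * y ^+ 2 ->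
  (1 - w) * Z = g ^+ 2 - (kappa ^+ 2)%:C ->
  (1 - kappa ^+ 2)%:C * (y / (g * m)) ^+ 2 * (1 - w) = 1 ->
  0 < Re (y / (g * m)) -> 0 < Im w /\ Im ((1 - w) * cj g) < 0.
Proof.
move=> y0 Z0 g0 m0 eJ eZ ew eS rY.
have c0 := onem_kappa2_gt0 kappa2.
have y2 : 0 < Im (y ^+ 2).
  by move: Z0; rewrite eZ; have [_ ->] := RealM (1 - kappa ^+ 2) (y ^+ 2); rewrite pmulr_rgt0.
have yi := Im_gt0_of_sqr y0 y2.
have Ji : Im (g * m) < 0.
  by apply: (@Im_lt0_same_side _ g m) => //; rewrite eJ ImD ImN ImC subr0.
have Yi : 0 < Im (y / (g * m)).
  have h := ImV_lt0 Ji; move: rY; rewrite ReM ImM; move: (_^-1) h => j h rY.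
  have hyj := mulr_gt0 yi h.
  have j0 : 0 < Re j by rewrite -(pmulr_rgt0 _ y0); lra.
  by rewrite addr_gt0 // mulr_gt0.
have gn : g != 0 by apply: contraTneq g0 => ->; rewrite ltxx.
have mn : m != 0 by apply: contraTneq m0 => ->; rewrite ltxx.
have yn : y != 0 by apply: contraTneq y0 => ->; rewrite ltxx.
set Y := y / (g * m) in eS rY Yi.
set S := (1 - kappa ^+ 2)%:C * Y ^+ 2 in eS.
have Si : 0 < Im S.
  by rewrite /S; have [_ ->] := RealM (1 - kappa ^+ 2) (Y ^+ 2); rewrite mulr_gt0 // Im_sqr !mulr_gt0.
have Sn := Im_gt0_neq0 Si.
have e1w : 1 - w = S^-1 by apply: (mulfI Sn); rewrite eS divff.
have wi : 0 < Im w.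
  have := ImV_gt0 Si; rewrite -e1w ImD ImN Im1 sub0r oppr_lt0; exact.
split => //.
pose p := y / m.
have pE : p = g * Y by rewrite /p /Y; field; rewrite gn mn.
have ep : (1 - kappa ^+ 2)%:C * p ^+ 2 = Z + (kappa ^+ 2)%:C * S.
  have -> : (1 - kappa ^+ 2)%:C * p ^+ 2 = g ^+ 2 * S by rewrite pE /S; ring.
  have -> : g ^+ 2 = (1 - w) * Z + (kappa ^+ 2)%:C by rewrite ew; ring.
  by rewrite mulrDl mulrAC (mulrC (1 - w)) eS mul1r.
have p2 : 0 < Im (p ^+ 2).
  have : 0 < Im ((1 - kappa ^+ 2)%:C * p ^+ 2).
    rewrite ep ImD; have [_ ->] := RealM (kappa ^+ 2) S.
    by rewrite ltr_pwDl // mulr_ge0 ?sqr_ge0 // ltW.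
  by have [_ ->] := RealM (1 - kappa ^+ 2) (p ^+ 2); rewrite pmulr_rgt0.
have py : 0 < Re p * Re y + Im p * Im y.
  have -> : Re p * Re y + Im p * Im y = (Re y ^+ 2 + Im y ^+ 2) * Re m^-1.
    by rewrite /p ReM ImM; ring.
  by rewrite mulr_gt0 ?ReV_gt0 // sqr_ReIm_gt0.
have [pr pi] : 0 < Re p /\ 0 < Im p.
  move: p2 py; rewrite Im_sqr; move: (Re p) (Im p) => a b h1 h2; split; nra.
have gS : 0 < Im (g * S).
  have -> : g * S = (1 - kappa ^+ 2)%:C * (p * Y) by rewrite pE /S; ring.
  have [_ ->] := RealM (1 - kappa ^+ 2) (p * Y); rewrite mulr_gt0 // ImM addr_gt0 // mulr_gt0 //.
rewrite e1w mulrC Im_div.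
have -> : Im (cj g * cj S) = - Im (g * S) by rewrite -conjM ImJ.
by rewrite mulNr oppr_lt0 divr_gt0 // sqr_ReIm_gt0.
Qed.

Lemma admissible_of_branch z : Sigma z -> quadrant (u_of z) -> 0 < Re (branch z) -> admissible (u_of z) t.
Proof.
move=> Sz Qu rY; have [Dz d0 ow] := (SigmaP t kappa2 z).1 Sz.
apply: (admissible_algebra (Re_H0 Dz) _ (Im_gam_lt0 Qu t0) (Re_gam_factor kappa2 t0 Sz) (gam_factor_sqr kappa2 t0 Sz) (sqk_u kappa z) _ _ rY).
- by rewrite Im_sqk; exact: quadrant_sqr.
- exact: omega_gam (u_of_neq0 kappa2 Dz) (sqk_u_neq0 kappa2 Dz) d0.
- exact: branch_sqr.
Qed.

(** For real u all of y, gamma and [gam_factor] are real, and the sign of the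
    branch is that of gamma. *)
Lemma gam_gt0_of_branch z : Sigma z -> Im (u_of z) = 0 -> 0 < Re (branch z) -> 0 < Re (gam (u_of z) t).
Proof.
move=> Sz iu rY; have [Dz d0 ow] := (SigmaP t kappa2 z).1 Sz.
have uR : u_of z = (Re (u_of z))%:C by rewrite real_of_Im0.
have gi : Im (gam (u_of z) t) = 0 by rewrite uR gam_real.
have y0 := Re_H0 Dz.
have yi : Im (H0 z) = 0.
  have h : Im (sqk (u_of z)) = 0 by rewrite Im_sqk Im_sqr iu mulr0.
  move: h; rewrite sqk_u; have [_ ->] := RealM (1 - kappa ^+ 2) (H0 z ^+ 2).
  by move/eqP; rewrite mulf_eq0 (negbTE (onem_kappa2_neq0 kappa2)) Im_sqr !mulf_eq0 pnatr_eq0 (gt_eqF y0) /= => /eqP.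
have m0 := Re_gam_factor kappa2 t0 Sz.
have mi : Im (gam_factor kappa t z) = 0.
  have : Im ((gam (u_of z) t * gam_factor kappa t z) ^+ 2) = 0 by rewrite gam_factor_sqr // ImD ImN ImC Im_sqr gi mulr0 subr0.
  rewrite exprMn ImM !Im_sqr gi !mulr0 mul0r addr0 Re_sqr gi expr0n subr0.
  move/eqP; rewrite mulf_eq0 sqrf_eq0 2!mulf_eq0 pnatr_eq0 (gt_eqF m0) /= => /orP[/eqP gr|/eqP //].
  by have := gam_neq0 kappa2 t0 Sz; rewrite -(real_of_Im0 gi) gr eqxx.
move: rY; rewrite /branch -(real_of_Im0 yi) -(real_of_Im0 gi) -(real_of_Im0 mi) -rmorphM -fmorphV -rmorphM ReC.
rewrite pmulr_rgt0 // invr_gt0 pmulr_lgt0 //.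
Qed.
End BranchAdmissible.

(** * The component of 0 *)

Section Component.
Variable R : realType.
Local Notation C := (R[i]).
Local Notation Co := (R[i]^o).
Local Notation Re := complex.Re.
Local Notation Im := complex.Im.
Local Notation cj := (@conjc R).
Implicit Types (z w u : C).
Variables kappa t : R.
Hypothesis kappa2 : kappa ^+ 2 < 1.
Hypothesis t0 : 0 < t.
Local Notation omega := (@omega R kappa).
Local Notation u_of := (@u_of R kappa).

Local Notation H0 := (@H0 R).
Local Notation branch := (@branch R kappa t).
Local Notation Sigma := (@Sigma R kappa t).
Local Notation Lambda := (@Lambda R kappa t).

Lemma delta_1 s : delta (1 : C) s = cexp (- (s%:C * (1 / 2))).
Proof. by rewrite /delta /ccosh /csinh; field. Qed.

Lemma gam_1 s : gam (1 : C) s = 1.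
Proof.
have h := cexp_neq0 (- (s%:C * (1 / 2)) : C).
have e : ddelta (1 : C) s = - (delta 1 s / 2) by rewrite /delta /ddelta; field.
by rewrite /gam e delta_1; field.
Qed.

Lemma u_of_0 : u_of 0 = 1.
Proof.
rewrite /u_of /a /Defs.H0 addr0 subr0 divr1 expr1n mulr1 -rmorphD addrC subrK.
by rewrite sqrtc1.
Qed.

Lemma unit_disc0 : unit_disc (0 : C).
Proof. by rewrite /unit_disc /= normr0 ltr01. Qed.

Lemma Sigma0 : Sigma 0.
Proof.
apply/SigmaP => //; rewrite u_of_0; split; first exact: unit_disc0.
  by rewrite delta_1 cexp_neq0.
by rewrite /omega expr1n subrr mul0r subr0 /off_cut Re1.
Qed.

Lemma branch_0 : 0 < Re (branch 0).
Proof.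
have m0 := Re_gam_factor kappa2 t0 Sigma0.
rewrite /branch u_of_0 gam_1 /Defs.H0 addr0 subr0 divr1 !mul1r; exact: ReV_gt0.
Qed.

Lemma continuous_RC (f : R -> C) (x : R) : {for x, continuous (fun r => Re (f r))} -> {for x, continuous (fun r => Im (f r))} ->
  @continuous_at R Co x f.
Proof.
move=> /cvgrPdist_lt h1 /cvgrPdist_lt h2 P /nbhs_boxP[e e0 hP].
change (nbhs x (f @^-1` P)).
near=> r; rewrite /=; apply: hP; rewrite distrC; near: r.
  exact: h1.
exact: h2.
Unshelve. all: by end_near.
Qed.

Definition seg (p q : C) (r : R) : C := p + r%:C * (q - p).

Lemma seg_cont p q : continuous (seg p q : R -> Co).
Proof.
move=> x; have hid : {for x, continuous (fun r : R => r)} by exact: cvg_id.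
apply: continuous_RC.
  rewrite (_ : (fun r => Re (seg p q r)) = fun r => Re p + r * Re (q - p)).
    by apply: (@cvgD R R); [exact: cvg_cst|apply: cvgM; [exact: hid|exact: cvg_cst]].
  by apply/funext => r; rewrite /seg (ReD p) (ReM r%:C) ReC ImC mul0r subr0.
rewrite (_ : (fun r => Im (seg p q r)) = fun r => Im p + r * Im (q - p)).
  by apply: (@cvgD R R); [exact: cvg_cst|apply: cvgM; [exact: hid|exact: cvg_cst]].
by apply/funext => r; rewrite /seg (ImD p) (ImM r%:C) ReC ImC mul0r addr0.
Qed.

Lemma Lambda_path (f : R -> C) (x y : R) : x <= y ->
  (forall r, x <= r <= y -> @continuous_at R Co r f) -> (forall r, x <= r <= y -> Sigma (f r)) ->
  forall r s, x <= r <= y -> x <= s <= y -> Lambda (f r) -> Lambda (f s).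
Proof.
move=> xy cf hS r s hr hs [A [A0 AS cA] Afr].
exists (A `|` (f @` `[x, y]%classic)); last by right; exists s.
split; [by left| |].
  by move=> p [/AS//|[q]]; rewrite /= in_itv /= => hq <-; exact: hS.
apply: connectedU => //; first by exists (f r); split => //; exists r.
apply: (@connected_continuous_connected R Co).
  by apply/connected_intervalP; exact: interval_is_interval.
by apply: continuous_in_subspaceT => q; rewrite inE /= in_itv /= => /cf.
Qed.

Lemma Sigma_near z : Sigma z -> cnear z Sigma.
Proof.
move=> /(SigmaP t kappa2)[Dz d0 ow].
have hu := ccont_u_of kappa2 Dz.
have u0 := u_of_neq0 kappa2 Dz.
have hd := ccont_neq0 (f := fun x => delta (u_of x) t) d0 (@ccont_delta R t u_of z u0 hu).
have hw := @ccont_omega R kappa t u_of z u0 d0 (sqk_u_neq0 kappa2 Dz) hu.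
have hw1 := ccontD (ccont_cst 1 z) (ccontN hw).
have ho := (ccontE _ _).1 hw1 _ (off_cut_near ow).
apply: cnearS (cnearI (unit_disc_near Dz) (cnearI hd ho)) => x [h1 [h2 h3]].
by apply/SigmaP.
Qed.

(** Sigma is open and boxes are convex, so membership in Lambda is locally
    constant on Sigma. *)
Lemma Lambda_near z : Sigma z -> cnear z (fun x => Sigma x /\ (Lambda x <-> Lambda z)).
Proof.
move=> /Sigma_near[e e0 he]; exists e => // x h1 h2; split; first exact: he.
have hS r : 0 <= r <= 1 -> Sigma (seg z x r).
  move=> /andP[r0 r1]; apply: he; rewrite /seg.
    rewrite (ReD z) (ReM r%:C) ReC ImC mul0r subr0 addrAC subrr add0r normrM ger0_norm // ReD ReN.
    by apply: le_lt_trans h1; rewrite ler_piMl.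
  rewrite (ImD z) (ImM r%:C) ReC ImC mul0r addr0 addrAC subrr add0r normrM ger0_norm // ImD ImN.
  by apply: le_lt_trans h2; rewrite ler_piMl.
have e0' : seg z x 0 = z by rewrite /seg mul0r addr0.
have e1' : seg z x 1 = x by rewrite /seg mul1r addrC subrK.
have H := Lambda_path ler01 (fun r _ => @seg_cont z x r) hS.
have H01 := H 0 1; have H10 := H 1 0; rewrite !lexx ler01 e0' e1' in H01 H10.
by split; [apply: H10|apply: H01].
Qed.

Lemma LambdaS z : Lambda z -> Sigma z.
Proof. by case=> A [_ AS _] /AS. Qed.

Lemma Lambda0 : Lambda 0.
Proof.
exists [set 0]; last by [].
by split => //; [move=> x ->; exact: Sigma0|exact: connected1].
Qed.

(** The real part of the branch is continuous and nonzero on Sigma and positive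
    at 0, so it is positive on the connected set Lambda. *)
Lemma Lambda_branch z : Lambda z -> 0 < Re (branch z).
Proof.
case=> A [A0 AS cA] Az.
pose f (x : C) : R := Re (branch x).
have : connected (f @` A).
  apply: (@connected_continuous_connected Co R) => //.
  apply: continuous_in_subspaceT => x; rewrite inE => /AS Sx.
  exact: rcont_Re (ccont_branch kappa2 t0 Sx).
move/connected_intervalP => itv.
rewrite ltNge; apply/negP => h.
have [x Ax fx] : (f @` A) 0.
  apply: (itv (f z) (f 0)); [by exists z|by exists 0|].
  by apply/andP; split; [exact: h|exact: ltW branch_0].
by have := Re_branch_neq0 kappa2 t0 (AS _ Ax); rewrite -/(f x) fx eqxx.
Qed.

Lemma unit_discJ z : unit_disc (cj z) <-> unit_disc z.
Proof. by split=> /unit_discE h; apply/unit_discE; move: h; rewrite /sqnorm ReJ ImJ sqrrN. Qed.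

Lemma u_ofJ z : unit_disc z -> u_of (cj z) = cj (u_of z).
Proof.
move=> Dz; rewrite /u_of /a -sqrtcJ; last exact: (off_cut_aff kappa2 (Re_H0 Dz)).
have eH : H0 (cj z) = cj (H0 z).
  by rewrite /Defs.H0 conjM conjV !conjD conjN (conjR 1).
by rewrite eH conjD conjM !conjR !expr2 conjM.
Qed.

Lemma off_cutJ z : off_cut (cj z) <-> off_cut z.
Proof.
rewrite /off_cut ReJ ImJ; split => h e; apply: h; first by rewrite e oppr0.
by apply/eqP; rewrite -oppr_eq0 e.
Qed.

Lemma conj_1B w : 1 - cj w = cj (1 - w).
Proof. by rewrite conjD conjN (conjR 1). Qed.

Lemma SigmaJ z : Sigma z -> Sigma (cj z).
Proof.
move=> /(SigmaP t kappa2)[Dz d0 ow]; apply/SigmaP => //; rewrite u_ofJ //; split.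
- exact/unit_discJ.
- by rewrite deltaJ conjc_eq0.
- by rewrite omegaJ conj_1B; apply/off_cutJ.
Qed.

Lemma continuous_cj : continuous (cj : Co -> Co).
Proof.
move=> z P /nbhs_boxP[e e0 hP]; apply/nbhs_boxP; exists e => // x h1 h2.
by apply: hP; rewrite ?ReJ ?ImJ // -opprD normrN.
Qed.

Lemma LambdaJ z : Lambda z -> Lambda (cj z).
Proof.
case=> A [A0 AS cA] Az.
exists (cj @` A); last by exists z.
split.
- by exists 0 => //; rewrite (conjR 0).
- by move=> x [y /AS Sy <-]; exact: SigmaJ.
- apply: (@connected_continuous_connected Co Co) => //.
  exact: continuous_subspaceT continuous_cj.
Qed.
End Component.

(** * Injectivity on the component *)

Section Injectivity.
Variable R : realType.
Local Notation C := (R[i]).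
Local Notation Re := complex.Re.
Local Notation Im := complex.Im.
Local Notation cj := (@conjc R).
Implicit Types (z w u : C).
Variables kappa t : R.
Hypothesis kappa2 : kappa ^+ 2 < 1.
Hypothesis t0 : 0 < t.
Local Notation omega := (@omega R kappa).
Local Notation admissible := (@admissible R kappa).
Local Notation u_of := (@u_of R kappa).

Local Notation H0 := (@H0 R).
Local Notation Sigma := (@Sigma R kappa t).
Local Notation Lambda := (@Lambda R kappa t).
Local Notation psi := (@psi R kappa t).

Lemma u_of_inj z1 z2 : unit_disc z1 -> unit_disc z2 -> u_of z1 = u_of z2 -> z1 = z2.
Proof.
move=> disc1 disc2 e.
have h : (1 - kappa ^+ 2)%:C * H0 z1 ^+ 2 = (1 - kappa ^+ 2)%:C * H0 z2 ^+ 2 by rewrite -!sqk_u e.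
have c0 : (1 - kappa ^+ 2)%:C != 0 :> C by rewrite eq_complex /= eqxx andbT onem_kappa2_neq0.
rewrite -(H0K disc1) -(H0K disc2); congr ((_ - 1) / (_ + 1)).
all: by rewrite -(sqrtc_sqr (Re_H0 disc1)) -(sqrtc_sqr (Re_H0 disc2)) (mulfI c0 h).
Qed.

Lemma Lambda_admissible z : Lambda z -> 0 < Im (u_of z) -> admissible (u_of z) t.
Proof.
move=> Lz i0; have Sz := LambdaS Lz; have [Dz _ _] := (SigmaP t kappa2 z).1 Sz.
apply: (admissible_of_branch kappa2 t0 Sz); last exact: Lambda_branch.
by split => //; exact: Re_u_of.
Qed.

Lemma Lambda_Im_omega_gt0 z : Lambda z -> 0 < Im (u_of z) -> 0 < Im (omega (u_of z) t).
Proof. by move=> Lz /(Lambda_admissible Lz)[]. Qed.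

Lemma Lambda_Im_omega_lt0 z : Lambda z -> Im (u_of z) < 0 -> Im (omega (u_of z) t) < 0.
Proof.
move=> Lz i0; have [Dz _ _] := (SigmaP t kappa2 z).1 (LambdaS Lz).
have := Lambda_Im_omega_gt0 (LambdaJ kappa2 Lz).
by rewrite u_ofJ // omegaJ !ImJ !oppr_gt0; apply.
Qed.

Lemma omega_real u s : Im u = 0 -> Im (omega u s) = 0.
Proof.
move=> i0; have uR : u = cj u by apply: complexP; rewrite ?ReJ ?ImJ // i0 oppr0.
by apply: cj_real; rewrite -omegaJ -uR.
Qed.

Lemma psi_omega_inj z1 z2 : Sigma z1 -> Sigma z2 -> psi z1 = psi z2 -> omega (u_of z1) t = omega (u_of z2) t.
Proof.
move=> S1 S2; rewrite !psiE -?Sigma_dom // => e.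
have [_ _ o1] := (SigmaP t kappa2 z1).1 S1; have [_ _ o2] := (SigmaP t kappa2 z2).1 S2.
by rewrite -(alphaK o1) -(alphaK o2) e.
Qed.

(** On Lambda the sign of Im omega is that of Im u. Hence two points with the
    same value are both in the quadrant, both in its conjugate, or both real
    in u. *)
Lemma Lambda_omega_inj z1 z2 : Lambda z1 -> Lambda z2 -> omega (u_of z1) t = omega (u_of z2) t -> z1 = z2.
Proof.
have up p q : Lambda p -> Lambda q -> 0 < Im (u_of p) -> 0 < Im (u_of q) -> omega (u_of p) t = omega (u_of q) t -> p = q.
  move=> Lp Lq ip iq e.
  have [Dp _ _] := (SigmaP t kappa2 p).1 (LambdaS Lp); have [Dq _ _] := (SigmaP t kappa2 q).1 (LambdaS Lq).
  apply: u_of_inj => //; apply: (omega_inj kappa2 (t := t)) => //; try exact: Lambda_admissible; last exact: ltW.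
  - by split => //; exact: Re_u_of.
  - by split => //; exact: Re_u_of.
move=> L1 L2 e.
have S1 := LambdaS L1; have S2 := LambdaS L2.
have [disc1 _ o1] := (SigmaP t kappa2 z1).1 S1; have [disc2 _ o2] := (SigmaP t kappa2 z2).1 S2.
have [i1|i1|i1] := ltgtP (Im (u_of z1)) 0.
- have [i2|i2|i2] := ltgtP (Im (u_of z2)) 0.
  + apply: (can_inj (@conjcK R)); apply: up; rewrite ?u_ofJ ?ImJ ?oppr_gt0 //; try exact: LambdaJ.
    by rewrite !omegaJ e.
  + by have := Lambda_Im_omega_lt0 L1 i1; rewrite e ltNge ltW // Lambda_Im_omega_gt0.
  + by have := Lambda_Im_omega_lt0 L1 i1; rewrite e omega_real // ltxx.
- have [i2|i2|i2] := ltgtP (Im (u_of z2)) 0.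
  + by have := Lambda_Im_omega_gt0 L1 i1; rewrite e ltNge ltW // Lambda_Im_omega_lt0.
  + exact: up.
  + by have := Lambda_Im_omega_gt0 L1 i1; rewrite e omega_real // ltxx.
- have ir := omega_real t i1.
  have [i2|i2|i2] := ltgtP (Im (u_of z2)) 0.
  + by have := Lambda_Im_omega_lt0 L2 i2; rewrite -e ir ltxx.
  + by have := Lambda_Im_omega_gt0 L2 i2; rewrite -e ir ltxx.
  + apply: u_of_inj => //.
    have r1 := real_of_Im0 i1; have r2 := real_of_Im0 i2.
    have g1 := gam_gt0_of_branch kappa2 t0 S1 i1 (Lambda_branch kappa2 t0 L1).
    have g2 := gam_gt0_of_branch kappa2 t0 S2 i2 (Lambda_branch kappa2 t0 L2).
    have w1 : Re (omega (u_of z1) t) < 1.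
      rewrite -subr_gt0; have := o1; rewrite /off_cut ReD ImD ReN ImN Re1 Im1 ir oppr0 addr0; exact.
    rewrite -r1 -r2; congr (_%:C).
    apply: (@omega_inj_real R kappa _ _ t) => //.
    * exact: Re_u_of.
    * exact: Re_u_of.
    * exact: ltW.
    * by rewrite r1 sqk_u_neq0.
    * by rewrite r2 sqk_u_neq0.
    * by rewrite r1.
    * by rewrite r2.
    * by rewrite r1.
    * by rewrite r1 r2.
Qed.

Lemma psi_inj_Lambda z1 z2 : Lambda z1 -> Lambda z2 -> psi z1 = psi z2 -> z1 = z2.
Proof.
by move=> L1 L2 e; apply: Lambda_omega_inj => //; apply: psi_omega_inj => //; exact: LambdaS.
Qed.
End Injectivity.

(** * Extension to the boundary of the quadrant *)

Section Boundary.
Variable R : realType.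
Local Notation C := (R[i]).
Local Notation Re := complex.Re.
Local Notation Im := complex.Im.
Local Notation cj := (@conjc R).
Implicit Types (z w u : C).
Variables kappa t : R.
Hypothesis kappa2 : kappa ^+ 2 < 1.
Hypothesis t0 : 0 < t.
Local Notation omega := (@omega R kappa).
Local Notation sqk := (@sqk R kappa).
Local Notation u_of := (@u_of R kappa).

Local Notation H0 := (@H0 R).

Definition z_of u : C := let y := sqrtc (sqk u * ((1 - kappa ^+ 2)^-1)%:C) in (y - 1) / (y + 1).

Lemma off_cut_scale (c : R) z : 0 < c -> off_cut z -> off_cut (z * c%:C).
Proof.
move=> c0 oz; rewrite mulrC /off_cut; have [-> ->] := RealM c z.
by move/eqP; rewrite mulf_eq0 (gt_eqF c0) /= => /eqP/oz; rewrite pmulr_rgt0.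
Qed.

Lemma z_ofP u : 0 < Re u -> off_cut (sqk u) -> unit_disc (z_of u) /\ u_of (z_of u) = u.
Proof.
move=> ru ou.
have c0 : 0 < (1 - kappa ^+ 2)^-1 by rewrite invr_gt0 onem_kappa2_gt0.
have y0 := Re_sqrtc_gt0 (off_cut_scale c0 ou).
have [Dz eH] := H0_disc y0; split => //.
have cc : (1 - kappa ^+ 2)%:C * ((1 - kappa ^+ 2)^-1)%:C = 1 :> C.
  by rewrite -rmorphM divff ?onem_kappa2_neq0.
rewrite /u_of /a [H0 _]eH sqr_sqrtc mulrCA cc mulr1 /sqk addrC subrK; exact: sqrtc_sqr.
Qed.

Lemma quadrant_off_cut u : quadrant u -> off_cut (sqk u).
Proof. by move=> Qu e; have := quadrant_sqr Qu; rewrite -(Im_sqk kappa) e ltxx. Qed.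

Lemma ccont_z_of u : off_cut (sqk u) -> ccont z_of u.
Proof.
move=> ou.
have c0 : 0 < (1 - kappa ^+ 2)^-1 by rewrite invr_gt0 onem_kappa2_gt0.
have o2 := off_cut_scale c0 ou; have y0 := Re_sqrtc_gt0 o2.
have h1 := ccontM (@ccont_sqk R kappa (fun x => x) u (ccont_id u)) (ccont_cst ((1 - kappa ^+ 2)^-1)%:C u).
have h2 := ccont_comp h1 (ccont_sqrtc o2).
have n0 : sqrtc (sqk u * ((1 - kappa ^+ 2)^-1)%:C) + 1 != 0 by rewrite addrC Re_gt0_1D_neq0.
have h3 := ccontD h2 (ccont_cst 1 u).
exact: ccontM (ccontD h2 (ccont_cst (-1) u)) (@ccontV R (fun x => sqrtc (sqk x * ((1 - kappa ^+ 2)^-1)%:C) + 1) u n0 h3).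
Qed.

Lemma u_ofK z : unit_disc z -> z_of (u_of z) = z.
Proof.
move=> Dz; have [D2 e] := z_ofP (Re_u_of kappa2 Dz) (off_cut_sqk kappa2 Dz).
exact: (u_of_inj kappa2).
Qed.

(** For u = 0, a boundary point of the quadrant, the singularity of [delta] is
    removed by continuity. *)
Definition delta_ext u : C := if u == 0 then 1 - t%:C / 2 else delta u t.

Lemma ccont_delta_ext u : ccont delta_ext u.
Proof.
have [->|u0] := eqVneq u 0; last first.
  apply: (@ccont_near R (fun x => delta x t)); last exact: (@ccont_delta R t (fun x => x) u u0 (ccont_id u)).
  by apply: cnearS (ccont_neq0 u0 (ccont_id u)) => x x0; rewrite /delta_ext (negbTE x0).
have hv := cdiffZ (t%:C / 2) (cdiff_id (0 : C)).
have := cdiff_sinh hv; rewrite mulr0 cosh0 mul1r mulr1 => -[phi [cp pl hp]].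
apply: (@ccont_near R (fun x => ccosh (t%:C * (x / 2)) - phi x)); last first.
  exact: ccontD (ccont_cosh (@ccont_arg R t (fun x => x) 0 (ccont_id 0))) (ccontN cp).
apply: cnearS hp => x e; rewrite /delta_ext; case: eqVneq => [->|x0].
  by rewrite mul0r mulr0 cosh0 pl.
rewrite /delta; congr (_ - _).
rewrite mulr0 sinh0 add0r subr0 in e.
by rewrite (_ : t%:C * (x / 2) = t%:C / 2 * x) ?e; [field|ring].
Qed.

(** The numerator and denominator of omega at time t are continuous in the whole
    plane, whereas omega may have poles on the boundary of the quadrant. *)
Definition onum u : C := u ^+ 2 - 1.

Definition oden u : C := sqk u * delta_ext u ^+ 2.

Lemma ccont_onum u : ccont onum u.
Proof. exact: ccontD (@ccontX2 R (fun x => x) u (ccont_id u)) (ccont_cst (-1) u). Qed.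

Lemma ccont_oden u : ccont oden u.
Proof. exact: ccontM (@ccont_sqk R kappa (fun x => x) u (ccont_id u)) (@ccontX2 R delta_ext u (@ccont_delta_ext u)). Qed.

Lemma deltaN u s : delta (- u) s = delta u s.
Proof. by rewrite /delta mulNr mulrN coshN sinhN invrN mulrNN. Qed.

Lemma delta_ext_real u : Re u = 0 \/ Im u = 0 -> Im (delta_ext u) = 0.
Proof.
move=> h; rewrite /delta_ext; case: eqVneq => [_|u0].
  rewrite ImD ImN Im1 ImM ReC ImC ImV Im_nat; ring.
apply: cj_real; rewrite -deltaJ; case: h => h.
  have -> : cj u = - u by apply: complexP; [rewrite ReJ ReN h oppr0|rewrite ImJ ImN].
  exact: deltaN.
have -> : cj u = u by apply: complexP; [rewrite ReJ|rewrite ImJ h oppr0].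
by [].
Qed.

Lemma real_sqr u : Re u = 0 \/ Im u = 0 -> Im (u ^+ 2) = 0.
Proof. by rewrite Im_sqr => -[] ->; ring. Qed.

(** On the coordinate axes u^2 and delta are real, hence so is omega;
    multiplying by the conjugate of the denominator avoids its poles. *)
Lemma onum_oden_real u : Re u = 0 \/ Im u = 0 -> Im (onum u * cj (oden u)) = 0.
Proof.
move=> h; have h1 := real_sqr h; have h2 := delta_ext_real h.
have h3 : Im (delta_ext u ^+ 2) = 0 by rewrite Im_sqr h2 mulr0.
rewrite /onum /oden /sqk; move: (u ^+ 2) (delta_ext u ^+ 2) h1 h3 => z d h1 h3.
by rewrite conjM !(ImM,ReM,ImD,ReD,ImN,ReN,ImJ,ReJ,Im1,Re1,ReC,ImC) h1 h3; ring.
Qed.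

Lemma omega_frac u : u != 0 -> omega u t = onum u / oden u.
Proof. by move=> u0; rewrite /omega /onum /oden /delta_ext (negbTE u0). Qed.

Lemma Im_onum_oden u : u != 0 -> oden u != 0 -> Im (onum u * cj (oden u)) = Im (omega u t) * sqnorm (oden u).
Proof. by move=> u0 m0; rewrite omega_frac // Im_div divfK // lt0r_neq0 // sqr_ReIm_gt0. Qed.
End Boundary.

(** * Values in the upper half-plane *)

Section UpperValues.
Variable R : realType.
Local Notation C := (R[i]).
Local Notation Co := (R[i]^o).
Local Notation Re := complex.Re.
Local Notation Im := complex.Im.
Local Notation cj := (@conjc R).
Implicit Types (z w u : C).
Variables kappa t : R.
Hypothesis kappa2 : kappa ^+ 2 < 1.
Hypothesis t0 : 0 < t.
Local Notation omega := (@omega R kappa).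
Local Notation sqk := (@sqk R kappa).
Local Notation admissible := (@admissible R kappa).
Local Notation u_of := (@u_of R kappa).

Local Notation Sigma := (@Sigma R kappa t).
Local Notation Lambda := (@Lambda R kappa t).
Local Notation onum := (@onum R).
Local Notation oden := (@oden R kappa t).
Local Notation z_of := (@z_of R kappa).

Definition adherent (U : C -> Prop) u := forall P, cnear u P -> exists2 x, U x & P x.

Lemma adherent_self (U : C -> Prop) u : U u -> adherent U u.
Proof. by move=> Uu P /cnear_self Pu; exists u. Qed.

Lemma adherent_le (U : C -> Prop) (f : C -> R) c u : adherent U u -> rcont f u -> (forall x, U x -> f x <= c) -> f u <= c.
Proof.
move=> au /rcontP cf h; rewrite leNgt; apply/negP => hc.
have e0 : 0 < f u - c by rewrite subr_gt0.
have [x Ux] := au _ (cf _ e0); rewrite ltr_norml => /andP[h1 _].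
have := h x Ux; lra.
Qed.

Lemma adherent_ge (U : C -> Prop) (f : C -> R) c u : adherent U u -> rcont f u -> (forall x, U x -> c <= f x) -> c <= f u.
Proof.
move=> au cf h; rewrite -lerN2; apply: (@adherent_le U (fun x => - f x)) => //; first exact: rcontN.
by move=> x Ux; rewrite lerN2 h.
Qed.

(** The closure of a bounded set is compact. *)
Lemma adherent_min (U : C -> Prop) (f : C -> R) (B : R) : (exists u, U u) ->
  (forall u, U u -> `|Re u| <= B /\ `|Im u| <= B) -> (forall u, adherent U u -> rcont f u) ->
  exists2 u0, adherent U u0 & forall u, adherent U u -> f u0 <= f u.
Proof.
move=> [u1 Uu1] hB hf.
pose K : set Co := closure (U : set Co).
have KE u : K u <-> adherent U u.
  split=> h P hP.
    by have [x [Ux Px]] := h P ((nbhs_boxP u P).2 hP); exists x.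
  by have [x Ux Px] := h P ((nbhs_boxP u P).1 hP); exists x.
pose box := (`[- B, B]%classic `*` `[- B, B]%classic : set (R * R)).
pose g (p : R * R) : Co := p.1 +i* p.2.
have cg : continuous g.
  move=> p P /nbhs_boxP[e e0 hP].
  have c1 : fst @ p --> p.1 by exact: cvg_fst.
  have c2 : snd @ p --> p.2 by exact: cvg_snd.
  change (nbhs p (g @^-1` P)); near=> r; rewrite /=; apply: hP; rewrite /= distrC; near: r.
    by move/cvgrPdist_lt : c1; apply.
  by move/cvgrPdist_lt : c2; apply.
have cbox : compact (g @` box).
  apply: continuous_compact; first exact: continuous_subspaceT.
  by apply: compact_setX; exact: segment_compact.
have cK : compact K.
  apply: subclosed_compact cbox _; first exact: closed_closure.
  move=> u /KE au.
  have hr : rcont (fun x => Re x) u := rcont_Re (ccont_id u).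
  have hi : rcont (fun x => Im x) u := rcont_Im (ccont_id u).
  exists (Re u, Im u); last by apply: complexP.
  split; rewrite /= in_itv /=; apply/andP; split.
  - by apply: (@adherent_ge U (fun x => Re x)) => // x /hB[]; rewrite ler_norml => /andP[].
  - by apply: (@adherent_le U (fun x => Re x)) => // x /hB[]; rewrite ler_norml => /andP[].
  - by apply: (@adherent_ge U (fun x => Im x)) => // x /hB[_]; rewrite ler_norml => /andP[].
  - by apply: (@adherent_le U (fun x => Im x)) => // x /hB[_]; rewrite ler_norml => /andP[].
have K0 : K !=set0 by exists u1; apply/KE; exact: adherent_self.
have cf : {within K, continuous (f : Co -> R)}.
  by apply: continuous_in_subspaceT => x; rewrite inE => /KE/hf.
have [u0 u0K hmin] := compact_EVT_min K0 cK cf.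
exists u0; first by apply/KE; rewrite inE in u0K.
by move=> u /KE Ku; apply: hmin; rewrite inE.
Unshelve. all: by end_near.
Qed.

(** For w = n / m this compares the distances of w to W and to its mirror image
    conj W: the nearer one is on the same side of the real axis as w. *)
Lemma sqnorm_reflection (W n m : C) : sqnorm (n - cj W * m) - sqnorm (n - W * m) = 4 * Im W * Im (n * cj m).
Proof. by rewrite /sqnorm !(ReD,ImD,ReN,ImN,ReM,ImM,ReJ,ImJ); ring. Qed.

(** The derivative is a multiple of the expression in [omega_crit]. *)
Lemma cdiff_frac (W : C) u : quadrant u -> onum u - cj W * oden u != 0 ->
  cdiff (fun x => (x ^+ 2 - 1 - W * (sqk x * delta x t ^+ 2)) / (x ^+ 2 - 1 - cj W * (sqk x * delta x t ^+ 2))) u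
   ((W - cj W) * (2 * delta u t * (u * delta u t * (1 - (kappa ^+ 2)%:C) - (u ^+ 2 - 1) * sqk u * delta_u u t)) / (onum u - cj W * oden u) ^+ 2).
Proof.
move=> Qu; have u0 := quadrant_neq0 Qu.
rewrite /oden /delta_ext (negbTE u0) /onum => d0.
have h2 := cdiffM (cdiff_id u) (cdiff_id u).
have hN : cdiff (fun x : C => x ^+ 2 - 1) u (2 * u).
  by apply: cdiff_eq (cdiffD h2 (cdiff_cst (-1) u)); ring.
have hZ : cdiff sqk u (2 * u).
  by apply: cdiff_eq (cdiffD h2 (cdiff_cst (- (kappa ^+ 2)%:C) u)); ring.
have hD := @cdiff_delta R u t u0.
have hM : cdiff (fun x : C => sqk x * delta x t ^+ 2) u (2 * u * delta u t ^+ 2 + sqk u * (2 * delta u t * delta_u u t)).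
  by apply: cdiff_eq (cdiffM hZ (cdiffM hD hD)); ring.
have hF k : cdiff (fun x : C => x ^+ 2 - 1 - k * (sqk x * delta x t ^+ 2)) u
    (2 * u - k * (2 * u * delta u t ^+ 2 + sqk u * (2 * delta u t * delta_u u t))).
  rewrite (_ : (fun x => _) = fun x => x ^+ 2 - 1 + (- k) * (sqk x * delta x t ^+ 2)); last first.
    by apply/funext => x; rewrite mulNr.
  by apply: cdiff_eq (cdiffD hN (cdiffZ (- k) hM)); rewrite mulNr.
apply: cdiff_eq (cdiffM (hF W) (@cdiffV R _ u _ d0 (hF (cj W)))).
move: d0; rewrite /sqk; move: (delta u t) (delta_u u t) (cj W) ((kappa ^+ 2)%:C) => d d' W' k d0.
by field.
Qed.

Lemma rcont_sqnorm (f : C -> C) u : ccont f u -> rcont (fun x => sqnorm (f x)) u.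
Proof.
move=> hf; have hr := rcont_Re hf; have hi := rcont_Im hf.
exact: rcontD (rcontM hr hr) (rcontM hi hi).
Qed.

Lemma ccont_cj (f : C -> C) u : ccont f u -> ccont (fun x => cj (f x)) u.
Proof. by move=> hf; apply: ccont_comp hf (@continuous_cj R (f u)). Qed.

Lemma sqnorm_gt0 z : z != 0 -> 0 < sqnorm z. Proof. exact: sqr_ReIm_gt0. Qed.

Lemma sqnorm_div z w : w != 0 -> sqnorm (z / w) = sqnorm z / sqnorm w.
Proof.
move=> w0; have n0 : sqnorm w != 0 by rewrite gt_eqF // sqnorm_gt0.
by apply: (canRL (mulfK n0)); rewrite -sqnormM divfK.
Qed.

Lemma oden_1_neq0 : oden 1 != 0.
Proof.
rewrite /oden /delta_ext oner_eq0 mulf_neq0 ?expf_neq0 ?delta_1 ?cexp_neq0 //.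
rewrite /sqk expr1n -(rmorph1 (@real_complex R)) -rmorphB /= eq_complex /= eqxx andbT.
exact: onem_kappa2_neq0.
Qed.

Lemma onum_eq0 u : 0 <= Re u -> onum u = 0 -> u = 1.
Proof.
move=> r0; rewrite /onum => /eqP; rewrite subr_eq0 sqrf_eq1 => /orP[]/eqP// e.
by move: r0; rewrite e ReN Re1 lerNr oppr0 ler10.
Qed.

(** The part of Lambda in the upper half of the disc, seen through u. *)
Definition LambdaQ u := quadrant u /\ Lambda (z_of u).

Lemma quadrant_Sigma u : quadrant u -> 0 < Im (omega u t) -> Sigma (z_of u).
Proof.
move=> Qu iw; have [ru _] := Qu; have [Dz e] := z_ofP kappa2 ru (@quadrant_off_cut R kappa u Qu).
apply/SigmaP => //; rewrite e; split => //; first exact: delta_neq0.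
by rewrite /off_cut ImD ImN Im1 => h; lra.
Qed.

Lemma LambdaQ_admissible u : LambdaQ u -> admissible u t.
Proof.
move=> [Qu Lu]; have [ru _] := Qu; have [Dz e] := z_ofP kappa2 ru (@quadrant_off_cut R kappa u Qu).
by have := Lambda_admissible kappa2 t0 Lu; rewrite e; apply; case: Qu.
Qed.

Lemma LambdaQ_near u : LambdaQ u -> cnear u LambdaQ.
Proof.
move=> [Qu Lu]; have oq := @quadrant_off_cut R kappa u Qu.
have cz := (ccontE _ _).1 (@ccont_z_of R kappa kappa2 u oq) _ (Lambda_near kappa2 (LambdaS Lu)).
have hq : cnear u (@quadrant R).
  exists (Num.min (Re u) (Im u)); first by rewrite lt_min; case: Qu => -> ->.
  move=> x; rewrite !lt_min !ltr_norml => /andP[/andP[h1 _] _] /andP[_ /andP[h2 _]].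
  by split; lra.
by apply: cnearS (cnearI hq cz) => x [qx [_ e]]; split => //; apply/e.
Qed.

(** At an adherent point where omega is still in the upper half-plane, z is in
    Sigma, and Lambda is closed in Sigma. *)
Lemma LambdaQ_adherent u : adherent LambdaQ u -> quadrant u -> 0 < Im (omega u t) -> LambdaQ u.
Proof.
move=> au Qu iw; split => //; have oq := @quadrant_off_cut R kappa u Qu.
have cz := (ccontE _ _).1 (@ccont_z_of R kappa kappa2 u oq) _ (Lambda_near kappa2 (quadrant_Sigma Qu iw)).
by have [x [_ Lx] [_ e]] := au _ cz; apply/e.
Qed.

Lemma LambdaQ_pos u : LambdaQ u -> 0 < Im (onum u * cj (oden u)).
Proof.
move=> Uu; have [Qu _] := Uu; have u0 := quadrant_neq0 Qu; have [iw _] := LambdaQ_admissible Uu.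
have m0 : oden u != 0.
  by rewrite /oden /delta_ext (negbTE u0) mulf_neq0 ?expf_neq0 ?(quadrant_sqk kappa Qu) ?(delta_neq0 _ Qu).
by rewrite (Im_onum_oden u0 m0) mulr_gt0 // sqnorm_gt0.
Qed.

Lemma LambdaQ_bounded u : LambdaQ u -> `|Re u| <= 641 + 16 / t /\ `|Im u| <= 641 + 16 / t.
Proof.
move=> Uu; have [Qu _] := Uu; have g := LambdaQ_admissible Uu.
have h : Re u ^+ 2 + Im u ^+ 2 <= 640 + 16 / t.
  by apply: (admissible_bounded kappa2 Qu t0) => s hs; have [] := admissible_backward kappa2 Qu g hs.
have h2 : 0 < 16 / t by rewrite divr_gt0.
by case: Qu => r0 i0; rewrite !gtr0_norm //; split; nra.
Qed.

Lemma z_of_1 : z_of 1 = 0.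
Proof. by rewrite -(u_of_0 kappa) u_ofK //; exact: unit_disc0. Qed.

Lemma LambdaQ_nonempty : exists u, LambdaQ u.
Proof.
have o1 : off_cut (sqk (1 : C)) by rewrite -(u_of_0 kappa); apply: off_cut_sqk => //; exact: unit_disc0.
have h := Lambda_near kappa2 (Sigma0 t kappa2); rewrite -z_of_1 in h.
have [e e0 he] := (ccontE _ _).1 (@ccont_z_of R kappa kappa2 1 o1) _ h.
(* u = 1 corresponds to z = 0, and points above it are in the quadrant. *)
exists (1 +i* (e / 2)); split.
  by split; rewrite /= ?divr_gt0.
have [||_ el] := he (1 +i* (e / 2)).
- by rewrite /= subrr normr0.
- by rewrite /= subr0 gtr0_norm ?divr_gt0 // ltr_pdivrMr // mulr2n mulrDr mulr1 ltrDl.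
- by apply/el; rewrite z_of_1; exact: Lambda0.
Qed.

(** The function f below is the squared modulus of (omega - W) / (omega - conj
    W), written so that poles of omega do not matter. It is smaller than 1
    exactly where Im omega > 0. *)
Lemma upper_surj (W : C) : 0 < Im W -> exists2 z, Lambda z & omega (u_of z) t = W.
Proof.
move=> W0.
have aRe u : adherent LambdaQ u -> 0 <= Re u.
  move=> au; apply: (@adherent_ge LambdaQ (fun x => Re x)) => //; first exact: rcont_Re (ccont_id u).
  by move=> x [[h _] _]; exact: ltW.
have cNM u := ccontM (@ccont_onum R u) (@ccont_cj oden u (@ccont_oden R kappa t u)).
have aNM u : adherent LambdaQ u -> 0 <= Im (onum u * cj (oden u)).
  move=> au; apply: (@adherent_ge LambdaQ (fun x => Im (onum x * cj (oden x)))) => //; first exact: rcont_Im (cNM u).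
  by move=> x /LambdaQ_pos/ltW.
(* If n = conj W m with m nonzero, then n / m = conj W would be below the real
   axis; and n = m = 0 is impossible, because n vanishes only at u = 1,
   where m does not. *)
have den0 u : adherent LambdaQ u -> onum u - cj W * oden u != 0.
  move=> au; apply/negP; rewrite subr_eq0 => /eqP e.
  have h := aNM u au; rewrite e in h.
  have em : Im (cj W * oden u * cj (oden u)) = - Im W * sqnorm (oden u).
    by rewrite /sqnorm !(ReM,ImM,ReJ,ImJ); ring.
  have m0 : oden u = 0.
    by apply/eqP; apply: contraTT h => /sqnorm_gt0 m0; rewrite em -ltNge nmulr_rlt0 // oppr_lt0.
  have u1 : u = 1 by apply: onum_eq0; [exact: aRe|rewrite e m0 mulr0].
  by have := oden_1_neq0; rewrite -u1 m0 eqxx.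
pose f u := sqnorm (onum u - W * oden u) / sqnorm (onum u - cj W * oden u).
have cN k u : ccont (fun x => onum x - k * oden x) u.
  exact: ccontD (@ccont_onum R u) (ccontN (ccontM (ccont_cst k u) (@ccont_oden R kappa t u))).
have cf u : adherent LambdaQ u -> rcont f u.
  move=> au; apply: rcontM; first exact: rcont_sqnorm (cN W u).
  by apply: rcontV; [rewrite gt_eqF // sqnorm_gt0 // den0|exact: rcont_sqnorm (cN (cj W) u)].
have [u0 au0 hmin] := adherent_min LambdaQ_nonempty LambdaQ_bounded cf.
have [u1 Uu1] := LambdaQ_nonempty.
have au1 := adherent_self Uu1.
have fE u : adherent LambdaQ u -> (f u < 1) = (0 < Im (onum u * cj (oden u))).
  move=> au; rewrite /f ltr_pdivrMr ?sqnorm_gt0 ?den0 // mul1r -subr_gt0 sqnorm_reflection.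
  by rewrite pmulr_rgt0 // mulr_gt0.
have p0 : 0 < Im (onum u0 * cj (oden u0)).
  by rewrite -fE //; apply: le_lt_trans (hmin _ au1) _; rewrite fE //; exact: LambdaQ_pos.
(* The minimum is not attained on the axes, where Im (n conj m) = 0. *)
have Qu : quadrant u0.
  have r0 : Re u0 != 0 by apply: contraTneq p0 => h; rewrite (onum_oden_real kappa t (or_introl h)) ltxx.
  have i0 : Im u0 != 0 by apply: contraTneq p0 => h; rewrite (onum_oden_real kappa t (or_intror h)) ltxx.
  split; first by rewrite lt_def r0 aRe.
  rewrite lt_def i0; apply: (@adherent_ge LambdaQ (fun x => Im x)) => //; first exact: rcont_Im (ccont_id u0).
  by move=> x [[_ h] _]; exact: ltW.
have un := quadrant_neq0 Qu.
have m0 : oden u0 != 0 by apply: contraTneq p0 => ->; rewrite (conjR 0) mulr0 ltxx.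
have iw : 0 < Im (omega u0 t) by move: p0; rewrite (Im_onum_oden un m0) pmulr_lgt0 // sqnorm_gt0.
have Uu := LambdaQ_adherent au0 Qu iw.
have [disc0 e] := z_ofP kappa2 Qu.1 (@quadrant_off_cut R kappa u0 Qu).
exists (z_of u0); first by case: Uu.
rewrite e omega_frac //; apply: (canLR (mulfK m0)); apply/eqP; rewrite -subr_eq0; apply/negPn/negP => n0.
have d0 := den0 _ au0.
(* Otherwise the value of f can be decreased within LambdaQ. *)
have hW : W - cj W != 0.
  apply: contraTneq W0 => /(congr1 (@complex.Im R)).
  rewrite ImD ImN ImJ opprK => h; have : Im W + Im W = 0 by exact: h.
  by lra.
have hd := cdiff_frac Qu d0.
have l0 := mulf_neq0 (mulf_neq0 hW (mulf_neq0 (mulf_neq0 (_ : 2 != 0 :> C) (delta_neq0 t Qu)) (omega_crit kappa2 Qu (LambdaQ_admissible Uu) (ltW t0)))) (_ : ((onum u0 - cj W * oden u0) ^+ 2)^-1 != 0).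
have fN k u : quadrant u -> onum u - k * oden u = u ^+ 2 - 1 - k * (sqk u * delta u t ^+ 2).
  by move=> Qu'; rewrite /onum /oden /delta_ext (negbTE (quadrant_neq0 Qu')).
have nf u : adherent LambdaQ u -> quadrant u -> sqnorm ((u ^+ 2 - 1 - W * (sqk u * delta u t ^+ 2)) / (u ^+ 2 - 1 - cj W * (sqk u * delta u t ^+ 2))) = f u.
  by move=> au Qu'; rewrite /f -!fN // sqnorm_div // den0.
have n0' : (u0 ^+ 2 - 1 - W * (sqk u0 * delta u0 t ^+ 2)) / (u0 ^+ 2 - 1 - cj W * (sqk u0 * delta u0 t ^+ 2)) != 0.
  by rewrite -!fN // mulf_neq0 // invr_eq0.
have [||x Ux] := sqnorm_decrease hd (l0 _ _) n0' (LambdaQ_near Uu).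
- by rewrite pnatr_eq0.
- by rewrite invr_eq0 expf_neq0.
have [Qx _] := Ux; have aux := adherent_self Ux.
by rewrite (nf x) // (nf u0) // ltNge hmin.
Qed.
End UpperValues.

(** * Real values and surjectivity *)

Section RealValues.
Variable R : realType.
Local Notation C := (R[i]).
Local Notation Co := (R[i]^o).
Local Notation Re := complex.Re.
Local Notation Im := complex.Im.
Local Notation cj := (@conjc R).
Implicit Types (z w u : C).
Variables kappa t : R.
Hypothesis kappa2 : kappa ^+ 2 < 1.
Hypothesis t0 : 0 < t.
Local Notation omega := (@omega R kappa).
Local Notation sqk := (@sqk R kappa).
Local Notation u_of := (@u_of R kappa).

Local Notation Sigma := (@Sigma R kappa t).
Local Notation Lambda := (@Lambda R kappa t).
Local Notation psi := (@psi R kappa t).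
Local Notation onum := (@onum R).
Local Notation oden := (@oden R kappa t).
Local Notation z_of := (@z_of R kappa).

(** For real r all quantities are real: [deltaR] and [odenR] are the real
    versions of [delta_ext] and [oden]. *)
Definition deltaR (r : R) := Re (delta_ext t r%:C).

Definition odenR (r : R) := (r ^+ 2 - kappa ^+ 2) * deltaR r ^+ 2.

Lemma delta_ext_C (r : R) : delta_ext t r%:C = (deltaR r)%:C.
Proof. by rewrite real_of_Im0 //; apply: delta_ext_real; right; rewrite ImC. Qed.

Lemma onum_C (r : R) : onum r%:C = (r ^+ 2 - 1)%:C.
Proof. by rewrite /onum -rmorphXn -(rmorph1 (@real_complex R)) -rmorphB. Qed.

Lemma sqk_C (r : R) : sqk r%:C = (r ^+ 2 - kappa ^+ 2)%:C.
Proof. by rewrite /sqk -rmorphXn -rmorphB. Qed.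

Lemma oden_C (r : R) : oden r%:C = (odenR r)%:C.
Proof. by rewrite /oden sqk_C delta_ext_C -rmorphXn -rmorphM. Qed.

Lemma delta_C (r : R) : r != 0 -> delta r%:C t = (deltaR r)%:C.
Proof. by move=> r0; rewrite -delta_ext_C /delta_ext eq_complex /= eqxx andbT (negbTE r0). Qed.

Lemma deltaR_E (r : R) : r != 0 -> deltaR r = coshR (t * r / 2) - sinhR (t * r / 2) / r.
Proof.
move=> r0; have rn : r%:C != 0 :> C by rewrite eq_complex /= eqxx andbT.
have e : t%:C * (r%:C / 2) = (t * r / 2)%:C by rewrite natC -fmorphV -!rmorphM mulrA.
rewrite /deltaR /delta_ext (negbTE rn) /delta e ReD ReN (ReM (csinh _)) Re_ccosh Re_csinh Im_csinh ReC ImC sin0 cos0.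
by rewrite ReV ImV ReC ImC; field.
Qed.

Lemma ddelta_E (r : R) : Re (ddelta r%:C t) = (r * sinhR (t * r / 2) - coshR (t * r / 2)) / 2.
Proof.
have e : t%:C * (r%:C / 2) = (t * r / 2)%:C by rewrite natC -fmorphV -!rmorphM mulrA.
rewrite /ddelta e natC -fmorphV -!rmorphM ReD ReN !(ReM (_%:C)) (ReM (ccosh _)) Re_ccosh Im_ccosh Re_csinh Im_csinh ReC ImC sin0 cos0.
by rewrite /=; ring.
Qed.

Lemma sinhR_lt_coshR (x : R) : sinhR x < coshR x.
Proof. by rewrite /sinhR /coshR; have := @expR_gt0 R (- x); lra. Qed.

Lemma deltaR_gt0 (r : R) : 1 <= r -> 0 < deltaR r.
Proof.
move=> r1; have r0 : 0 < r by lra.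
rewrite (deltaR_E (lt0r_neq0 r0)) subr_gt0 ltr_pdivrMr //.
apply: lt_le_trans (sinhR_lt_coshR _) _.
by rewrite ler_peMr // (le_trans ler01) // coshR_ge1.
Qed.

Lemma continuous_real (g : C -> R) : (forall u, rcont g u) -> continuous (fun r : R => g r%:C).
Proof.
move=> cg r; have cr : @continuous_at R Co r (fun r => r%:C).
  by apply: continuous_RC; [exact: cvg_id|exact: cvg_cst].
exact: (@continuous_comp R Co R (fun r => r%:C) g r cr (cg r%:C)).
Qed.

Lemma omega_C (r : R) : r != 0 -> omega r%:C t = ((r ^+ 2 - 1) / odenR r)%:C.
Proof.
move=> r0; have rn : r%:C != 0 :> C by rewrite eq_complex /= eqxx andbT.
by rewrite omega_frac // onum_C oden_C; move: (odenR r) => m; rewrite rmorphM fmorphV.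
Qed.

Lemma real_Sigma (r : R) : 0 < r -> kappa ^+ 2 < r ^+ 2 -> deltaR r != 0 -> (r ^+ 2 - 1) / odenR r < 1 ->
  [/\ off_cut (sqk r%:C), u_of (z_of r%:C) = r%:C & Sigma (z_of r%:C)].
Proof.
move=> r0 kr d0 w1.
have oz : off_cut (sqk r%:C) by rewrite sqk_C /off_cut ReC subr_gt0.
have [Dz e] := z_ofP kappa2 (r0 : 0 < Re r%:C) oz.
have d' : delta r%:C t != 0 by rewrite (delta_C (lt0r_neq0 r0)) eq_complex /= eqxx andbT.
have o' : off_cut (1 - omega r%:C t).
  by rewrite (omega_C (lt0r_neq0 r0)) /off_cut ReD ReN Re1 ReC subr_gt0.
have S : Sigma (z_of r%:C) by apply/(SigmaP t kappa2); rewrite e; exact: And3 Dz d' o'.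
exact: And3 oz e S.
Qed.

Lemma real_Lambda (x y : R) : x <= y ->
  (forall r, x <= r <= y -> [/\ 0 < r, kappa ^+ 2 < r ^+ 2, deltaR r != 0 & (r ^+ 2 - 1) / odenR r < 1]) ->
  x <= 1 <= y -> forall r, x <= r <= y -> Lambda (z_of r%:C).
Proof.
move=> xy h h1 r hr.
apply: (@Lambda_path R kappa t (fun r => z_of r%:C) x y xy _ _ 1 r h1 hr).
- move=> s /h[s0 ks ds ws]; have [oz _ _] := real_Sigma s0 ks ds ws.
  have cr : @continuous_at R Co s (fun r => r%:C).
    by apply: continuous_RC; [exact: cvg_id|exact: cvg_cst].
  exact: (@continuous_comp R Co Co (fun r => r%:C) z_of s cr (@ccont_z_of R kappa kappa2 s%:C oz)).
- by move=> s /h[s0 ks ds ws]; have [_ _] := real_Sigma s0 ks ds ws.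
- by rewrite (z_of_1 kappa2); exact: Lambda0.
Qed.

Lemma continuous_level (v : R) : continuous (fun r : R => r ^+ 2 - 1 - v * odenR r).
Proof.
rewrite (_ : (fun r : R => _) = fun r : R => (fun u : C => Re (onum u - v%:C * oden u)) r%:C).
  apply: (@continuous_real (fun u => Re (onum u - v%:C * oden u))) => u; apply: rcont_Re.
  exact: ccontD (@ccont_onum R u) (ccontN (ccontM (ccont_cst v%:C u) (@ccont_oden R kappa t u))).
by apply/funext => r; rewrite onum_C oden_C -rmorphM -rmorphB ReC.
Qed.

Lemma odenR_gt0 (r : R) : kappa ^+ 2 < r ^+ 2 -> deltaR r != 0 -> 0 < odenR r.
Proof. by move=> kr d0; rewrite mulr_gt0 ?subr_gt0 // exprn_even_gt0. Qed.

Lemma kappa2_lt_sqr (r : R) : 1 <= r -> kappa ^+ 2 < r ^+ 2.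
Proof. by move=> r1; apply: lt_le_trans kappa2 _; rewrite expr_ge1 // (le_trans ler01). Qed.

(** At a zero of the time derivative of delta one has gamma = 0, so that 1 -
    omega = - kappa^2 / (u^2 - kappa^2) is at most 0. *)
Lemma exists_omega_ge1 : exists2 x, 1 <= x & odenR x <= x ^+ 2 - 1.
Proof.
(* The choice gives t X / 2 = t + 1, and (X - 1) sinh (t + 1) is at least 1,
   hence at least cosh (t + 1) - sinh (t + 1). *)
pose X : R := 2 + 2 / t.
have X0 : 0 < 2 / t by rewrite divr_gt0.
have X1 : 1 <= X by rewrite /X; lra.
have cD : continuous (fun r : R => Re (ddelta r%:C t)).
  apply: (@continuous_real (fun u => Re (ddelta u t))) => u; apply: rcont_Re.
  exact: (@ccont_ddelta R t (fun x => x) u (ccont_id u)).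
have [|x hx e] := @IVT R _ 1 X 0 X1 (continuous_subspaceT cD).
  have h1 : Re (ddelta 1%:C t) < 0.
    by rewrite ddelta_E pmulr_llt0 // mul1r subr_lt0 sinhR_lt_coshR.
  have h2 : 0 <= Re (ddelta X%:C t).
    rewrite ddelta_E pmulr_lge0 // subr_ge0.
    have tX : t * X / 2 = t + 1 by rewrite /X; field; rewrite gt_eqF.
    rewrite tX; have t1 : 0 <= t + 1 by rewrite addr_ge0 // ltW.
    have s1 := sinhR_ge t1.
    have : coshR (t + 1) - sinhR (t + 1) <= 1.
      rewrite (_ : coshR _ - sinhR _ = expR (- (t + 1))); last by rewrite /coshR /sinhR; lra.
      by rewrite expR_le1 oppr_le0.
    by have := X0; rewrite /X; nra.
  by rewrite ge_min le_max (ltW h1) h2 orbT.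
rewrite in_itv /= in hx; have /andP[x1 _] := hx.
have x0 : 0 < x by apply: lt_le_trans x1.
exists x => //.
have xn : x%:C != 0 :> C by exact: realC_neq0.
have d0 := deltaR_gt0 x1.
have zn : sqk x%:C != 0 by rewrite sqk_C eq_complex /= eqxx andbT gt_eqF // subr_gt0 kappa2_lt_sqr.
have dn : delta x%:C t != 0 by rewrite (delta_C (lt0r_neq0 x0)) eq_complex /= eqxx andbT gt_eqF.
have := omega_gam xn zn dn; rewrite gamC e mulr0 mul0r oppr0 expr0n /= add0r.
rewrite (omega_C (lt0r_neq0 x0)) sqk_C => /(congr1 (@complex.Re R)).
rewrite ReM !(ReD,ImD,ReN,ImN,Re1,Im1,ReC,ImC) oppr0 addr0 mulr0 subr0.
have m0 := odenR_gt0 (kappa2_lt_sqr x1) (lt0r_neq0 d0); have kx := kappa2_lt_sqr x1.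
move=> h; have : (1 - (x ^+ 2 - 1) / odenR x) * (x ^+ 2 - kappa ^+ 2) <= 0 by rewrite h oppr_le0 sqr_ge0.
by rewrite pmulr_lle0 ?subr_gt0 // subr_le0 ler_pdivlMr // mul1r.
Qed.

(** At u = 1 the value of omega is 0. For v >= 0, move to the right up to the
    first point where the value is v. For v < 0, move to the left, towards u
    = |kappa| where the denominator vanishes. On the way omega stays below
    1, so the path stays in Sigma. *)
Lemma real_surj (v : R) : v < 1 -> exists2 z, Lambda z & omega (u_of z) t = v%:C.
Proof.
move=> v1.
have fin x : 0 < x -> kappa ^+ 2 < x ^+ 2 -> deltaR x != 0 -> x ^+ 2 - 1 - v * odenR x = 0 -> Lambda (z_of x%:C) ->
    exists2 z, Lambda z & omega (u_of z) t = v%:C.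
  move=> x0 kx d0 /eqP; rewrite subr_eq0 => /eqP hx L; exists (z_of x%:C) => //.
  have m0 := odenR_gt0 kx d0; have e : (x ^+ 2 - 1) / odenR x = v by rewrite hx mulfK // lt0r_neq0.
  have w1 : (x ^+ 2 - 1) / odenR x < 1 by rewrite e.
  have [_ eu _] := real_Sigma x0 kx d0 w1.
  by rewrite eu (omega_C (lt0r_neq0 x0)) e.
have m1 : 0 < odenR 1 by apply: odenR_gt0; [exact: kappa2_lt_sqr|exact: lt0r_neq0 (deltaR_gt0 (lexx 1))].
(* The level set omega = v is the zero set of r^2 - 1 - v odenR r. *)
have [v0|v0] := leP 0 v.
  have [x1 hx1 mx1] := exists_omega_ge1.
  have mx1' : 0 < odenR x1 by apply: odenR_gt0; [exact: kappa2_lt_sqr|exact: lt0r_neq0 (deltaR_gt0 hx1)].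
  have [|x [hx ex hy]] := first_hit hx1 (@continuous_level v) (v := 0).
    rewrite expr1n subrr add0r oppr_le0 mulr_ge0 ?(ltW m1) //= subr_ge0.
    by apply: le_trans mx1; rewrite ler_piMl ?(ltW mx1') // ltW.
  have /andP[x_ge1 _] := hx.
  have x0 := lt_le_trans ltr01 x_ge1.
  have hL : forall r, 1 <= r <= x -> Lambda (z_of r%:C).
    apply: real_Lambda => //; last by rewrite lexx.
    move=> r hr; have /andP[r1 _] := hr; have d0 := lt0r_neq0 (deltaR_gt0 r1).
    split; [exact: lt_le_trans r1|exact: kappa2_lt_sqr|exact: d0|].
    apply: le_lt_trans v1; rewrite ler_pdivrMr; last exact: odenR_gt0 (kappa2_lt_sqr r1) d0.
    by rewrite -subr_le0 hy.
  apply: (fin x) => //; [exact: kappa2_lt_sqr|exact: lt0r_neq0 (deltaR_gt0 x_ge1)|].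
  by apply: hL; rewrite x_ge1 lexx.
have k1 : `|kappa| < 1 by rewrite -(@ltr_pXn2r _ 2) // ?nnegrE // ?real_normK ?num_real // expr1n.
have mk : odenR `|kappa| = 0 by rewrite /odenR real_normK ?num_real // subrr mul0r.
have [||x [/andP[kx x1] ex hy]] := last_zero (ltW k1) (@continuous_level v).
- by rewrite mk mulr0 subr0 real_normK ?num_real // subr_le0 ltW.
- by rewrite expr1n subrr add0r oppr_gt0 pmulr_llt0.
(* At a zero of odenR in [|kappa|, 1] the level function would be r^2 - 1,
   which contradicts its sign. *)
have key r : `|kappa| <= r -> r <= 1 -> 0 <= r ^+ 2 - 1 - v * odenR r -> r < 1 \/ 0 < r ^+ 2 - 1 - v * odenR r ->
    [/\ 0 < r, kappa ^+ 2 < r ^+ 2 & deltaR r != 0].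
  move=> kr r1 h h'; have r0 : 0 <= r by exact: le_trans kr.
  have k2 : kappa ^+ 2 = `|kappa| ^+ 2 by rewrite real_normK ?num_real.
  have n0 : r ^+ 2 - 1 <= 0 by rewrite subr_le0 expr_le1.
  have mr : odenR r != 0.
    apply/negP => /eqP e; move: h h'; rewrite e mulr0 subr0 => h [r_lt1|].
      by have : r ^+ 2 < 1; [rewrite expr_lt1|rewrite -subr_lt0 ltNge h].
    by rewrite ltNge n0.
  have d0 : deltaR r != 0 by apply: contraNneq mr => e; rewrite /odenR e expr0n mulr0.
  have kr' : `|kappa| < r.
    rewrite lt_neqAle kr andbT; apply: contraNneq mr => e.
    by rewrite /odenR k2 e subrr mul0r.
  split=> //; first exact: le_lt_trans kr'.
  by rewrite k2 ltr_pXn2r // nnegrE.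
have [x0 kx2 d0] := key x kx (ltW x1) (eq_ind_r (fun y => 0 <= y) (lexx 0) ex) (or_introl x1).
apply: (fin x) => //.
apply: (@real_Lambda x 1) => //; [exact: ltW| |by rewrite lexx ltW|by rewrite lexx ltW].
move=> r /andP[xr r1].
have h : 0 <= r ^+ 2 - 1 - v * odenR r.
  have [->|xr'] := eqVneq r x; first by rewrite ex.
  by rewrite ltW // hy // r1 lt_neqAle eq_sym xr' xr.
have h' : r < 1 \/ 0 < r ^+ 2 - 1 - v * odenR r.
  have [->|r1'] := eqVneq r 1; last by left; rewrite lt_neqAle r1' r1.
  by right; rewrite hy // x1 lexx.
have [r0 kr dr] := key r (le_trans kx xr) r1 h h'; split => //.
apply: le_lt_trans ltr01; rewrite ler_pdivrMr ?odenR_gt0 // mul0r subr_le0 expr_le1 // ltW //.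
Qed.

Lemma omega_surj (W : C) : off_cut (1 - W) -> exists2 z, Lambda z & omega (u_of z) t = W.
Proof.
move=> oW; have [i0|i0|i0] := ltgtP (Im W) 0.
- have [|z Lz e] := @upper_surj R kappa t kappa2 t0 (cj W); first by rewrite ImJ oppr_gt0.
  have [Dz _ _] := (SigmaP t kappa2 z).1 (LambdaS Lz).
  exists (cj z); first exact: LambdaJ.
  by rewrite u_ofJ // omegaJ e conjcK.
- exact: upper_surj.
- rewrite -(real_of_Im0 i0); apply: real_surj.
  by rewrite -subr_gt0; move: oW; rewrite /off_cut ReD ImD ReN ImN Re1 Im1 i0 subr0 => ->.
Qed.

Lemma psi_surj p : unit_disc p -> exists2 z, Lambda z & psi z = p.
Proof.
move=> /alpha_surj[W oW <-]; have [z Lz e] := omega_surj oW.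
by exists z => //; rewrite psiE -?Sigma_dom ?e //; exact: LambdaS.
Qed.

Lemma psi_maps z : Lambda z -> unit_disc (psi z).
Proof. by move=> /LambdaS[]. Qed.
End RealValues.

Theorem proposition1 (R : realType) (kappa t : R)
    (t_gt0 : 0 < t) (kappa_gtN1 : -1 < kappa) (kappa_lt1 : kappa < 1) :
  Sigma kappa t = psi_dom kappa t /\
  set_bij (Lambda kappa t) (@unit_disc R) (psi kappa t).
Proof.
have kappa2 : kappa ^+ 2 < 1.
  by rewrite -real_normK ?num_real // expr_lt1 // ltr_norml kappa_gtN1.
split; first exact: Sigma_dom.
split.
- by move=> z; exact: psi_maps.
- by move=> z1 z2; rewrite !inE => L1 L2; exact: psi_inj_Lambda.
- by move=> p /(psi_surj kappa2 t_gt0)[z Lz e]; exists z.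
Qed.
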